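(* Let $(\mathcal{A},H,D)$ be a twisted spectral triple with twisting $\theta$, and put $\Delta=D^2+1$, considered as an abstract Laplace operator of order $r=2$. (1) If $\mathcal{A}$ admits a compatible twisted algebra of DOs $\mathcal{D}$ (with respect to $\Delta$) such that $[D,\mathcal{A}]_\theta\subseteq\mathcal{D}^0$ and such that $\theta$ is diagonalizable with positive spectrum on $\mathcal{D}$, then $(\mathcal{A},H,D)$ is regular. Moreover, $\mathcal{A}$ admits a compatible twisted algebra of $\Psi$DOs. (2) Conversely, if $(\mathcal{A},H,D)$ is regular, then $\mathcal{A}$ admits a compatible twisted algebra of DOs $\mathcal{D}$ with $[D,\mathcal{A}]_\theta\subseteq\mathcal{D}^0$.
   Context: **Twisted commutators.** $[a,b]_\theta:=ab-\theta(b)a$. **Twisted spectral triple.** A triple $(\mathcal{A},H,D)$ consisting of a unital $*$-algebra $\mathcal{A}$ with an algebra automorphism $\theta$ (the twisting), represented by bounded operators on a Hilbert space $H$, together with an unbounded self-adjoint operator $D$ on $H$ with compact resolvent such that $[D,a]_\theta$ is densely defined and bounded for all $a\in\mathcal{A}$. **Regular.** The twisted spectral triple is regular if there is an algebra $\mathcal{B}\subseteq\mathbb{L}(H)$ of bounded operators containing both $\mathcal{A}$ and $[D,\mathcal{A}]_\theta$, equipped with an extension of $\theta$ to a linear (not necessarily multiplicative) isomorphism of $\mathcal{B}$, such that $\mathcal{B}$ is invariant under $\delta_\theta:=[|D|,\cdot]_\theta$. **Abstract Laplace operator.** $\Delta$ is a strictly positive self-adjoint operator with nominal order $r$ (here $\Delta=D^2+1$,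 $r=2$). Put $H^\infty=\bigcap_{n\ge0}\mathrm{dom}(\Delta^n)$, and for $s\in\mathbb{R}$ let $H^s$ be the completion of $H^\infty$ for $\langle\eta,\xi\rangle_s=\langle\Delta^{s/r}\eta,\Delta^{s/r}\xi\rangle$. $\mathrm{Op}^t$ is the set of linear maps $H^\infty\to H^\infty$ extending to bounded maps $H^s\to H^{s-t}$ for every $s\in\mathbb{R}$; $\mathrm{Op}=\bigcup_t\mathrm{Op}^t$. **Twisted algebra of DOs.** An $\mathbb{N}$-filtered algebra $\mathcal{D}=\bigcup_{m}\mathcal{D}^m$ of linear operators on $H^\infty$ with a filtration-preserving linear (not necessarily multiplicative) automorphism $\theta$ such that (i) $[\Delta,\cdot]_{\theta^r}$ maps $\mathcal{D}^m$ into $\mathcal{D}^{m+r-1}$ for all $m$; (ii) for every $X\in\mathcal{D}^m$ there is $C>0$ with $\|Xv\|_H\le C\|\Delta^{m/r}v\|_H$ for all $v\in H^\infty$. It is compatible with $\mathcal{A}$ if $\mathcal{A}\subseteq\mathcal{D}^0$ and its twisting extends that of $\mathcal{A}$ (in particular $\mathcal{A}$ preserves $H^\infty$). **Twisted algebra of $\Psi$DOs.** An $\mathbb{R}$-filtered subalgebra $\Psi=\bigcup_{t}\Psi^t$ of $\mathrm{Op}$ with a complex one-parameter family $(\Theta^z)_{z\in\mathbb{C}}$ of filtration-preserving algebra automorphisms ($\Theta=\Theta^1$) such that (i) $\Delta^z\Psi\subseteq\Psi$ and $\Psi\Delta^z\subseteq\Psi$ for all $z$, where moreover $\Delta^{z/r}\Psi^t=\Psi^{\mathrm{Re}(z)+t}=\Psi^t\Delta^{z/r}$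 for all $z\in\mathbb{C},t\in\mathbb{R}$; (ii) $[\Delta^{z/r},\Psi^t]_{\Theta^z}\subseteq\Psi^{\mathrm{Re}(z)+t-1}$ for all $z,t$; (iii) $\Psi^0\subseteq\mathrm{Op}^0$. It is compatible with $\mathcal{A}$ if $\mathcal{A}\subseteq\Psi^0$ and $\Theta(a)-\theta(a)\in\Psi^{-1}$ for all $a\in\mathcal{A}$. **Diagonalizable with positive spectrum.** $\mathcal{D}$ is the algebraic direct sum of the eigenspaces of $\theta$, and all eigenvalues are strictly positive reals. *)

(* Defs.v *)
From HB Require Import structures.
From mathcomp Require Import all_boot all_order all_algebra.
From mathcomp Require Import all_classical all_reals all_analysis.
From mathcomp Require Import sesquilinear complex.

Set Implicit Arguments.
Unset Strict Implicit.
Unset Printing Implicit Defensive.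

Import Order.TTheory GRing.Theory Num.Theory.
Import numFieldNormedType.Exports.

Local Open Scope classical_set_scope.
Local Open Scope ring_scope.
Local Open Scope complex_scope.

(** * Unbounded operators, as graphs

  An unbounded operator is represented by its graph, a linear subspace of
  [H * H]: [T v w] means that [v] is in the domain and that [T v = w].
  Single-valuedness is not part of the structure; it is automatic for the
  self-adjoint operators below (the adjoint of a densely defined operator is
  single-valued), and for their functions when the resolvent is compact. *)

Structure linop (K : numFieldType) (H : lmodType K) := LinOp {
  graph :> H -> H -> Prop ;
  graph0 : graph 0 0 ;
  graph_lin : forall k v w v' w',
    graph v w -> graph v' w' -> graph (k *: v + v') (k *: w + w') }.

Section UnboundedOperators.
Variables (K : numFieldType) (H : lmodType K).
Implicit Types S T : linop H.

Definition dom T : set H := [set v | exists w, T v w].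

Definition op_id : linop H.
Proof.
by exists (fun v w => w = v) => // k v w v' w' -> ->.
Defined.

Definition op_comp S T : linop H.
Proof.
exists (fun v w => exists2 u, T v u & S u w); first by exists 0; exact: graph0.
by move=> k v w v' w' [u ? ?] [u' ? ?]; exists (k *: u + u'); exact: graph_lin.
Defined.

Definition op_add S T : linop H.
Proof.
exists (fun v w => exists w1 w2, [/\ S v w1, T v w2 & w = w1 + w2]).
  by exists 0, 0; split; [exact: graph0|exact: graph0|rewrite addr0].
move=> k v w v' w' [w1 [w2 [? ? ->]]] [w1' [w2' [? ? ->]]].
exists (k *: w1 + w1'), (k *: w2 + w2'); split; [exact: graph_lin..|].
by rewrite scalerDr addrACA.
Defined.

Definition op_pow T (n : nat) : linop H := iter n (op_comp T) op_id.

(** [c] is the extension of the twisted commutator [T a - b T] (with [b] the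
  twist of [a]) from [dom T] to [H]; in particular [a] preserves [dom T]. *)
Definition twisted_comm T (a b c : H -> H) : Prop :=
  forall v w, T v w -> exists2 u, T (a v) u & u - b w = c v.

(** The space [H^oo], the intersection of the domains of the [T ^ n]. *)
Definition smooth_set T : set H := \bigcap_(n in setT) dom (op_pow T n).

Definition smooth_pred T : {pred H} := fun v => v \in smooth_set T.

Lemma smooth_submod_closed T : submod_closed (smooth_pred T).
Proof.
split=> [|k v v' /set_mem sv /set_mem sv']; apply/mem_set => n _.
  by exists 0; exact: graph0.
have [w vw] := sv n I; have [w' vw'] := sv' n I.
by exists (k *: w + w'); exact: graph_lin.
Qed.

HB.instance Definition _ T :=
  GRing.isSubmodClosed.Build K H (smooth_pred T) (smooth_submod_closed T).

Structure smooth T := Smooth { smooth_val :> H ; _ : smooth_pred T smooth_val }.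
HB.instance Definition _ T := [isSub for @smooth_val T].
HB.instance Definition _ T := [Choice of smooth T by <:].
HB.instance Definition _ T := [SubChoice_isSubLmodule of smooth T by <:].

(** The restriction of an operator [S] to [H^oo(T)], meaningful when [S] is
  single-valued and maps [H^oo(T)] to itself. *)
Definition on_smooth T (S : linop H) : smooth T -> smooth T :=
  fun v => xget 0 [set w : smooth T | S v w].

(** [X] is the restriction to [H^oo(T)] of the everywhere defined map [a]. *)
Definition restricts T (a : H -> H) (X : smooth T -> smooth T) : Prop :=
  forall v : smooth T, a v = X v :> H.

End UnboundedOperators.

Section HilbertSpace.
Variables (R : realType) (H : completeNormedModType R[i]).
Variable ip : {dot H for @conjc R}.
Implicit Types T : linop H.

Definition bounded_op (a : H -> H) : Prop :=
  linear a /\ exists M : R[i], forall v, `|a v| <= M * `|v|.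

Definition compact_op (a : H -> H) : Prop :=
  linear a /\ compact (closure (a @` [set v | `|v| <= 1])).

Definition self_adjoint T : Prop :=
  dense (dom T) /\
  forall x y, T x y <-> (forall v w, T v w -> ip w x = ip v y).

(** Compactness of [(T - z)^-1] for one [z] in the resolvent set. *)
Definition compact_resolvent T : Prop :=
  exists z (k : H -> H),
    [/\ forall v, T (k v) (v + z *: k v),
        forall v w, T v w -> k (w - z *: v) = v
      & compact_op k].

(** Functional calculus [f(T)] of a self-adjoint operator with compact
  resolvent: such a [T] has an orthonormal basis of eigenvectors, and [f(T)]
  is the closed operator with [f(T) e = f(lam) e] if [T e = lam e], on its
  maximal domain.  Thus [f(T) v = w] iff the component of [w] along each
  eigenvector [e] is [f(lam)] times that of [v]; by Parseval, such a [w] exists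
  iff [sum_lam |f(lam)|^2 |P_lam v|^2] is finite. *)
Definition fcalc (f : R -> R[i]) T : linop H.
Proof.
exists (fun v w => forall (lam : R) (e : H),
  T e (lam%:C *: e) -> ip w e = f lam * ip v e).
  by move=> lam e _; rewrite !linear0l mulr0.
move=> k v w v' w' vw vw' lam e Te.
by rewrite !linearPl /= (vw _ _ Te) (vw' _ _ Te) mulrDr mulrCA.
Defined.

Definition abs_op T : linop H := fcalc (fun x => `|x|%:C) T.

(** [x ^ z = exp (z * ln x)] for [x > 0] and [z] complex. *)
Definition cpow (x : R) (z : R[i]) : R[i] :=
  (expR (complex.Re z * ln x))%:C *
  (cos (complex.Im z * ln x) +i* sin (complex.Im z * ln x)).

Definition pow_op T (z : R[i]) : linop H := fcalc (cpow ^~ z) T.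

(** * Operators on [H^oo] for an abstract Laplace operator [L] of order [r] *)

Section Laplace.
Variables (L : linop H) (r : nat).
Let E := smooth L.
Implicit Types (X Y : E -> E) (s t : R) (z : R[i]).

Definition Lpow z : E -> E := on_smooth (pow_op L z).

Definition sobolev_norm s (v : E) : R[i] := `|smooth_val (Lpow (s / r%:R)%:C v)|.

(** A linear map of [H^oo] extends to a bounded map of the completions
  [H^s -> H^(s - t)] iff it is bounded for their norms. *)
Definition Op t : set (E -> E) :=
  [set X | linear X /\
    forall s, exists M : R[i], forall v,
      sobolev_norm (s - t) (X v) <= M * sobolev_norm s v].

Definition total I (F : I -> set (E -> E)) : set (E -> E) :=
  \bigcup_(i in setT) F i.

Record filtered_algebra I (le : rel I) (add : I -> I -> I)
    (F : I -> set (E -> E)) : Prop := {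
  filt_linear : forall i X, F i X -> linear X ;
  filt_zero : forall i, F i 0 ;
  filt_lin : forall i (k : R[i]) X Y, F i X -> F i Y -> F i (k *: X + Y) ;
  filt_mono : forall i j, le i j -> F i `<=` F j ;
  filt_mul : forall i j X Y, F i X -> F j Y -> F (add i j) (X \o Y) }.

Record filtered_linear_auto I (F : I -> set (E -> E))
    (th : (E -> E) -> (E -> E)) : Prop := {
  auto_lin : forall (k : R[i]) X Y, total F X -> total F Y ->
    th (k *: X + Y) = k *: th X + th Y ;
  auto_bij : set_bij (total F) (total F) th ;
  auto_filt : forall i, th @` F i = F i }.

Record twisted_DO (F : nat -> set (E -> E)) (th : (E -> E) -> (E -> E)) : Prop := {
  DO_alg : filtered_algebra leq addn F ;
  DO_twist : filtered_linear_auto F th ;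
  DO_comm : forall m X, F m X ->
    F (m + r - 1)%N ((on_smooth L \o X) - (iter r th X \o on_smooth L)) ;
  DO_bound : forall m X, F m X -> exists2 M : R[i], 0 < M &
    forall v, `|smooth_val (X v)| <= M * sobolev_norm m%:R v }.

Record twisted_PsiDO (F : R -> set (E -> E))
    (Th : R[i] -> (E -> E) -> (E -> E)) : Prop := {
  Psi_alg : filtered_algebra (fun s t => s <= t) (fun s t => s + t) F ;
  Psi_Op : total F `<=` total Op ;
  Psi_auto : forall z, filtered_linear_auto F (Th z) ;
  Psi_autoM : forall z X Y, total F X -> total F Y ->
    Th z (X \o Y) = Th z X \o Th z Y ;
  Psi_autoD : forall z z' X, total F X -> Th (z + z') X = Th z (Th z' X) ;
  Psi_powl : forall z X, total F X -> total F (Lpow z \o X) ;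
  Psi_powr : forall z X, total F X -> total F (X \o Lpow z) ;
  Psi_shiftl : forall z t,
    [set Lpow (z / r%:R) \o X | X in F t] = F (complex.Re z + t) ;
  Psi_shiftr : forall z t,
    [set X \o Lpow (z / r%:R) | X in F t] = F (complex.Re z + t) ;
  Psi_comm : forall z t X, F t X ->
    F (complex.Re z + t - 1) ((Lpow (z / r%:R) \o X) - (Th z X \o Lpow (z / r%:R))) ;
  Psi_zero : F 0 `<=` Op 0 }.

(** Each [X] is a finite sum of eigenvectors of [th] (the sum of the
  eigenspaces is automatically direct), and all eigenvalues are positive; in
  [R[i]], [0 < lam] entails that [lam] is real. *)
Definition diagonalizable_pos (F : nat -> set (E -> E))
    (th : (E -> E) -> (E -> E)) : Prop :=
  (forall X, total F X ->
    exists n (Y : 'I_n -> E -> E) (lam : 'I_n -> R[i]),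
      (forall i, total F (Y i) /\ th (Y i) = lam i *: Y i) /\
      X = \sum_i Y i) /\
  (forall (lam : R[i]) X, total F X -> X <> 0 -> th X = lam *: X -> 0 < lam).

End Laplace.

(** * Twisted spectral triples *)

Section Triples.
Variable A : algType R[i].

Record twisted_spectral_triple (star : A -> A) (theta : {lrmorphism A -> A})
    (pi : A -> H -> H) (D : linop H) : Prop := {
  ip_norm : forall v : H, `|v| ^+ 2 = ip v v ;
  starK : involutive star ;
  star_lin : forall (k : R[i]) a b, star (k *: a + b) = k^* *: star a + star b ;
  starM : forall a b, star (a * b) = star b * star a ;
  theta_bij : bijective theta ;
  pi_bounded : forall a, bounded_op (pi a) ;
  pi_lin : forall (k : R[i]) a b v, pi (k *: a + b) v = k *: pi a v + pi b v ;
  pi1 : forall v, pi 1 v = v ;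
  piM : forall a b v, pi (a * b) v = pi a (pi b v) ;
  pi_star : forall a v w, ip (pi a v) w = ip v (pi (star a) w) ;
  D_self_adjoint : self_adjoint D ;
  D_compact_resolvent : compact_resolvent D ;
  D_comm : forall a, exists2 c, bounded_op c & twisted_comm D (pi a) (pi (theta a)) c }.

Variables (theta : A -> A) (pi : A -> H -> H) (D : linop H).

(** [[D, A]_theta], as a set of bounded operators on [H]. *)
Definition D_commutators : set (H -> H) :=
  [set c | bounded_op c /\ exists a, twisted_comm D (pi a) (pi (theta a)) c].

Definition regular : Prop :=
  exists (B : set (H -> H)) (thB : (H -> H) -> (H -> H)),
    [/\ B `<=` bounded_op,
        (forall (k : R[i]) a b, B a -> B b -> B (k *: a + b)) /\
          (forall a b, B a -> B b -> B (a \o b)),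
        (forall a, B (pi a)) /\ D_commutators `<=` B,
        [/\ forall (k : R[i]) a b, B a -> B b -> thB (k *: a + b) = k *: thB a + thB b,
            set_bij B B thB & forall a, thB (pi a) = pi (theta a)]
      & forall b, B b -> exists2 c, B c & twisted_comm (abs_op D) b (thB b) c].

Definition laplacian : linop H := op_add (op_comp D D) (op_id H).

Let E := smooth laplacian.

Definition DO_compatible (F : nat -> set (E -> E)) (th : (E -> E) -> (E -> E)) : Prop :=
  forall a, exists X Y : E -> E,
    [/\ restricts (pi a) X, restricts (pi (theta a)) Y, F 0%N X & th X = Y].

(** The restrictions to [H^oo] of the elements of [[D, A]_theta] are in [F 0]. *)
Definition DO_contains_commutators (F : nat -> set (E -> E)) : Prop :=
  forall c, D_commutators c -> exists2 X : E -> E, restricts c X & F 0%N X.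

Definition PsiDO_compatible (F : R -> set (E -> E))
    (Th : R[i] -> (E -> E) -> (E -> E)) : Prop :=
  forall a, exists X Y : E -> E,
    [/\ restricts (pi a) X, restricts (pi (theta a)) Y, F 0 X & F (-1) (Th 1 X - Y)].

End Triples.
End HilbertSpace.

(* Main.v *)
(** An orthonormal eigenbasis of [D] turns every function of [D] into a
  diagonal operator.  For the pseudodifferential calculus take the operators
  of order [t] themselves, with [Theta^z] the conjugation by [Delta^(z/2)]: the
  twisted commutators then vanish identically, and compatibility says that
  [Delta^(1/2) a - theta(a) Delta^(1/2)] has order 0.  For the differential
  operators take those of order [m], with a linear twist which extends [theta]
  and differs from that conjugation by operators of order -1; such a twist is
  found by linear algebra, and it also acts on the bounded operators of order
  0, which yields regularity.  Both parts thus reduce to showing that [a] and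
  [[D, a]_theta] have order 0 and that [Delta^(1/2) a - theta(a) Delta^(1/2)]
  does.

  From a twisted algebra of differential operators, commuting with powers of
  [Delta] bounds [X] of order [m] from [H^s] to [H^(s-m)] for [s - m] an even
  integer, and interpolation gives all [s].  If [theta(Y) = l Y], then
  [W = Delta^(1/2) Y - l Y Delta^(1/2)] solves the Sylvester equation
  [Delta^(1/2) W + l W Delta^(1/2) = Delta Y - l^2 Y Delta], whose solution
  gains one order because [l > 0].  Interpolation and Sylvester equation are
  both handled by cutting operators into blocks along the spectral
  decomposition [e^n <= Delta < e^(n+1)].  From regularity, the same bounds
  follow by commuting with powers of [|D|]. *)

Require Import Defs.
From mathcomp Require Import all_boot all_order all_algebra.
From mathcomp Require Import all_classical all_reals all_analysis.
From mathcomp Require Import sesquilinear complex.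
From mathcomp Require Import ring lra.

Set Implicit Arguments.
Unset Strict Implicit.
Unset Printing Implicit Defensive.

Import Order.TTheory GRing.Theory Num.Theory.
Import numFieldNormedType.Exports.
Local Open Scope classical_set_scope.
Local Open Scope ring_scope.
Local Open Scope complex_scope.

(** * Hilbert space preliminaries *)

(** Conjugation by [Delta^(1/2)] cannot itself serve as the twist of the differential operators: it
    agrees with [theta] on the algebra only modulo order -1, while compatibility there asks for
    equality. A correction of order -1 is harmless, since composed with [Delta] it has order 1,
    within the allowed order [m + 1] for every [m]. Making it while keeping linearity and
    bijectivity is a matter of complements of subspaces, with no continuity asked.

    The axioms for differential operators bound [X] only from [H^m] to [H^0]. Neither they nor
    regularity make the algebra stable under adjoints, so negative exponents cannot be reached by
    duality; they get their own commutation argument, which relies on the surjectivity of the twist.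

    The commutator with [Delta] involves the square of the twist, so on an eigenvector it sees only
    [l^2]. Positivity selects the root [l] and keeps the spectra of [Delta^(1/2)] and
    [- l Delta^(1/2)] apart, which is what makes the Sylvester equation solvable. *)

Section ComplexModulus.
Variable R : realType.
Implicit Types x y : R[i].

(** The order of [R[i]] is partial and its norm is [R[i]]-valued; estimates are made in [R], with
    this squared modulus and with [rn] below. *)
Definition nsq x : R := complex.Re x ^+ 2 + complex.Im x ^+ 2.

Lemma nsq_ge0 x : 0 <= nsq x.
Proof. by rewrite addr_ge0 ?sqr_ge0. Qed.

Lemma nsqE x : (nsq x)%:C = `|x| ^+ 2.
Proof. by rewrite -add_Re2_Im2. Qed.

Lemma nsqM x y : nsq (x * y) = nsq x * nsq y.
Proof. by apply: complexI; rewrite rmorphM /= !nsqE normrM exprMn. Qed.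

Lemma nsqR (a : R) : nsq a%:C = a ^+ 2.
Proof. by rewrite /nsq /= expr0n addr0. Qed.

Lemma nsq0 : nsq 0 = 0.
Proof. by rewrite /nsq /= expr0n addr0. Qed.

Lemma nsq1 : nsq 1 = 1.
Proof. by rewrite /nsq /= expr0n addr0 expr1n. Qed.

Lemma nsqN x : nsq (- x) = nsq x.
Proof. by apply: complexI; rewrite !nsqE normrN. Qed.

Lemma nsqJ x : nsq (conjc x) = nsq x.
Proof. by case: x => a b; rewrite /nsq /= sqrrN. Qed.

Lemma nsq_eq0 x : (nsq x == 0) = (x == 0).
Proof.
by rewrite -(inj_eq (@complexI R)) nsqE sqrf_eq0 normr_eq0.
Qed.

Lemma mulcJ x : x * conjc x = (nsq x)%:C.
Proof. by rewrite nsqE sqr_normc. Qed.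

Lemma conjcM x y : conjc (x * y) = conjc x * conjc y.
Proof. exact: rmorphM. Qed.

Lemma nsqD_le x y : nsq (x + y) <= 2 * nsq x + 2 * nsq y.
Proof.
case: x y => [a b] [c d]; rewrite /nsq /=.
by rewrite -subr_ge0 (_ : _ - _ = (a - c) ^+ 2 + (b - d) ^+ 2) ?addr_ge0 ?sqr_ge0 //; ring.
Qed.

End ComplexModulus.

Section HilbertNorm.
Variables (R : realType) (H : completeNormedModType R[i]).
Implicit Types (u v w : H) (s : nat -> H).

Definition rn v : R := complex.Re `|v|.

Lemma rnE v : `|v| = (rn v)%:C.
Proof. by rewrite RRe_real // normr_real. Qed.

Lemma rn_ge0 v : 0 <= rn v.
Proof. by rewrite -ler0c -rnE. Qed.

Lemma rnD u v : rn (u + v) <= rn u + rn v.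
Proof. by rewrite -lecR rmorphD /= -!rnE ler_normD. Qed.

Lemma rnN v : rn (- v) = rn v.
Proof. by rewrite /rn normrN. Qed.

Lemma rn0 : rn 0 = 0.
Proof. by rewrite /rn normr0. Qed.

Lemma rn_eq0 v : (rn v == 0) = (v == 0).
Proof. by rewrite -(inj_eq (@complexI R)) -rnE normr_eq0. Qed.

Lemma rnZ2 k v : rn (k *: v) ^+ 2 = nsq k * rn v ^+ 2.
Proof.
apply: complexI; rewrite [RHS](rmorphM (real_complex R)) /= nsqE.
by rewrite !(rmorphXn (real_complex R)) /= -!rnE normrZ exprMn.
Qed.

Lemma rnZ_real (a : R) v : rn (a%:C *: v) = `|a| * rn v.
Proof.
apply/eqP; rewrite -(@eqrXn2 _ 2) ?mulr_ge0 ?rn_ge0 //.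
by rewrite rnZ2 nsqR exprMn real_normK ?num_real.
Qed.

Lemma rn_distC u v : rn (u - v) = rn (v - u).
Proof. by rewrite -rnN opprB. Qed.

Lemma rn_tri u v w : rn (u - w) <= rn (u - v) + rn (v - w).
Proof. by rewrite -[X in rn X <= _](subrKA v) rnD. Qed.

Definition cvgs s v :=
  forall e : R, 0 < e -> exists N, forall n, (N <= n)%N -> rn (s n - v) <= e.

Lemma cvgs_unique s u v : cvgs s u -> cvgs s v -> u = v.
Proof.
move=> su sv; apply/eqP; rewrite -subr_eq0 -rn_eq0 eq_le rn_ge0 andbT.
apply/ler_addgt0Pr => e e0; rewrite add0r.
have e20 : 0 < e / 2 by rewrite divr_gt0.
have [N hN] := su _ e20; have [M hM] := sv _ e20.
apply: (le_trans (rn_tri u (s (maxn N M)) v)).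
rewrite rn_distC (splitr e) lerD ?hN ?hM ?leq_maxl ?leq_maxr //.
Qed.

Lemma cvgsD s t u v : cvgs s u -> cvgs t v -> cvgs (fun n => s n + t n) (u + v).
Proof.
move=> su tv e e0; have e20 : 0 < e / 2 by rewrite divr_gt0.
have [N hN] := su _ e20; have [M hM] := tv _ e20.
exists (maxn N M) => n; rewrite geq_max => /andP[nN nM].
by rewrite opprD addrACA (le_trans (rnD _ _)) // (splitr e) lerD ?hN ?hM.
Qed.

Lemma cvgs_bound s t u (C : R) (f : H -> H) :
  (forall v w, rn (f v - f w) <= C * rn (v - w)) ->
  (forall n, s n = f (t n)) -> cvgs t u -> cvgs s (f u).
Proof.
move=> hf st tu e e0.
have C0 : 0 < `|C| + 1 by rewrite ltr_pwDr.
have [N hN] := tu (e / (`|C| + 1)) (divr_gt0 e0 C0).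
exists N => n /hN h; rewrite st (le_trans (hf _ _)) //.
have := ler_norm C.
move: h; rewrite ler_pdivlMr // => h hC.
by have := rn_ge0 (t n - u); nra.
Qed.

Lemma cvgs_rn_le s v (C : R) : cvgs s v -> (forall n, rn (s n) <= C) -> rn v <= C.
Proof.
move=> sv sC; apply/ler_addgt0Pr => e /sv[N hN].
rewrite -(subrK (s N) v) (le_trans (rnD _ _)) // addrC lerD //.
by rewrite rn_distC hN.
Qed.

Lemma complete_cvgs s :
  (forall e : R, 0 < e -> exists N, forall m n, (N <= m)%N -> (N <= n)%N ->
     rn (s m - s n) <= e) -> exists v, cvgs s v.
Proof.
move=> hs.
have sc : cvg (s @ \oo).
  apply/cauchy_cvgP/cauchy_exP => e e0.
  have e0' : e = (complex.Re e)%:C by rewrite RRe_real ?gtr0_real.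
  have er0 : 0 < complex.Re e by rewrite -ltcR -e0'.
  have [N hN] := hs (complex.Re e / 2) (divr_gt0 er0 (ltr0Sn _ _)).
  exists (s N); exists N => // n /= Nn.
  rewrite /ball_ /= -ball_normE /= rnE e0' ltcR.
  by rewrite (le_lt_trans (hN _ _ _ _)) // ltr_pdivrMr // ltr_pMr // ltr1n.
exists (lim (s @ \oo)) => e e0.
have e0' : 0 < e%:C by rewrite ltcR.
have /cvgrPdist_le /(_ _ e0') [N _ hN] := sc.
by exists N => n /hN /=; rewrite rnE lecR rn_distC.
Qed.

Lemma dense_approx (A : set H) v (e : R) : dense A -> 0 < e ->
  exists2 w, A w & rn (w - v) < e.
Proof.
move=> dA e0; have e0' : 0 < e%:C by rewrite ltcR.
have := dA (ball v e%:C); case.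
- by exists v; exact: ballxx.
- exact: ball_open.
by move=> w [] /=; rewrite -ball_normE /= rnE ltcR rn_distC => ? ?; exists w.
Qed.

End HilbertNorm.

Section InnerProduct.
Variables (R : realType) (H : completeNormedModType R[i]).
Variable ip : {dot H for @conjc R}.
Hypothesis ip_norm : forall v : H, `|v| ^+ 2 = ip v v.
Implicit Types (u v w x y : H) (s : nat -> H).

Lemma ipC x y : ip x y = conjc (ip y x).
Proof. by rewrite (hermC ip x y) expr0 mul1r. Qed.

Lemma ipZr k x y : ip x (k *: y) = conjc k * ip x y.
Proof. by rewrite linearZr_LR. Qed.

Lemma ipZl k x y : ip (k *: x) y = k * ip x y.
Proof. by rewrite linearZl_LR. Qed.

Lemma ip0l y : ip 0 y = 0.
Proof. by rewrite linear0l. Qed.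

Lemma ip0r x : ip x 0 = 0.
Proof. by rewrite linear0r. Qed.

Lemma ipDl x y z : ip (x + y) z = ip x z + ip y z.
Proof. by rewrite linearDl. Qed.

Lemma ipDr x y z : ip z (x + y) = ip z x + ip z y.
Proof. by rewrite linearDr. Qed.

Lemma ipBl x y z : ip (x - y) z = ip x z - ip y z.
Proof. by rewrite linearBl. Qed.

Lemma ip_self v : ip v v = (rn v ^+ 2)%:C.
Proof. by rewrite -ip_norm rnE rmorphXn. Qed.

Lemma ip_eq0 v : (ip v v == 0) = (v == 0).
Proof. by rewrite -ip_norm sqrf_eq0 normr_eq0. Qed.

Lemma rnD2 u v : rn (u + v) ^+ 2 = rn u ^+ 2 + rn v ^+ 2 + 2 * complex.Re (ip u v).
Proof.
apply: complexI; rewrite -ip_self ipDl !ipDr (ipC v u) !(rmorphD (real_complex R)) /=.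
rewrite -!ip_self (rmorphM (real_complex R)) /= (rmorph_nat (real_complex R)) -addcJ.
ring.
Qed.

Lemma parallelogram u v :
  rn (u + v) ^+ 2 + rn (u - v) ^+ 2 = 2 * (rn u ^+ 2 + rn v ^+ 2).
Proof.
rewrite !rnD2 rnN linearNr raddfN /=; ring.
Qed.

Lemma pythagoras u v : ip u v = 0 -> rn (u + v) ^+ 2 = rn u ^+ 2 + rn v ^+ 2.
Proof. by move=> uv; rewrite rnD2 uv mulr0 addr0. Qed.

Lemma cauchy_schwarz u v : nsq (ip u v) <= rn u ^+ 2 * rn v ^+ 2.
Proof.
have [->|v0] := eqVneq v 0; first by rewrite linear0r nsq0 rn0 expr0n mulr0.
have nv0 : 0 < rn v ^+ 2 by rewrite exprn_gt0 // lt_neqAle rn_ge0 andbT eq_sym rn_eq0.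
pose k := ip u v / ip v v.
have o : ip (u - k *: v) (k *: v) = 0.
  by rewrite ipZr ipBl ipZl divfK ?subrr ?mulr0 // ip_eq0.
have := pythagoras o; rewrite subrK rnZ2 => ->.
rewrite mulrDl; apply: ler_wpDl; first by rewrite mulr_ge0 ?sqr_ge0.
have -> : nsq k = nsq (ip u v) * (rn v ^+ 2) ^- 2.
  by rewrite /k nsqM (ip_self v) -fmorphV /= nsqR exprVn.
move: nv0; set t := rn v ^+ 2 => t0.
by rewrite le_eqVlt; apply/orP; left; apply/eqP; field; rewrite gt_eqF.
Qed.

(** Two sequences and two fixed vectors at once: identities of this shape cut out the graph of an
    adjoint, and with the constant sequence 0 they give closed orthogonal complements. *)
Lemma ip_limit s s' u u' x y :
  (forall n, ip (s n) x = ip (s' n) y) -> cvgs s u -> cvgs s' u' ->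
  ip u x = ip u' y.
Proof.
move=> ss su su'; apply/eqP; rewrite -subr_eq0 -nsq_eq0 eq_le nsq_ge0 andbT.
apply/ler_addgt0Pr => e e0; rewrite add0r.
(* The factors of the two Cauchy-Schwarz bounds, plus 1 to exclude zero; [d] is then chosen so that
   [d ^+ 2 * c = e]. *)
pose c := 2 * rn x ^+ 2 + 2 * rn y ^+ 2 + 1.
have c0 : 0 < c by rewrite ltr_wpDl // addr_ge0 // mulr_ge0 // sqr_ge0.
pose d := Num.sqrt (e / c).
have d0 : 0 < d by rewrite sqrtr_gt0 divr_gt0.
have [N hN] := su _ d0; have [M hM] := su' _ d0.
pose n := maxn N M.
have -> : ip u x - ip u' y = ip (u - s n) x + - ip (u' - s' n) y.
  by rewrite !ipBl ss; ring.
apply: (le_trans (nsqD_le _ _)); rewrite nsqN.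
have h1 := cauchy_schwarz (u - s n) x.
have h2 := cauchy_schwarz (u' - s' n) y.
have d2 : d ^+ 2 * c = e by rewrite sqr_sqrtr ?divfK ?gt_eqF // ltW // divr_gt0.
have l1 : rn (u - s n) ^+ 2 <= d ^+ 2.
  by rewrite ler_sqr ?nnegrE ?rn_ge0 ?(ltW d0) // rn_distC hN ?leq_maxl.
have l2 : rn (u' - s' n) ^+ 2 <= d ^+ 2.
  by rewrite ler_sqr ?nnegrE ?rn_ge0 ?(ltW d0) // rn_distC hM ?leq_maxr.
have := ler_wpM2r (sqr_ge0 (rn x)) l1.
have := ler_wpM2r (sqr_ge0 (rn y)) l2.
rewrite -d2 /c; nra.
Qed.

End InnerProduct.

Lemma bounded_psum_cauchy (R : realType) (f : nat -> R) (C : R) :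
  (forall i, 0 <= f i) -> (forall n, \sum_(i < n) f i <= C) ->
  forall e, 0 < e -> exists N, forall n, (N <= n)%N ->
    \sum_(i < n) f i <= \sum_(i < N) f i + e.
Proof.
move=> f0 fC e e0; pose S := [set \sum_(i < n) f i | n in setT].
have hS : has_sup S.
  by split; [exists (\sum_(i < 0) f i), 0%N|exists C => _ [n _ <-]; exact: fC].
have [_ [N _ <-] hN] := sup_adherent e0 hS.
exists N => n _; rewrite -lerBlDr (le_trans _ (ltW hN)) // lerB //.
by apply: ub_le_sup; [case: hS|exists n].
Qed.

(** * Orthonormal sequences: Bessel's inequality and the Riesz-Fischer theorem *)

Section OrthonormalSequence.
Variables (R : realType) (H : completeNormedModType R[i]).
Variable ip : {dot H for @conjc R}.
Hypothesis ip_norm : forall v : H, `|v| ^+ 2 = ip v v.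
(* Zero entries are allowed, so that one notation covers finite families. *)
Variable e : nat -> H.
Hypothesis e_orth : forall i j, i != j -> ip (e i) (e j) = 0.
Hypothesis e_unit : forall i, e i = 0 \/ ip (e i) (e i) = 1.
Implicit Types (v w x : H) (c : nat -> R[i]).

(** A coefficient at a zero entry of [e] is invisible in the sum but would count in the sum of
    squares. *)
Definition supported c := forall i, e i = 0 -> c i = 0.

Definition psum c n := \sum_(i < n) c i *: e i.

Lemma ip_psum c n j : supported c ->
  ip (psum c n) (e j) = if (j < n)%N then c j else 0.
Proof.
move=> sc; rewrite linear_sumlz /=.
have h i : ip (c i *: e i) (e j) = if i == j then c j else 0.
  rewrite (ipZl ip); case: eqVneq => [->|ij]; last by rewrite e_orth ?mulr0.
  by case: (e_unit j) => [e0|->]; rewrite ?mulr1 // sc ?mul0r.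
under eq_bigr do rewrite h.
rewrite -big_mkcond /=; case: ltnP => jn.
  by rewrite (big_pred1 (Ordinal jn)) // => i; rewrite -val_eqE.
rewrite big_pred0 // => i; apply/negP => /eqP ij.
by move: (ltn_ord i); rewrite ij ltnNge jn.
Qed.

Lemma supported_ip v : supported (fun i => ip v (e i)).
Proof. by move=> i ->; rewrite linear0r. Qed.

Lemma ip_psum_l c n w : ip (psum c n) w = \sum_(i < n) c i * ip (e i) w.
Proof. by rewrite linear_sumlz; apply: eq_bigr => i _ /=; rewrite (ipZl ip). Qed.

Lemma ip_psum_r c n w : ip w (psum c n) = \sum_(i < n) conjc (c i) * ip w (e i).
Proof. by rewrite raddf_sum; apply: eq_bigr => i _ /=; rewrite (ipZr ip). Qed.

Lemma rn_psum_tail c m n : supported c -> (m <= n)%N ->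
  rn (psum c n - psum c m) ^+ 2 = \sum_(i < n) nsq (c i) - \sum_(i < m) nsq (c i).
Proof.
move=> sc mn.
have key k : (m <= k)%N -> rn (psum c k - psum c m) ^+ 2 =
   \sum_(i < k) nsq (c i) - \sum_(i < m) nsq (c i); last exact: key.
move=> /subnK <-; elim: (k - m)%N => [|j IH]; first by rewrite add0n !subrr rn0 expr0n.
rewrite addSn /psum !big_ord_recr /= -/(psum c _) -/(psum c m) addrAC.
rewrite (pythagoras ip_norm); last first.
  rewrite (ipZr ip) (ipBl ip) !ip_psum // ltnn ltnNge leq_addl /=.
  by rewrite subrr mulr0.
rewrite IH rnZ2 addrAC; congr (_ + _).
case: (e_unit (j + m)) => [e0|e1]; first by rewrite sc // nsq0 mul0r.
have := ip_self ip_norm (e (j + m)); rewrite e1 => /complexI.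
by move=> <-; rewrite mulr1.
Qed.

Lemma rn_psum c n : supported c -> rn (psum c n) ^+ 2 = \sum_(i < n) nsq (c i).
Proof.
move=> sc; have := rn_psum_tail sc (leq0n n).
by rewrite /psum !big_ord0 !subr0.
Qed.

Lemma bessel_eq v n :
  rn (v - psum (fun i => ip v (e i)) n) ^+ 2 =
  rn v ^+ 2 - \sum_(i < n) nsq (ip v (e i)).
Proof.
set c := fun i => ip v (e i); have sc : supported c := supported_ip v.
apply/eqP; rewrite eq_sym subr_eq -(rn_psum n sc); apply/eqP.
rewrite -(pythagoras ip_norm) ?subrK //.
rewrite ip_psum_r big1 // => i _; rewrite (ipBl ip) ip_psum // ltn_ord.
by rewrite subrr mulr0.
Qed.

Lemma bessel v n : \sum_(i < n) nsq (ip v (e i)) <= rn v ^+ 2.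
Proof. by rewrite -subr_ge0 -bessel_eq sqr_ge0. Qed.

Lemma riesz_fischer c (C : R) : supported c ->
  (forall n, \sum_(i < n) nsq (c i) <= C) ->
  exists x, [/\ cvgs (psum c) x, forall i, ip x (e i) = c i & rn x ^+ 2 <= C].
Proof.
move=> sc hC.
have [x hx] : exists x, cvgs (psum c) x.
  apply: complete_cvgs => d d0.
  have [N hN] := bounded_psum_cauchy (fun i => nsq_ge0 (c i)) hC (exprn_gt0 2 d0).
  suff h m n : (N <= m)%N -> (m <= n)%N -> rn (psum c n - psum c m) <= d.
    by exists N => m n Nm Nn; case: (leqP m n) => [mn|/ltnW nm];
       [rewrite rn_distC|]; rewrite h.
  move=> Nm mn; rewrite -ler_sqr ?nnegrE ?rn_ge0 ?(ltW d0) // rn_psum_tail //.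
  rewrite lerBlDl (le_trans (hN n _)) ?(leq_trans Nm) // lerD2r.
  rewrite -(subnKC Nm) big_split_ord /= lerDl sumr_ge0 // => i _; exact: nsq_ge0.
exists x; split => //.
- move=> i.
  suff h : ip (x - c i *: e i) (e i) = 0.
    move: h; rewrite (ipBl ip) (ipZl ip) => /eqP; rewrite subr_eq0 => /eqP ->.
    by case: (e_unit i) => [e0|->]; rewrite ?mulr1 // sc ?mul0r.
  (* The shift by [i.+1] makes every partial sum contain the [i]-th term. *)
  rewrite (@ip_limit _ _ ip ip_norm (fun n => psum c (n + i.+1) - c i *: e i)
    (fun=> 0) _ 0 _ (e i)) ?(ip0l ip) //.
  + move=> n /=; rewrite (ipBl ip) ip_psum // ltn_addl // (ipZl ip).
    by case: (e_unit i) => [e0|->]; rewrite ?mulr1 ?subrr // sc ?mul0r ?subr0.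
  + move=> d d0; have [N hN] := hx _ d0; exists N => n Nn.
    by rewrite opprB addrA subrK hN // (leq_trans Nn) ?leq_addr.
  + by move=> d /ltW d0; exists 0%N => n _; rewrite subrr rn0.
- have C0 : 0 <= C by rewrite (le_trans _ (hC 0%N)) // big_ord0.
  rewrite -(sqr_sqrtr C0) ler_sqr ?nnegrE ?rn_ge0 ?sqrtr_ge0 //.
  apply: (cvgs_rn_le hx) => n.
  by rewrite -ler_sqr ?nnegrE ?rn_ge0 ?sqrtr_ge0 // sqr_sqrtr // rn_psum.
Qed.

End OrthonormalSequence.

(** * The spectral theorem for a compact resolvent *)

Section SelfAdjoint.
Variables (R : realType) (H : completeNormedModType R[i]).
Variable ip : {dot H for @conjc R}.
Hypothesis ip_norm : forall v : H, `|v| ^+ 2 = ip v v.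
Variable D : linop H.
Hypothesis D_sa : self_adjoint ip D.
Implicit Types v w x y : H.

Lemma sa_sym x y v w : D x y -> D v w -> ip w x = ip v y.
Proof. by case: D_sa => _ h /h; apply. Qed.

Lemma graphD v w v' w' : D v w -> D v' w' -> D (v + v') (w + w').
Proof. by move=> vw /(graph_lin 1 vw); rewrite !scale1r. Qed.

Lemma graphZ k v w : D v w -> D (k *: v) (k *: w).
Proof. by move=> vw; have := graph_lin k vw (graph0 D); rewrite !addr0. Qed.

Lemma graphB v w v' w' : D v w -> D v' w' -> D (v - v') (w - w').
Proof. by move=> vw vw'; rewrite -(scaleN1r v') -(scaleN1r w'); apply: graphD => //; exact: graphZ. Qed.


(** Symmetry makes [y] orthogonal to the dense domain, and a vector [w] orthogonal to [y] is no
    closer to [y] than 0 is. *)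
Lemma sa_single0 y : D 0 y -> y = 0.
Proof.
move=> D0y.
have yd w : dom D w -> ip y w = 0.
  by move=> [w' ww']; rewrite (ipC ip) -(sa_sym D0y ww') (ip0r ip) conjc0.
apply/eqP; rewrite -rn_eq0 eq_le rn_ge0 andbT; apply/ler_addgt0Pr => e e0.
rewrite add0r; case: D_sa => dD _.
have [w dw wy] := dense_approx y dD e0.
apply: le_trans (ltW wy); rewrite -ler_sqr ?nnegrE ?rn_ge0 //.
have /(pythagoras ip_norm) : ip y (- w) = 0 by rewrite raddfN /= yd ?oppr0.
by rewrite rn_distC => ->; rewrite lerDl sqr_ge0.
Qed.

Lemma sa_closed (s t : nat -> H) x y :
  (forall n, D (s n) (t n)) -> cvgs s x -> cvgs t y -> D x y.
Proof.
move=> st sx ty; apply/(D_sa.2) => v w vw.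
rewrite (ipC ip) (ipC ip v); congr (conjc _).
by apply: (ip_limit ip_norm _ sx ty) => n; rewrite (ipC ip) (sa_sym (st n) vw) -(ipC ip).
Qed.

(** * The compact resolvent [k = (D - z)^-1] and its eigenvectors *)

Section Resolvent.
Variables (z : R[i]) (k : H -> H).
Hypothesis kD : forall v, D (k v) (v + z *: k v).
Hypothesis Dk : forall v w, D v w -> k (w - z *: v) = v.
Hypothesis k_lin : linear k.
Hypothesis k_cpt : compact (closure (k @` [set v | `|v| <= 1])).

Lemma resD u v : k (u + v) = k u + k v.
Proof. by have := k_lin 1 u v; rewrite !scale1r. Qed.

Lemma res0 : k 0 = 0.
Proof. by apply: (addIr (k 0)); rewrite -resD !add0r. Qed.

Lemma resZ a v : k (a *: v) = a *: k v.
Proof. by have := k_lin a v 0; rewrite res0 !addr0. Qed.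

Lemma resB u v : k (u - v) = k u - k v.
Proof. by rewrite resD -scaleN1r resZ scaleN1r. Qed.

(** The only form in which compactness is used below. *)
Lemma res_cluster (v : nat -> H) : (forall n, rn (v n) <= 1) ->
  exists p, forall e : R, 0 < e -> forall N, exists n, (N <= n)%N /\ rn (k (v n) - p) <= e.
Proof.
move=> v1.
have [|p [_ pc]] := k_cpt (F := (k \o v) @ \oo) _.
  exists 0%N => // n _; apply: subset_closure; exists (v n) => //=.
  by rewrite rnE -[1]/(1%:C) lecR.
exists p => e e0 N; have e0' : 0 < e%:C by rewrite ltcR.
have [||q [[n /= Nn <-]]] := pc [set k (v n) | n in [set n | (N <= n)%N]] (ball p e%:C).
- by exists N => // n /= Nn; exists n.
- exact: nbhsx_ballx.
rewrite -ball_normE /= rnE ltcR rn_distC => /ltW h.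
by exists n.
Qed.

(** Otherwise the unit ball would contain vectors with [n%:R < rn (k (v n))], and such images have
    no cluster point. *)
Lemma res_bounded : exists2 M : R, 0 < M & forall v, rn (k v) <= M * rn v.
Proof.
suff [M hM] : exists M : R, forall v, rn v <= 1 -> rn (k v) <= M.
  exists (`|M| + 1) => [|v]; first by rewrite ltr_pwDr.
  have [->|v0] := eqVneq v 0; first by rewrite res0 rn0 mulr0.
  have nv0 : 0 < rn v by rewrite lt_neqAle rn_ge0 andbT eq_sym rn_eq0.
  have := hM ((rn v)^-1%:C *: v).
  rewrite resZ !rnZ_real ger0_norm ?invr_ge0 ?rn_ge0 // mulVf ?gt_eqF //.
  move=> /(_ (lexx _)); rewrite ler_pdivrMl // mulrC => /le_trans; apply.
  by rewrite ler_wpM2r ?rn_ge0 // (le_trans (ler_norm _)) ?lerDl.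
apply/not_existsP => h.
have {h} /choice[v hv] (n : nat) : exists v, rn v <= 1 /\ n%:R < rn (k v).
  have /existsNP[v /not_implyP[v1 /negP nv]] := h n%:R.
  by exists v; rewrite ltNge.
have [p hp] := res_cluster (fun n => (hv n).1).
have [n [nN np]] := hp 1 ltr01 (Num.truncn (rn p + 1)).+1.
have := (hv n).2; apply/negP; rewrite -leNgt.
have := rnD (k (v n) - p) p; rewrite subrK => /le_trans; apply.
rewrite (le_trans (lerD np (lexx _))) // addrC.
apply: (@le_trans _ _ (Num.truncn (rn p + 1)).+1%:R); last by rewrite ler_nat.
by rewrite ltW // truncnS_gt.
Qed.

Lemma res_inj v : k v = 0 -> v = 0.
Proof. by move=> kv; have := kD v; rewrite kv scaler0 addr0; exact: sa_single0. Qed.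

Lemma eigen_res (lam : R) x : x != 0 -> D x (lam%:C *: x) ->
  lam%:C - z != 0 /\ k x = (lam%:C - z)^-1 *: x.
Proof.
move=> x0 Dx; have := Dk Dx; rewrite -scalerBl resZ.
have [->|l0] := eqVneq (lam%:C - z) 0.
  by rewrite scale0r => x00; rewrite -x00 eqxx in x0.
by move=> h; split=> //; rewrite -{2}h scalerA mulVf // scale1r.
Qed.

Definition orthonormal_eigen : set (set H) := [set S |
  (forall x, S x -> ip x x = 1 /\ exists lam : R, D x (lam%:C *: x)) /\
  (forall x y, S x -> S y -> x <> y -> ip x y = 0)].

Lemma maximal_orthonormal_eigen : exists S, orthonormal_eigen S /\
  (forall B, S `<` B -> ~ orthonormal_eigen B).
Proof.
apply: Zorn_bigcup => F FP tF; split => [x [S FS Sx]|x y [S FS Sx] [S' FS' Sy]].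
  exact: (FP _ FS).1.
have [SS'|S'S] := tF _ _ FS FS'.
  by apply: (FP _ FS').2 => //; exact: SS'.
by apply: (FP _ FS).2 => //; exact: S'S.
Qed.

Lemma unit_neq0 x : ip x x = 1 -> x != 0.
Proof. by rewrite -(ip_eq0 ip_norm) => ->; exact: oner_neq0. Qed.

Lemma unit_rn x : ip x x = 1 -> rn x = 1.
Proof.
rewrite (ip_self ip_norm) => /(@complexI R) /eqP.
by rewrite sqrf_eq1 => /orP[/eqP//|/eqP h]; have := rn_ge0 x; rewrite h ler0N1.
Qed.

(* Eigenvectors in [S] with bounded eigenvalue have uniformly separated images
   under the compact operator [k], so there are finitely many of them. *)
Lemma orthonormal_eigen_countable S : orthonormal_eigen S -> countable S.
Proof.
move=> [S1 S2].
pose SN (N : nat) := [set x | S x /\ exists lam : R,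
  D x (lam%:C *: x) /\ nsq (lam%:C - z) <= N%:R].
have -> : S = \bigcup_(N in [set: nat]) SN N.
  apply/seteqP; split => [x Sx|x [N _ []]//].
  have [_ [lam Dx]] := S1 x Sx.
  exists (Num.truncn (nsq (lam%:C - z))).+1 => //; split => //; exists lam; split => //.
  by rewrite ltW // truncnS_gt.
apply: bigcup_countable => // N _; apply: finite_set_countable.
apply: contrapT => /infiniteP /pcard_leP[f].
have Sf n : SN N (f n) by exact: (@funS _ _ _ _ f).
have fI : injective f by move=> i j fij; apply: (@inj _ _ _ f); rewrite ?inE.
have f1 n : rn (f n) <= 1 by have [/S1[/unit_rn -> _] _] := Sf n.
have [p hp] := res_cluster f1.
have N1 : 0 < (N.+1%:R : R) by rewrite ltr0n.
(* Two images near the cluster point lie within [2 * e = N.+1%:R^-1] of each other, whereas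
   orthogonality puts their squared distance above [N.+1%:R^-1], which is at least
   [(2 * e) ^+ 2]. *)
pose e := (2 * N.+1%:R : R)^-1.
have e0 : 0 < e by rewrite invr_gt0 mulr_gt0.
have [i [_ hi]] := hp e e0 0%N.
have [j [ij hj]] := hp e e0 i.+1.
have h : rn (k (f i) - k (f j)) <= 2 * e.
  rewrite (le_trans (rn_tri _ p _)) // [2 * e]mulr_natl mulr2n lerD //.
  by rewrite rn_distC.
have [Si [li [Di hli]]] := Sf i; have [Sj [lj [Dj hlj]]] := Sf j.
have [fi1 _] := S1 _ Si; have [fj1 _] := S1 _ Sj.
have [ni ki] := eigen_res (unit_neq0 fi1) Di.
have [nj kj] := eigen_res (unit_neq0 fj1) Dj.
have : rn (k (f i) - k (f j)) ^+ 2 = (nsq (li%:C - z))^-1 + (nsq (lj%:C - z))^-1.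
  rewrite ki kj -scaleNr (pythagoras ip_norm); last first.
    rewrite (ipZl ip) (ipZr ip) S2 ?mulr0 // => /fI ij'.
    by rewrite ij' ltnn in ij.
  have nsqV (c : R[i]) : c != 0 -> nsq c^-1 = (nsq c)^-1.
    move=> c0; apply: (mulfI (x := nsq c)); first by rewrite nsq_eq0.
    by rewrite -nsqM mulfV // nsq1 mulfV // nsq_eq0.
  by rewrite !rnZ2 nsqN !unit_rn // expr1n !mulr1 !nsqV.
move=> hk; have : rn (k (f i) - k (f j)) ^+ 2 <= (2 * e) ^+ 2.
  by rewrite ler_sqr ?nnegrE ?rn_ge0 // mulr_ge0 // ltW.
apply/negP; rewrite -ltNge hk.
have ->: 2 * e = N.+1%:R^-1 by rewrite /e invfM mulrA divff // mul1r.
have pos (c : R[i]) : c != 0 -> 0 < nsq c.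
  by move=> c0; rewrite lt_neqAle nsq_ge0 andbT eq_sym nsq_eq0.
have lti (c : R[i]) : c != 0 -> nsq c <= N%:R -> N.+1%:R^-1 < (nsq c)^-1.
  move=> c0 cN; rewrite ltf_pV2 ?posrE ?pos // (le_lt_trans cN) // ltr_nat //.
apply: (@lt_le_trans _ _ (nsq (li%:C - z))^-1); last by rewrite lerDl invr_ge0 nsq_ge0.
apply: le_lt_trans (lti _ ni hli).
by rewrite expr2; apply: ler_piMl; rewrite ?invr_ge0 ?ler0n // invf_le1 // ler1n.
Qed.

End Resolvent.
End SelfAdjoint.

(** * Finding an eigenvector orthogonal to a given sequence of eigenvectors *)

Section SpectralTheorem.
Variables (R : realType) (H : completeNormedModType R[i]).
Variable ip : {dot H for @conjc R}.
Hypothesis ip_norm : forall v : H, `|v| ^+ 2 = ip v v.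
Variable D : linop H.
Hypothesis D_sa : self_adjoint ip D.
Implicit Types u v w x y : H.

Variables (z : R[i]) (k : H -> H).
Hypothesis kD : forall v, D (k v) (v + z *: k v).
Hypothesis Dk : forall v w, D v w -> k (w - z *: v) = v.
Hypothesis k_lin : linear k.
Hypothesis k_cpt : compact (closure (k @` [set v | `|v| <= 1])).

Variables (e : nat -> H) (d : nat -> R).
Hypothesis e_orth : forall i j, i != j -> ip (e i) (e j) = 0.
Hypothesis e_unit : forall i, e i = 0 \/ ip (e i) (e i) = 1.
Hypothesis e_eigen : forall i, D (e i) ((d i)%:C *: e i).

Definition eperp : set H := [set v | forall i, ip v (e i) = 0].

Lemma eperp_lin a v w : eperp v -> eperp w -> eperp (a *: v + w).
Proof. by move=> hv hw i; rewrite (ipDl ip) (ipZl ip) hv hw mulr0 addr0. Qed.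

Lemma eperp0 : eperp 0.
Proof. by move=> i; rewrite (ip0l ip). Qed.

Lemma eperpD v w : eperp v -> eperp w -> eperp (v + w).
Proof. by move=> hv /(eperp_lin 1 hv); rewrite scale1r. Qed.

Lemma eperpZ a v : eperp v -> eperp (a *: v).
Proof. by move=> hv; have := eperp_lin a hv eperp0; rewrite addr0. Qed.

Lemma eperpB v w : eperp v -> eperp w -> eperp (v - w).
Proof. by move=> hv hw; rewrite -scaleN1r; apply: eperpD => //; exact: eperpZ. Qed.

Lemma eperp_closed (s : nat -> H) v : (forall n, eperp (s n)) -> cvgs s v -> eperp v.
Proof.
move=> hs sv i; rewrite (ip_limit ip_norm (s' := fun=> 0) (u' := 0) (y := e i) _ sv).
- by rewrite (ip0l ip).
- by move=> n; rewrite hs (ip0l ip).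
- by move=> c /ltW c0; exists 0%N => n _; rewrite subrr rn0.
Qed.

(** Pairing [kD v] with the eigenvector gives [(d i - z) * ip (k v) (e i) = 0], and [z] is not an
    eigenvalue. *)
Lemma eperp_res v : eperp v -> eperp (k v).
Proof.
move=> hv i; have [->|e0] := eqVneq (e i) 0; first by rewrite (ip0r ip).
have [l0 _] := eigen_res Dk k_lin e0 (e_eigen i).
have := sa_sym D_sa (e_eigen i) (kD v).
rewrite (ipDl ip) hv add0r (ipZl ip) (ipZr ip) conjc_real => /eqP.
by rewrite eq_sym -subr_eq0 -mulrBl mulf_eq0 (negbTE l0) => /eqP.
Qed.

(** The closed span of [e] reduces [D]: the partial sums of the two expansions are pairs of the
    graph, which is closed. It is needed because self-adjointness is tested on the whole domain,
    while the maximality argument controls [k] only on [eperp]. *)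
Lemma eproj w w' : D w w' -> exists p p',
  [/\ D p p', eperp (w - p), eperp (w' - p') &
      forall m, eperp m -> ip p m = 0 /\ ip p' m = 0].
Proof.
move=> ww'.
have proj v : exists p, cvgs (psum e (fun i => ip v (e i))) p /\
    (forall i, ip p (e i) = ip v (e i)).
  have [p [h1 h2 _]] := riesz_fischer ip_norm e_orth e_unit
    (@supported_ip _ _ ip e v) (bessel ip_norm e_orth e_unit v).
  by exists p.
have [p [hp ep]] := proj w; have [p' [hp' ep']] := proj w'.
exists p, p'; split.
- apply: (sa_closed ip_norm D_sa _ hp hp') => n.
  rewrite /psum; elim: n => [|n IH]; first by rewrite !big_ord0; exact: graph0.
  rewrite !big_ord_recr /=; apply: graphD => //.
  have -> : ip w' (e n) = ip w (e n) * (d n)%:C.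
    by rewrite (sa_sym D_sa (e_eigen n) ww') (ipZr ip) conjc_real mulrC.
  by rewrite -scalerA; exact: graphZ.
- by move=> i; rewrite (ipBl ip) ep subrr.
- by move=> i; rewrite (ipBl ip) ep' subrr.
- have aux c q m : eperp m -> cvgs (psum e c) q -> ip q m = 0.
    move=> hm hq; rewrite (ip_limit ip_norm (s' := fun=> 0) (u' := 0) (y := m) _ hq).
    + by rewrite (ip0l ip).
    + move=> n; rewrite (ip0l ip) (ip_psum_l ip e) big1 // => i _.
      by rewrite (ipC ip) hm conjc0 mulr0.
    + by move=> c0 /ltW c00; exists 0%N => n _; rewrite subrr rn0.
  by move=> m hm; split; [exact: aux hp|exact: aux hp'].
Qed.

(* By the parallelogram law a maximising sequence for [rn (k v)] on the unit
  ball of [eperp] is Cauchy as soon as its image is. *)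
Lemma res_attains : (exists2 v, eperp v & v != 0) ->
  exists v (K : R), [/\ eperp v, v != 0, 0 < K, rn (k v) = K * rn v &
    forall w, eperp w -> rn (k w) <= K * rn w].
Proof.
move=> [v0 hv0 v00].
have [M M0 hM] := res_bounded k_lin k_cpt.
pose S := [set rn (k v) | v in [set v | eperp v /\ rn v <= 1]].
have S_ub : has_ubound S.
  exists M => _ [v [_ v1] <-]; rewrite (le_trans (hM v)) // -[leRHS]mulr1.
  by rewrite ler_wpM2l // ltW.
have hS : has_sup S.
  split=> //; exists (rn (k 0)), 0 => //; split; first exact: eperp0.
  by rewrite rn0.
pose K := sup S.
have KP v : eperp v -> rn (k v) <= K * rn v.
  move=> hv; have [->|vn0] := eqVneq v 0; first by rewrite (res0 k_lin) rn0 mulr0.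
  have nv0 : 0 < rn v by rewrite lt_neqAle rn_ge0 andbT eq_sym rn_eq0.
  rewrite -ler_pdivrMr //; apply: ub_le_sup => //.
  exists ((rn v)^-1%:C *: v); last first.
    by rewrite (resZ k_lin) rnZ_real ger0_norm ?invr_ge0 ?rn_ge0 // mulrC.
  split; first exact: eperpZ.
  by rewrite rnZ_real ger0_norm ?invr_ge0 ?rn_ge0 // mulVf ?gt_eqF.
have K0 : 0 < K.
  have kv0 : k v0 != 0.
    by apply: contra_neq v00; exact: (res_inj ip_norm D_sa kD).
  have : 0 < K * rn v0.
    by rewrite (lt_le_trans _ (KP _ hv0)) // lt_neqAle rn_ge0 andbT eq_sym rn_eq0.
  by rewrite pmulr_lgt0 // lt_neqAle rn_ge0 andbT eq_sym rn_eq0.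
have /choice[s hs] n : exists v, [/\ eperp v, rn v <= 1 & K - n.+1%:R^-1 < rn (k v)].
  have [_ [v [hv v1] <-] h] : exists2 t, S t & K - n.+1%:R^-1 < t.
    by apply: sup_adherent => //; rewrite invr_gt0.
  by exists v.
have [p hp] := res_cluster k_cpt (fun n => let: And3 _ h _ := hs n in h).
(* A subsequence whose images converge to [p]; the condition [n <= m] keeps it maximising at the
   same rate. *)
have /choice[t ht] n : exists m, (n <= m)%N /\ rn (k (s m) - p) <= n.+1%:R^-1.
  by apply: hp; rewrite invr_gt0.
pose a n := s (t n).
have a_perp n : eperp (a n) by case: (hs (t n)).
have a1 n : rn (a n) <= 1 by case: (hs (t n)).
have inv_le n m : (n <= m)%N -> m.+1%:R^-1 <= n.+1%:R^-1 :> R.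
  by move=> nm; rewrite lef_pV2 ?posrE ?ltr0n // ler_nat ltnS.
have aK n : K - n.+1%:R^-1 <= rn (k (a n)).
  case: (hs (t n)) => _ _ /ltW; apply: le_trans.
  by rewrite lerB // inv_le // (ht n).1.
have ap n : rn (k (a n) - p) <= n.+1%:R^-1 := (ht n).2.
have small (c : R) : 0 < c -> exists N, forall n, (N <= n)%N -> n.+1%:R^-1 <= c.
  move=> c0; exists (Num.truncn c^-1) => n Nn.
  rewrite invf_ple ?posrE // (le_trans (ltW (truncnS_gt _))) // ler_nat //.
have [v hv] : exists v, cvgs a v.
  apply: complete_cvgs => c c0.
  (* With tolerance [r], the image of [a m + a n] has norm at least [2 * K - 4 * r], so [a m + a n]
     has norm at least [2 - c ^+ 2 / 4], and the parallelogram law leaves at most [c ^+ 2] for the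
     squared difference. *)
  have [N hN] := small (K * c ^+ 2 / 16)
    ltac:(by rewrite divr_gt0 // mulr_gt0 // exprn_gt0).
  exists N => m n Nm Nn.
  have hm := hN _ Nm; have hn := hN _ Nn.
  set r := K * c ^+ 2 / 16 in hm hn.
  have lower : 2 * K - 4 * r <= rn (k (a m + a n)).
    rewrite (resD k_lin).
    have h1 := rnD (k (a m) + k (a n)) (k (a m) - k (a n)).
    rewrite addrACA subrr addr0 -mulr2n -scaler_nat in h1.
    have h2 : rn (2%:R *: k (a m)) = 2 * rn (k (a m)).
      rewrite -(_ : (2 : R)%:C = 2%:R); last by rewrite rmorph_nat.
      by rewrite rnZ_real ger0_norm.
    rewrite h2 in h1.
    have h3 := rn_tri (k (a m)) p (k (a n)); rewrite (rn_distC p) in h3.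
    have hm' : K - r <= rn (k (a m)) by apply: le_trans (aK m); rewrite lerB.
    have hpm := le_trans (ap m) hm; have hpn := le_trans (ap n) hn.
    clear -h1 h3 hm' hpm hpn; lra.
  have upper := KP _ (eperpD (a_perp m) (a_perp n)).
  have par := parallelogram ip_norm (a m) (a n).
  have q : 2 - c ^+ 2 / 4 <= rn (a m + a n).
    rewrite -(ler_pM2l K0); apply: le_trans upper; apply: le_trans lower.
    by rewrite /r; lra.
  have am2 : rn (a m) ^+ 2 <= 1 by rewrite expr_le1 ?rn_ge0.
  have an2 : rn (a n) ^+ 2 <= 1 by rewrite expr_le1 ?rn_ge0.
  rewrite -ler_sqr ?nnegrE ?rn_ge0 ?(ltW c0) //.
  have c20 : 0 <= c ^+ 2 by rewrite sqr_ge0.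
  have := rn_ge0 (a m + a n).
  move: q par am2 an2 c20; set A := rn (a m + a n); set B := rn (a m - a n) ^+ 2.
  set C := c ^+ 2 => q par am2 an2 c20 A0.
  (* Squaring the lower bound needs [2 - C / 4] nonnegative; for larger [C] the trivial bound 4 on
     [B] is enough. *)
  have [C8|C8] := leP C 8; last by have := sqr_ge0 A; lra.
  have : (2 - C / 4) ^+ 2 <= A ^+ 2 by rewrite ler_sqr ?nnegrE //; lra.
  have := sqr_ge0 C; nra.
have v1 : rn v <= 1 by exact: cvgs_rn_le hv a1.
have pv : eperp v by exact: eperp_closed a_perp hv.
have kv : K <= rn (k v).
  apply/ler_addgt0Pr => c c0.
  have [N hN] := small (c / 2) (divr_gt0 c0 (ltr0Sn _ _)).
  have [N' hN'] := hv (c / 2 / M) (divr_gt0 (divr_gt0 c0 (ltr0Sn _ _)) M0).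
  pose n := maxn N N'.
  have h1 := hN n (leq_maxl _ _); have h2 := hN' n (leq_maxr _ _).
  have h3 : K - c / 2 <= rn (k (a n)) by apply: le_trans (aK n); rewrite lerB.
  clear h1.
  have h4 := hM (a n - v); rewrite (resB k_lin) in h4.
  have h5 := rnD (k (a n) - k v) (k v); rewrite subrK in h5.
  rewrite ler_pdivlMr // mulrC in h2; lra.
have nv1 : rn v = 1.
  apply/eqP; rewrite eq_le v1 /= -(ler_pM2l K0) mulr1.
  exact: le_trans kv (KP v pv).
exists v, K; split=> //.
- by rewrite -rn_eq0 nv1 oner_neq0.
- by apply/eqP; rewrite eq_le KP // nv1 mulr1 kv.
Qed.

(* The form [K ^+ 2 * ip u v - ip (k u) (k v)] is positive on [eperp] and vanishes
  at the maximiser [v], which is therefore in its kernel. *)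
Lemma res_critical v (K : R) : eperp v -> rn (k v) = K * rn v ->
  (forall w, eperp w -> rn (k w) <= K * rn w) ->
  forall u, eperp u -> ip (k u) (k v) = (K ^+ 2)%:C * ip u v.
Proof.
move=> pv kv hK u pu.
pose c := (K ^+ 2)%:C * ip u v - ip (k u) (k v).
suff : c = 0 by move/eqP; rewrite subr_eq0 => /eqP.
have sq w : eperp w -> rn (k w) ^+ 2 <= K ^+ 2 * rn w ^+ 2.
  by move=> pw; rewrite -exprMn ler_sqr ?nnegrE ?rn_ge0 ?hK // (le_trans _ (hK _ pw)) ?rn_ge0.
pose B := K ^+ 2 * rn u ^+ 2 - rn (k u) ^+ 2.
have B0 : 0 <= B by rewrite subr_ge0 sq.
(* At [v + t *: u] the form takes the value [2 * Re (t * c) + |t|^2 * B]. This choice of [t] makes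
   it at most [- q * nsq c], so positivity forces [c = 0]. *)
pose q : R := (B + 1)^-1.
have q0 : 0 < q by rewrite invr_gt0 ltr_wpDl.
have qB : q * B <= 1 by rewrite mulrC ler_pdivrMr ?mul1r ?lerDl // ltr_wpDl.
pose t := - (q%:C * conjc c).
have := sq (v + t *: u) (eperpD pv (eperpZ t pu)).
rewrite (resD k_lin) (resZ k_lin) !(rnD2 ip_norm) !rnZ2 kv exprMn.
have -> : ip v (t *: u) = conjc (t * ip u v).
  by rewrite (ipZr ip) rmorphM /= -(ipC ip).
have -> : ip (k v) (t *: k u) = conjc (t * ip (k u) (k v)).
  by rewrite (ipZr ip) rmorphM /= -(ipC ip).
have ReJ (x : R[i]) : complex.Re (conjc x) = complex.Re x by case: x.
rewrite !ReJ.
have -> : nsq t = q ^+ 2 * nsq c by rewrite /t nsqN nsqM nsqR nsqJ.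
have : complex.Re (t * c) = - (q * nsq c).
  by rewrite /t mulNr -mulrA (mulrC (conjc c)) mulcJ -rmorphM.
have -> : complex.Re (t * c) =
    K ^+ 2 * complex.Re (t * ip u v) - complex.Re (t * ip (k u) (k v)).
  rewrite /c mulrBr mulrCA raddfB /=; congr (_ - _).
  by case: (t * _) => x y; rewrite /= mul0r subr0.
move: qB B0 (nsq_ge0 c); rewrite /B.
set Tuv := complex.Re (t * ip u v); set Tk := complex.Re _; set N := nsq c.
set ru := rn u ^+ 2; set rku := rn (k u) ^+ 2; set rv := rn v ^+ 2.
move=> qB B0 N0 hT hle.
have hle' : 0 <= 2 * (K ^+ 2 * Tuv - Tk) + q ^+ 2 * N * (K ^+ 2 * ru - rku) by lra.
rewrite hT in hle'.
have : 0 <= q * N * (q * (K ^+ 2 * ru - rku) - 2) by lra.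
have qN : 0 <= q * N by rewrite mulr_ge0 // ltW.
move=> h; have : q * N <= 0 by nra.
move=> h'; have /eqP : q * N = 0 by lra.
by rewrite mulf_eq0 gt_eqF //= nsq_eq0 => /eqP.
Qed.

(* If [z = a + i b], the criticality condition at the maximiser [v] says that
  [(D - a) ^ 2 y = c ^ 2 y] for [y = k v], so that [(D - a) y + c y] or [y] is an
  eigenvector. *)
Lemma eperp_eigenvector : (exists2 v, eperp v & v != 0) ->
  exists f (lam : R), [/\ eperp f, f != 0 & D f (lam%:C *: f)].
Proof.
move=> /res_attains[v [K [pv v0 K0 kv hK]]].
have crit := res_critical pv kv hK.
set y := k v; have py : eperp y by exact: eperp_res.
have y0 : y != 0 by apply: contra_neq v0; exact: (res_inj ip_norm D_sa kD).
pose h : R := K ^- 2.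
(* On [eperp], criticality says that the adjoint of [k] maps [y] to [K ^+ 2] times [v]; that adjoint
   is the resolvent at [conjc z], whence [(D - conjc z) v = h y]. Self-adjointness reduces this to
   pairings with test vectors, which [eproj] moves into [eperp]. *)
have Dv : D v (h%:C *: y + conjc z *: v).
  apply/(D_sa.2) => w w' ww'.
  have [p [p' [pp' pwp pwp' pm]]] := eproj ww'.
  have [py0 _] := pm _ py; have [pv0 pv'0] := pm _ pv.
  have := Dk (graphB ww' pp'); move=> kw.
  have := crit _ (eperpB pwp' (eperpZ z pwp)).
  rewrite kw -/y !(ipBl ip) (ipZl ip) (ipBl ip) py0 pv0 pv'0 !subr0 => e1.
  rewrite (ipDr ip) !(ipZr ip) conjcK conjc_real e1 mulrA -rmorphM /= /h.
  by rewrite mulVf ?expf_neq0 ?gt_eqF // rmorph1 mul1r subrK.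
have Dy : D y (v + z *: y) := kD v.
pose a := complex.Re z; pose b := complex.Im z.
(* [x1] is [(D - a) y], and [(D - a) x1 = m y] with [m = h - b ^+ 2]. Symmetry of [D] gives
   [m >= 0], so [m] has a real root [c]. *)
pose x1 := v + (z - a%:C) *: y.
have Dx1 : D x1 (a%:C *: x1 + (h - b ^+ 2)%:C *: y).
  have := graphD Dv (graphZ (z - a%:C) Dy).
  congr (D _ _); rewrite /x1 !scalerDr !scalerA.
  have zE : z = a%:C + 'i%C * b%:C := complexE z.
  have zJ : conjc z = a%:C - 'i%C * b%:C.
    by rewrite /a /b; case: (z) => p q; simpc.
  have i2 : 'i%C * 'i%C = -1 :> R[i] by rewrite -expr2 sqr_i.
  rewrite (addrC (h%:C *: y)) addrACA -!scalerDl -[RHS]addrA -scalerDl.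
  have zb : (z - a%:C) * z = a%:C * (z - a%:C) - (b%:C) ^+ 2.
    rewrite {1 2 3}zE; transitivity (a%:C * ('i%C * b%:C) + ('i%C * 'i%C) * b%:C ^+ 2); first ring.
    by rewrite i2; ring.
  congr (_ *: _ + _ *: _); first by rewrite zJ {1}zE; ring.
  rewrite zb rmorphB rmorphXn /=; ring.
have Dy' : D y (x1 + a%:C *: y) by move: Dy; rewrite /x1 -addrA -scalerDl subrK.
pose m := h - b ^+ 2.
have rel : rn x1 ^+ 2 = m * rn y ^+ 2.
  have := sa_sym D_sa Dy' Dx1.
  rewrite (ipDl ip) (ipDr ip) !(ipZl ip) (ipZr ip) conjc_real.
  rewrite addrC => /addIr; rewrite !(ip_self ip_norm) -rmorphM => /complexI.
  by move=> <-.
have ny : 0 < rn y ^+ 2.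
  by rewrite exprn_gt0 // lt_neqAle rn_ge0 andbT eq_sym rn_eq0.
have m0 : 0 <= m.
  by rewrite -(pmulr_lge0 _ ny) -rel sqr_ge0.
pose c := Num.sqrt m.
have c2 : c * c = m by rewrite -expr2 sqr_sqrtr.
have px1 : eperp x1 by rewrite /x1; apply: eperpD => //; exact: eperpZ.
have [f0|f0] := eqVneq (x1 + c%:C *: y) 0.
  exists y, (a - c); split => //; move: Dy'.
  move/eqP: f0; rewrite addr_eq0 => /eqP ->.
  by rewrite -scaleNr -scalerDl rmorphB /= addrC.
exists (x1 + c%:C *: y), (a + c); split => //.
  by apply: eperpD => //; exact: eperpZ.
have := graphD Dx1 (graphZ c%:C Dy').
have lin u w : a%:C *: u + m%:C *: w + c%:C *: (u + a%:C *: w) =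
    (a + c)%:C *: (u + c%:C *: w).
  rewrite -c2 !scalerDr !scalerA addrACA -!scalerDl.
  by rewrite rmorphM rmorphD /=; congr (_ *: _ + _ *: _); ring.
by rewrite lin.
Qed.

End SpectralTheorem.

(** A maximal orthonormal set of eigenvectors is countable, and nothing is orthogonal to it, since
    [eperp_eigenvector] would enlarge it. *)
Theorem spectral_theorem (R : realType) (H : completeNormedModType R[i])
    (ip : {dot H for @conjc R}) (D : linop H) :
  (forall v : H, `|v| ^+ 2 = ip v v) ->
  self_adjoint ip D -> compact_resolvent D ->
  exists (e : nat -> H) (d : nat -> R),
    [/\ forall i j, i != j -> ip (e i) (e j) = 0,
        forall i, e i = 0 \/ ip (e i) (e i) = 1,
        forall i, D (e i) ((d i)%:C *: e i)
      & forall v, (forall i, ip v (e i) = 0) -> v = 0].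
Proof.
move=> ip_norm D_sa [z [k [kD Dk [k_lin k_cpt]]]].
have [S [SP Smax]] := maximal_orthonormal_eigen ip D.
have /countable_injP[g gI] := orthonormal_eigen_countable ip_norm Dk k_lin k_cpt SP.
(* Indices outside the range of [g] receive the zero vector, so a finite-dimensional [H] needs no
   separate treatment. *)
pose e n := xget 0 [set x | S x /\ g x = n].
have eP n : e n = 0 \/ S (e n) /\ g (e n) = n.
  by rewrite /e; case: xgetP => [x -> [? ?]|_]; [right|left].
have e_g x : S x -> e (g x) = x.
  move=> Sx; rewrite /e; case: xgetP => [y -> [Sy gy]|/(_ x)]; last by case.
  by apply: gI; rewrite ?inE.
have e_eig n : exists lam : R, D (e n) (lam%:C *: e n).
  case: (eP n) => [->|[Sn _]]; last exact: (SP.1 _ Sn).2.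
  by exists 0; rewrite scaler0; exact: graph0.
have {e_eig} [d hd] := choice e_eig.
have e_orth i j : i != j -> ip (e i) (e j) = 0.
  case: (eP i) => [->|[Si gi]]; first by rewrite (ip0l ip).
  case: (eP j) => [->|[Sj gj]]; first by rewrite (ip0r ip).
  move=> ij; apply: SP.2 => // eij; move: ij; rewrite -gi -gj eij eqxx //.
have e_unit i : e i = 0 \/ ip (e i) (e i) = 1.
  by case: (eP i) => [->|[Si _]]; [left|right; exact: (SP.1 _ Si).1].
exists e, d; split=> // v hv; apply: contrapT => /eqP v0.
have [|f [lam [pf f0 Df]]] := @eperp_eigenvector _ _ _ ip_norm _ D_sa _ _ kD Dk
  k_lin k_cpt _ _ e_orth e_unit hd; first by exists v.
have nf0 : 0 < rn f by rewrite lt_neqAle rn_ge0 andbT eq_sym rn_eq0.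
pose f1 := (rn f)^-1%:C *: f.
have f11 : ip f1 f1 = 1.
  rewrite (ip_self ip_norm) rnZ_real ger0_norm ?invr_ge0 ?rn_ge0 //.
  by rewrite mulVf ?gt_eqF // expr1n.
have f1S x : S x -> ip f1 x = 0.
  by move=> Sx; rewrite -(e_g _ Sx) (ipZl ip) pf mulr0.
apply: (Smax (S `|` [set f1])).
  split=> [x Sx|sub]; first by left.
  have : S f1 by apply: sub; right.
  by move=> /f1S; rewrite f11 => /eqP; rewrite oner_eq0.
split=> [x [/(SP.1 _)//|->]|x y].
  split=> //; exists lam; rewrite /f1 scalerA mulrC -scalerA; exact: graphZ.
move=> [Sx|->] [Sy|->] // xy; first exact: SP.2.
- by rewrite (ipC ip) f1S // conjc0.
- exact: f1S.
Qed.

(** * Extension of a twist *)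

Section LinearExtension.
Variables (K : fieldType) (V : lmodType K).
Implicit Types (U C W : set V) (x y : V) (k : K).

(** Kept apart from [U 0] because Zorn's lemma also has to accept the empty chain, whose union is
    empty. *)
Definition lin_closed U := forall k x y, U x -> U y -> U (k *: x + y).
Definition subsp U := U 0 /\ lin_closed U.

Lemma subspZ U k x : subsp U -> U x -> U (k *: x).
Proof. by move=> [U0 Ul] Ux; rewrite -[_ *: _]addr0; exact: Ul. Qed.

Lemma subspD U x y : subsp U -> U x -> U y -> U (x + y).
Proof. by move=> [U0 Ul] Ux Uy; rewrite -[x]scale1r; exact: Ul. Qed.

Lemma subspN U x : subsp U -> U x -> U (- x).
Proof. by move=> sU Ux; rewrite -scaleN1r; exact: subspZ. Qed.

Lemma subspB U x y : subsp U -> U x -> U y -> U (x - y).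
Proof. by move=> sU Ux Uy; apply: subspD => //; exact: subspN. Qed.

(** Zorn's lemma on linearly closed sets that meet [U] at most in 0: a vector outside the sum could
    be adjoined to a maximal one. *)
Lemma complement U : subsp U -> exists C, [/\ subsp C,
  forall x, C x -> U x -> x = 0 &
  forall x, exists c u, [/\ C c, U u & x = c + u]].
Proof.
move=> sU; have [U0 Ul] := sU.
pose P C := lin_closed C /\ forall x, C x -> U x -> x = 0.
have [|A [[Al AU] Amax]] := @Zorn_bigcup V P.
  move=> F FP tF; split=> [k x y [C FC Cx] [C' FC' C'y]|x [C FC Cx]].
    have [CC'|C'C] := tF _ _ FC FC'.
      by exists C' => //; apply: (FP _ FC').1 => //; exact: CC'.
    by exists C => //; apply: (FP _ FC).1 => //; exact: C'C.
  exact: (FP _ FC).2.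
have A0 : A 0.
  apply: contrapT => nA0; apply: (Amax (A `|` [set 0])).
    by split=> [x Ax|h]; [left|apply: nA0; apply: h; right].
  split=> [k x y [Ax|->] [Ay|->]|x [Ax|->]//]; last exact: AU.
  - by left; exact: Al.
  - by left; rewrite -[0](addNr x) -{2}[x]scale1r -scaleNr addrA -scalerDl; exact: Al.
  - by left; rewrite scaler0 add0r.
  - by right; rewrite scaler0 addr0.
exists A; split=> // x0; apply: contrapT => h.
pose B := [set y | exists k a, A a /\ y = k *: x0 + a].
have AB : A `<=` B by move=> x Ax; exists 0, x; rewrite scale0r add0r.
apply: (Amax B).
  split=> // BA; apply: h; exists x0, 0; rewrite addr0; split=> //.
  by apply: BA; exists 1, 0; rewrite scale1r addr0.
split=> [k x y [k1 [a1 [A1 ->]]] [k2 [a2 [A2 ->]]]|_ [k [a [Aa ->]]] Ux].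
  exists (k * k1 + k2), (k *: a1 + a2); split; first exact: Al.
  by rewrite scalerDr scalerA addrACA scalerDl.
have [k0|k0] := eqVneq k 0.
  by move: Ux; rewrite k0 scale0r add0r; exact: AU.
exfalso; apply: h; exists (- (k^-1 *: a)), (k^-1 *: (k *: x0 + a)); split.
- by rewrite -scaleNr; exact: (subspZ _ (conj A0 Al)).
- exact: subspZ.
- by rewrite scalerDr scalerA mulVf // scale1r addrC addrK.
Qed.

(* Writing [V0 = C + W1 + S] with [W1] a complement of [S `&` W] in [W], the map [T]
  is [Th] on [C], the identity on [W1] and [th] on [S]. *)
Lemma twist_extension (V0 S W : set V) (Th th : V -> V) :
  subsp V0 -> subsp S -> subsp W -> S `<=` V0 -> W `<=` V0 ->
  (forall k x y, V0 x -> V0 y -> Th (k *: x + y) = k *: Th x + Th y) ->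
  (forall x, V0 x -> V0 (Th x)) ->
  (forall x, V0 x -> Th x = 0 -> x = 0) ->
  (forall y, V0 y -> exists2 x, V0 x & Th x = y) ->
  (forall x, V0 x -> W (Th x) <-> W x) ->
  (forall k x y, S x -> S y -> th (k *: x + y) = k *: th x + th y) ->
  (forall x, S x -> S (th x)) ->
  (forall x, S x -> th x = 0 -> x = 0) ->
  (forall y, S y -> exists2 x, S x & th x = y) ->
  (forall x, S x -> W (th x - Th x)) ->
  exists T : V -> V,
    [/\ forall k x y, V0 x -> V0 y -> T (k *: x + y) = k *: T x + T y,
        set_bij V0 V0 T, {in S, T =1 th} & forall x, V0 x -> W (T x - Th x)].
Proof.
move=> sV0 sS sW SV0 WV0 Thl ThV Thi Ths ThW thl thS thi ths thTh.
have sSW : subsp (S `&` W).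
  by split=> [|k x y [? ?] [? ?]]; split; [exact: sS.1|exact: sW.1|exact: sS.2|exact: sW.2].
have [W1 [sW1 W1SW W1d]] := complement sSW.
pose SpW := [set x | exists s w, [/\ S s, W w & x = s + w]].
have sSpW : subsp SpW.
  split; first by exists 0, 0; rewrite addr0; split=> //; [exact: sS.1|exact: sW.1].
  move=> k x y [s [w [Ss Ww ->]]] [s' [w' [Ss' Ww' ->]]].
  exists (k *: s + s'), (k *: w + w'); rewrite scalerDr addrACA.
  by split=> //; [exact: sS.2|exact: sW.2].
have [C1 [sC1 C1SpW C1d]] := complement sSpW.
have SSpW s : S s -> SpW s.
  by move=> Ss; exists s, 0; rewrite addr0; split=> //; exact: sW.1.
have WSpW w : W w -> SpW w.
  by move=> Ww; exists 0, w; rewrite add0r; split=> //; exact: sS.1.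
have SpWV0 x : SpW x -> V0 x.
  by move=> [s [w [/SV0 ? /WV0 ? ->]]]; exact: subspD.
have Th0 : Th 0 = 0.
  by have := Thl (-1) 0 0 sV0.1 sV0.1; rewrite scaleN1r oppr0 addr0 scaleN1r addNr.
(* The complements only provide the existence of a decomposition; [rel_fun] below shows that the
   value does not depend on it. *)
pose rel x y := exists c w s,
  [/\ C1 c /\ V0 c, W1 w /\ W w, S s, x = c + w + s & y = Th c + w + th s].
have rel_ex x : V0 x -> exists y, rel x y.
  move=> Vx; have [c [u [Cc [s [w [Ss Ww ->]]] xE]]] := C1d x.
  have [w1 [w2 [W1w1 [Sw2 Ww2] wE]]] := W1d w.
  have Ww1 : W w1 by rewrite -(addrK w2 w1) -wE; exact: subspB.
  have Vc : V0 c.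
    rewrite -(addrK (s + w) c) -xE; apply: subspB => //.
    by apply: SpWV0; exists s, w.
  exists (Th c + w1 + th (s + w2)), c, w1, (s + w2); split=> //.
    by apply: subspD.
  by rewrite xE wE -addrA; congr (_ + _); rewrite addrCA.
have rel_lin k x y x' y' : rel x y -> rel x' y' -> rel (k *: x + x') (k *: y + y').
  move=> [c [w [s [[Cc Vc] [W1w Ww] Ss -> ->]]]] [c' [w' [s' [[Cc' Vc'] [W1w' Ww'] Ss' -> ->]]]].
  exists (k *: c + c'), (k *: w + w'), (k *: s + s'); split.
  - by split; [exact: sC1.2|exact: sV0.2].
  - by split; [exact: sW1.2|exact: sW.2].
  - exact: sS.2.
  - by rewrite !scalerDr addrACA; congr (_ + _); rewrite addrACA.
  - rewrite Thl // thl // !scalerDr addrACA; congr (_ + _); by rewrite addrACA.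
have th0 : th 0 = 0.
  by have := thl (-1) 0 0 sS.1 sS.1; rewrite scaleN1r oppr0 addr0 scaleN1r addNr.
have rel_W x y : rel x y -> W (y - Th x).
  move=> [c [w [s [[Cc Vc] [W1w Ww] Ss -> ->]]]].
  have -> : Th (c + w + s) = Th c + Th w + Th s.
    have ThD a b : V0 a -> V0 b -> Th (a + b) = Th a + Th b.
      by move=> Va Vb; have := Thl 1 a b Va Vb; rewrite !scale1r.
    by rewrite !ThD //; [exact: WV0|apply: subspD => //; exact: WV0|exact: SV0].
  rewrite opprD addrACA [in X in W (X + _)]opprD [in X in W (X + _)]addrACA subrr add0r.
  apply: subspD => //; last exact: thTh.
  by apply: subspB => //; apply/ThW => //; exact: WV0.
have rel_inj x : rel x 0 -> x = 0.
  move=> rx; have := rel_W _ _ rx; move: rx.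
  move=> [c [w [s [[Cc Vc] [W1w Ww] Ss xE yE]]]].
  have Vx : V0 x.
    by rewrite xE; do 2?apply: subspD => //; [exact: WV0|exact: SV0].
  (* The value 0 differs from [Th x] by an element of [W], so [Th x], and with it [x], lies in [W];
     directness then removes the three components in turn. *)
  rewrite sub0r => /(subspN sW); rewrite opprK => /(ThW _ Vx) Wx.
  have c0 : c = 0.
    apply: C1SpW => //; have -> : c = x - (s + w) by rewrite xE -(addrA c) (addrC w) addrK.
    by apply: subspB => //; [exact: WSpW|exists s, w].
  move: yE; rewrite c0 Th0 add0r => /esym/eqP; rewrite addr_eq0 => /eqP wE.
  have w0 : w = 0.
    apply: W1SW => //; split=> //.
    by rewrite wE; apply: subspN => //; exact: thS.
  have s0 : s = 0 by apply: thi => //; apply/eqP; rewrite -oppr_eq0 -wE w0.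
  by rewrite xE c0 w0 s0 !addr0.
have rel_fun x y y' : rel x y -> rel x y' -> y = y'.
  have rel0 y0 : rel 0 y0 -> y0 = 0.
    move=> [c [w [s [[Cc Vc] [W1w Ww] Ss xE yE]]]].
    have c0 : c = 0.
      apply: C1SpW => //; have -> : c = - (s + w).
        by apply/eqP; rewrite -addr_eq0 (addrC s) addrA -xE.
      by apply: subspN => //; exists s, w.
    move: xE; rewrite c0 add0r => /esym/eqP; rewrite addr_eq0 => /eqP wE.
    have w0 : w = 0 by apply: W1SW => //; split=> //; rewrite wE; exact: subspN.
    have s0 : s = 0 by apply/eqP; rewrite -oppr_eq0 -wE w0.
    by rewrite yE c0 w0 s0 Th0 th0 !addr0.
  move=> h h'; have := rel_lin (-1) _ _ _ _ h h'.
  by rewrite !scaleN1r addNr => /rel0 /eqP; rewrite addrC subr_eq0 => /eqP.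
pose T x := xget 0 [set y | rel x y].
have relT x : V0 x -> rel x (T x) by move=> /rel_ex; exact: xgetPex.
have TE x y : V0 x -> rel x y -> T x = y by move=> /relT h h'; exact: rel_fun h h'.
have Tl k x y : V0 x -> V0 y -> T (k *: x + y) = k *: T x + T y.
  by move=> Vx Vy; apply: TE; [exact: sV0.2|apply: rel_lin; exact: relT].
have TW x : V0 x -> W (T x - Th x) by move=> Vx; apply: rel_W; exact: relT.
exists T; split=> //; last first.
  move=> s /set_mem Ss; apply: TE; first exact: SV0.
  exists 0, 0, s; split; rewrite ?Th0 ?add0r //.
    by split; [exact: sC1.1|exact: sV0.1].
  by split; [exact: sW1.1|exact: sW.1].
have TV x : V0 x -> V0 (T x).
  by move=> Vx; rewrite -(subrK (Th x) (T x)); apply: subspD => //;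
     [apply: WV0; exact: TW|exact: ThV].
have T_W w : W w -> exists2 x, V0 x & T x = w.
  move=> Ww; have [w1 [w2 [W1w1 [Sw2 Ww2] wE]]] := W1d w.
  have Ww1 : W w1 by rewrite -(addrK w2 w1) -wE; exact: subspB.
  have [s Ss sE] := ths _ Sw2.
  have V1 : V0 (w1 + s) by apply: subspD => //; [exact: WV0|exact: SV0].
  exists (w1 + s) => //; apply: TE => //.
  exists 0, w1, s; split; rewrite ?Th0 ?add0r ?sE //.
  by split; [exact: sC1.1|exact: sV0.1].
split=> //.
- move=> x y /set_mem Vx /set_mem Vy Txy.
  have : T (x - y) = 0.
    by rewrite addrC -scaleN1r Tl // Txy scaleN1r addNr.
  move=> T0; apply/eqP; rewrite -subr_eq0; apply/eqP/rel_inj.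
  by rewrite -T0; apply: relT; exact: subspB.
(* [T x] misses [y = Th x] by an element of [W], and [T_W] puts [W] in the image of [T]. *)
- move=> y Vy; have [x Vx xE] := Ths _ Vy.
  have [x' Vx' x'E] := T_W _ (TW _ Vx).
  exists (x - x'); first exact: subspB.
  by rewrite addrC -scaleN1r Tl // x'E scaleN1r opprB subrK.
Qed.

End LinearExtension.

(** * Diagonal operators in an eigenbasis *)

Record eigenframe (R : realType) (H : completeNormedModType R[i])
    (ip : {dot H for @conjc R}) (D : linop H) (e : nat -> H) (d : nat -> R) : Prop := {
  frame_norm : forall v : H, `|v| ^+ 2 = ip v v ;
  frame_sa : self_adjoint ip D ;
  frame_orth : forall i j, i != j -> ip (e i) (e j) = 0 ;
  frame_unit : forall i, e i = 0 \/ ip (e i) (e i) = 1 ;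
  frame_eigen : forall i, D (e i) ((d i)%:C *: e i) ;
  frame_total : forall v, (forall i, ip v (e i) = 0) -> v = 0 }.

Section DiagonalFrame.
Variables (R : realType) (H : completeNormedModType R[i]).
Variable ip : {dot H for @conjc R}.
Variables (D : linop H) (e : nat -> H) (d : nat -> R).
Hypothesis fr : eigenframe ip D e d.
Let ip_norm := frame_norm fr.
Let D_sa := frame_sa fr.
Let e_orth := frame_orth fr.
Let e_unit := frame_unit fr.
Let e_eigen := frame_eigen fr.
Let e_total := frame_total fr.
Implicit Types u v w x y : H.

Local Notation cf v i := (ip v (e i)).

Lemma cf_inj v w : (forall i, cf v i = cf w i) -> v = w.
Proof.
move=> h; apply/eqP; rewrite -subr_eq0; apply/eqP/e_total => i.
by rewrite (ipBl ip) h subrr.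
Qed.

Lemma cvgs_psum_cf v : cvgs (psum e (fun i => cf v i)) v.
Proof.
have [p [h1 h2 _]] := riesz_fischer ip_norm e_orth e_unit
  (@supported_ip _ _ ip e v) (bessel ip_norm e_orth e_unit v).
by rewrite [X in cvgs _ X](_ : v = p) //; apply: cf_inj => i; rewrite h2.
Qed.

Lemma cvgs_rn_cf v (c : R) : 0 < c ->
  exists N, rn v ^+ 2 <= \sum_(i < N) nsq (cf v i) + c.
Proof.
move=> c0; have s0 : 0 < Num.sqrt c by rewrite sqrtr_gt0.
have [N hN] := cvgs_psum_cf v s0; exists N.
rewrite -lerBlDl -(bessel_eq ip_norm e_orth e_unit) rn_distC.
rewrite -[leRHS](sqr_sqrtr (ltW c0)) ler_sqr ?nnegrE ?rn_ge0 ?sqrtr_ge0 //.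
exact: hN.
Qed.

(** Parseval as a bound on finite sums, so that no infinite series is ever formed. *)
Lemma rn_leP v (C : R) : 0 <= C ->
  rn v <= C <-> forall n, \sum_(i < n) nsq (cf v i) <= C ^+ 2.
Proof.
move=> C0; split=> [vC n|h].
  apply: le_trans (bessel ip_norm e_orth e_unit v n) _.
  by rewrite ler_sqr ?nnegrE ?rn_ge0.
rewrite -ler_sqr ?nnegrE ?rn_ge0 //; apply/ler_addgt0Pr => c /(cvgs_rn_cf v)[N hN].
by apply: (le_trans hN); rewrite lerD2r.
Qed.

Lemma ip_ext x y u w :
  (forall i, cf x i * conjc (cf w i) = cf y i * conjc (cf u i)) -> ip x w = ip y u.
Proof.
move=> h; apply: (ip_limit ip_norm _ (@cvgs_psum_cf x) (@cvgs_psum_cf y)) => n.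
rewrite !(ip_psum_l ip e); apply: eq_bigr => i _.
by rewrite (ipC ip (e i) w) (ipC ip (e i) u).
Qed.

Lemma cf_e i j : i != j -> cf (e i) j = 0.
Proof. exact: e_orth. Qed.

Lemma diag_exists (f : nat -> R[i]) v (C : R) :
  (forall n, \sum_(i < n) nsq (f i) * nsq (cf v i) <= C) ->
  exists w, forall i, cf w i = f i * cf v i.
Proof.
move=> h; have [||w [_ hw _]] := riesz_fischer ip_norm e_orth e_unit
  (c := fun i => f i * cf v i) (C := C) _ _.
- by move=> i /(@supported_ip _ _ ip e v) ->; rewrite mulr0.
- by move=> n; under eq_bigr do rewrite nsqM.
by exists w.
Qed.

(** Being an equivalence, this also fixes the domain: it is the maximal one. *)
Definition diagonal_op (T : linop H) (t : nat -> R[i]) :=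
  forall v w, T v w <-> forall i, cf w i = t i * cf v i.

(** [fcalc] tests against every eigenvector of [T], not only the [e i]. The two tests agree because
    an eigenvector for [lam] has nonzero coordinates only where [t i = lam]. *)
Lemma diagonal_fcalc (T : linop H) (t : nat -> R) (f : R -> R[i]) :
  diagonal_op T (fun i => (t i)%:C) -> diagonal_op (fcalc ip f T) (fun i => f (t i)).
Proof.
move=> hT v w; split=> [h i|h lam x /hT hx].
  apply: h; apply/hT => j; rewrite (ipZl ip).
  by have [->//|ij] := eqVneq i j; rewrite cf_e // !mulr0.
rewrite -(ipZl ip); apply: ip_ext => i; rewrite (ipZl ip) h.
have := hx i; rewrite (ipZl ip) => /eqP; rewrite -subr_eq0 -mulrBl mulf_eq0.
case/orP=> [|/eqP ->]; last by rewrite conjc0 !mulr0.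
by rewrite subr_eq0 (inj_eq (@complexI R)) => /eqP ->.
Qed.

Lemma diagonal_D : diagonal_op D (fun i => (d i)%:C).
Proof.
move=> v w; split=> [vw i|h].
  by rewrite (sa_sym D_sa (e_eigen i) vw) (ipZr ip) conjc_real.
apply/(D_sa.2) => v' w' vw'; apply: ip_ext => i.
rewrite (sa_sym D_sa (e_eigen i) vw') (ipZr ip) h conjcM conjc_real; ring.
Qed.

Definition kap i : R := d i ^+ 2 + 1.

Lemma kap_ge1 i : 1 <= kap i.
Proof. by rewrite lerDr sqr_ge0. Qed.

Lemma kap_gt0 i : 0 < kap i.
Proof. exact: lt_le_trans ltr01 (kap_ge1 i). Qed.

(** The converse has to produce the intermediate vector [D v]; it exists because
    [d i ^+ 2 <= kap i ^+ 2]. *)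
Lemma diagonal_lap : diagonal_op (laplacian D) (fun i => (kap i)%:C).
Proof.
move=> v w; split=> [[w1 [w2 [[u /diagonal_D Du /diagonal_D Dw] -> ->]]] i|h].
  by rewrite (ipDl ip) Dw Du mulrA -rmorphM /kap rmorphD /= mulrDl mul1r expr2.
have [|u hu] := @diag_exists (fun i => (d i)%:C) v (rn w ^+ 2).
  move=> n; apply: le_trans (bessel ip_norm e_orth e_unit w n).
  apply: ler_sum => i _; rewrite h nsqM ler_wpM2r ?nsq_ge0 // !nsqR.
  by rewrite /kap; have := sqr_ge0 (d i); nra.
exists (w - v), v; split=> //; last by rewrite subrK.
exists u; apply/diagonal_D => // i.
rewrite (ipBl ip) h hu mulrA -rmorphM /kap rmorphD /= expr2; ring.
Qed.

Lemma diagonal_pow n : diagonal_op (op_pow (laplacian D) n) (fun i => (kap i ^+ n)%:C).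
Proof.
elim: n => [|n IH] v w.
  split=> [-> i|h]; first by rewrite expr0 mul1r.
  by apply: cf_inj => i; rewrite h expr0 mul1r.
split=> [[u /IH hu /diagonal_lap hw] i|h].
  by rewrite hw hu mulrA -rmorphM exprS.
have [|u hu] := @diag_exists (fun i => (kap i ^+ n)%:C) v (rn w ^+ 2).
  move=> m; apply: le_trans (bessel ip_norm e_orth e_unit w m).
  apply: ler_sum => i _; rewrite h nsqM ler_wpM2r ?nsq_ge0 // !nsqR.
  rewrite ler_sqr ?nnegrE ?exprn_ge0 ?(ltW (kap_gt0 _)) // exprS.
  by rewrite ler_peMl ?kap_ge1 // exprn_ge0 ?(ltW (kap_gt0 _)).
exists u; first exact/IH.
by apply/diagonal_lap => i; rewrite h hu mulrA -rmorphM exprS.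
Qed.

Lemma smooth_setP v : smooth_set (laplacian D) v <->
  forall n, exists C : R, forall m, \sum_(i < m) kap i ^+ n * nsq (cf v i) <= C.
Proof.
split=> [h n|h n _].
  have [w /diagonal_pow hw] := h n I; exists (rn w ^+ 2) => m.
  apply: le_trans (bessel ip_norm e_orth e_unit w m).
  apply: ler_sum => i _; rewrite hw nsqM ler_wpM2r ?nsq_ge0 // nsqR.
  by rewrite expr2 ler_peMl ?exprn_ege1 ?kap_ge1 ?exprn_ge0 ?(ltW (kap_gt0 _)).
have [C hC] := h (n * 2)%N.
have [|w hw] := @diag_exists (fun i => (kap i ^+ n)%:C) v C.
  by move=> m; under eq_bigr do rewrite nsqR -exprM.
by exists w; apply/diagonal_pow.
Qed.

Definition lkap i : R := ln (kap i).

Lemma lkap_ge0 i : 0 <= lkap i.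
Proof. by rewrite ln_ge0 // kap_ge1. Qed.

Lemma expR_lkap i : expR (lkap i) = kap i.
Proof. by rewrite /lkap lnK // posrE kap_gt0. Qed.

Lemma expR_lkap_nat n i : expR (n%:R * lkap i) = kap i ^+ n.
Proof. by rewrite expRM_natl expR_lkap. Qed.

Lemma nsq_cpow z i : nsq (cpow (kap i) z) = expR (2 * complex.Re z * lkap i).
Proof.
rewrite /cpow nsqM nsqR /nsq /= cos2Dsin2 mulr1 /lkap expr2 -expRD.
by congr expR; ring.
Qed.

Lemma cpow_real (s : R) i : cpow (kap i) s%:C = (expR (s * lkap i))%:C.
Proof. by rewrite /cpow /= mul0r cos0 sin0 complexr0 mulr1. Qed.

Lemma cpowD z z' i : cpow (kap i) (z + z') = cpow (kap i) z * cpow (kap i) z'.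
Proof.
case: z z' => [a b] [a' b']; rewrite /cpow /= !mulrDl expRD cosD sinD.
set x := ln _; apply/eqP; rewrite eq_complex /=; apply/andP; split; apply/eqP; ring.
Qed.

Local Notation E := (smooth (laplacian D)).

Lemma smooth_valP (v : E) n :
  exists C : R, forall m, \sum_(i < m) kap i ^+ n * nsq (cf v i) <= C.
Proof.
have : smooth_pred (laplacian D) v by case: v.
by rewrite /smooth_pred => /set_mem /smooth_setP.
Qed.

Lemma smooth_lift v : smooth_set (laplacian D) v -> exists v' : E, smooth_val v' = v.
Proof. by move=> h; exists (Smooth (mem_set h)). Qed.

Lemma smooth_valD (v w : E) : smooth_val (v + w) = smooth_val v + smooth_val w.
Proof. by []. Qed.

Lemma smooth_valZ a (v : E) : smooth_val (a *: v) = a *: smooth_val v.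
Proof. by []. Qed.

Lemma smooth_valB (v w : E) : smooth_val (v - w) = smooth_val v - smooth_val w.
Proof. by []. Qed.

Lemma smooth_ext (v w : E) : (forall i, cf v i = cf w i) -> v = w.
Proof. by move=> /cf_inj h; apply: val_inj. Qed.

Lemma smooth_exists (f : nat -> R[i]) (s C : R) :
  (forall i, nsq (f i) <= C * expR (s * lkap i)) ->
  forall v : E, exists w : E, forall i, cf w i = f i * cf v i.
Proof.
(* Smoothness is expressed by integer powers of [kap], so the real exponent [s] is rounded up. *)
move=> hf v; pose k := (Num.truncn `|s|).+1.
have sk : s <= k%:R.
  by rewrite (le_trans (ler_norm s)) // ltW // truncnS_gt.
have C0 : 0 <= C.
  have := le_trans (nsq_ge0 _) (hf 0%N); rewrite pmulr_lge0 ?expR_gt0 //.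
have hf' j : nsq (f j) <= C * kap j ^+ k.
  rewrite (le_trans (hf j)) // ler_wpM2l // -expR_lkap_nat ler_expR.
  by rewrite ler_wpM2r ?lkap_ge0.
have key n : exists C' : R, forall m,
    \sum_(j < m) kap j ^+ n * (nsq (f j) * nsq (cf v j)) <= C'.
  have [C' hC'] := smooth_valP v (n + k); exists (C * C') => m.
  apply: le_trans (ler_wpM2l C0 (hC' m)); rewrite mulr_sumr; apply: ler_sum => j _.
  have -> : C * (kap j ^+ (n + k) * nsq (cf v j)) =
    kap j ^+ n * (C * kap j ^+ k * nsq (cf v j)) by rewrite exprD; ring.
  by rewrite ler_wpM2l ?exprn_ge0 ?(ltW (kap_gt0 _)) // ler_wpM2r ?nsq_ge0.
have [C1 hC1] := key 0%N.
have [|w hw] := @diag_exists f (smooth_val v) C1.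
  by move=> m; apply: le_trans (hC1 m); apply: ler_sum => j _; rewrite expr0 mul1r.
have [|w' ww'] := @smooth_lift w; last by exists w' => j; rewrite ww'.
apply/smooth_setP => n; have [C2 hC2] := key n; exists C2 => m.
by under eq_bigr do rewrite hw nsqM.
Qed.

End DiagonalFrame.

(** * Sobolev scales and operators of finite order *)

Section GeometricSchur.
Variable R : realType.
Implicit Types x y : nat -> R.

(** One of the two truncated differences vanishes and the other is the distance of [m] and [n]. *)
Definition gap (m n : nat) : R := expR (- 1) ^+ ((m - n) + (n - m)).

Lemma gap_ge0 m n : 0 <= gap m n.
Proof. by rewrite exprn_ge0 // expR_ge0. Qed.

Lemma gapC m n : gap m n = gap n m.
Proof. by rewrite /gap addnC. Qed.

Lemma expRN1_lt1 : expR (- 1) < 1 :> R.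
Proof. by rewrite -[ltRHS]expR0 ltr_expR ltrN10. Qed.

Definition gap_sum : R := 2 / (1 - expR (- 1)).

Lemma gap_sum_ge0 : 0 <= gap_sum.
Proof. by rewrite divr_ge0 // subr_ge0 ltW // expRN1_lt1. Qed.

(* [gap m n] is dominated by the increments of a bounded monotone function
  of [n]. *)
Lemma sum_gap m N : \sum_(n < N) gap m n <= gap_sum.
Proof.
set r : R := expR (- 1); have r0 : 0 < r by exact: expR_gt0.
have r1 : 0 < 1 - r by rewrite subr_gt0 expRN1_lt1.
pose phi n : R := if (n <= m)%N then r ^+ (m - n) else 2 - r ^+ (n - m).
suff h : (1 - r) * \sum_(n < N) gap m n <= phi N.
  rewrite /gap_sum ler_pdivlMr // mulrC (le_trans h) // /phi.
  have rk k : r ^+ k <= 1 by rewrite exprn_ile1 // ltW // expRN1_lt1.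
  have rk0 k : 0 <= r ^+ k by rewrite exprn_ge0 // ltW.
  case: ifP => _; last by rewrite lerBlDr lerDl.
  by rewrite (le_trans (rk _)) // ler1n.
elim: N => [|N IH].
  by rewrite big_ord0 mulr0 /phi leq0n exprn_ge0 // ltW.
rewrite big_ord_recr /= mulrDr (le_trans (lerD IH (lexx _))) // -lerBrDl /phi /gap -/r.
case: (ltngtP N m) => [Nm|mN|->].
- have -> : (m - N)%N = (m - N.+1).+1 by rewrite subnSK.
  have -> : (N - m)%N = 0%N by apply/eqP; rewrite subn_eq0 ltnW.
  rewrite addn0 exprS; have : 0 <= r ^+ (m - N.+1) by rewrite exprn_ge0 // ltW.
  move=> q0; have := mulr_ge0 (sqr_ge0 (1 - r)) q0; clear -r; lra.
- rewrite /=.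
  have -> : (m - N)%N = 0%N by apply/eqP; rewrite subn_eq0 ltnW.
  by rewrite add0n subSn ?(ltnW mN) // exprS; lra.
- by rewrite subnn subSnn expr0 expr1; lra.
Qed.

Lemma cauchy_sum (a x : nat -> R) N : (forall n, 0 <= a n) ->
  (\sum_(n < N) a n * x n) ^+ 2 <=
  (\sum_(n < N) a n) * \sum_(n < N) a n * x n ^+ 2.
Proof.
move=> a0; elim: N => [|N IH]; first by rewrite !big_ord0 mul0r expr0n.
rewrite !big_ord_recr /=.
set A := \sum_(n < N) a n in IH *; set S := \sum_(n < N) _ in IH *.
set Q := \sum_(n < N) _ * _ ^+ 2 in IH *.
have A0 : 0 <= A by rewrite sumr_ge0.
have Q0 : 0 <= Q by rewrite sumr_ge0 // => i _; rewrite mulr_ge0 ?sqr_ge0.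
suff : 2 * S * x N <= A * x N ^+ 2 + Q.
  by have := a0 N; have := sqr_ge0 (x N); nra.
have [A00|An0] := eqVneq A 0.
  have : S = 0 by apply/eqP; rewrite -sqrf_eq0 eq_le sqr_ge0 (le_trans IH) ?A00 ?mul0r.
  by move=> ->; rewrite A00 mulr0 !mul0r add0r.
have Ap : 0 < A by rewrite lt_neqAle eq_sym An0.
rewrite -(ler_pM2l Ap); have := sqr_ge0 (A * x N - S); nra.
Qed.

(** The Schur test: [gap] is symmetric, so its row and column sums are all at most [gap_sum], and
    the bound is independent of [N] and [K]. *)
Lemma schur_gap x y (M : R) N K : 0 <= M ->
  (forall n, 0 <= x n) -> (forall m, 0 <= y m) ->
  (forall m, y m <= M * \sum_(n < N) gap m n * x n) ->
  \sum_(m < K) y m ^+ 2 <= (M * gap_sum) ^+ 2 * \sum_(n < N) x n ^+ 2.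
Proof.
move=> M0 x0 y0 h.
have h1 m : y m ^+ 2 <= M ^+ 2 * gap_sum * \sum_(n < N) gap m n * x n ^+ 2.
  apply: (@le_trans _ _ ((M * \sum_(n < N) gap m n * x n) ^+ 2)).
    by rewrite ler_sqr ?nnegrE // (le_trans (y0 m)).
  rewrite exprMn -mulrA ler_wpM2l ?sqr_ge0 //.
  apply: (le_trans (cauchy_sum x N (gap_ge0 m))).
  rewrite ler_wpM2r ?sum_gap // sumr_ge0 // => i _.
  by rewrite mulr_ge0 ?gap_ge0 ?sqr_ge0.
apply: (@le_trans _ _ (\sum_(m < K) M ^+ 2 * gap_sum * \sum_(n < N) gap m n * x n ^+ 2)).
  by apply: ler_sum => m _; exact: h1.
rewrite -mulr_sumr exchange_big /=.
have -> S : (M * gap_sum) ^+ 2 * S = M ^+ 2 * gap_sum * (gap_sum * S) by ring.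
rewrite ler_wpM2l ?mulr_ge0 ?sqr_ge0 ?gap_sum_ge0 // mulr_sumr.
apply: ler_sum => n _; rewrite -mulr_suml ler_wpM2r ?sqr_ge0 //.
by under eq_bigr do rewrite gapC; exact: sum_gap.
Qed.

End GeometricSchur.

(* [cf v i] are the coordinates of [v] in an eigenbasis of a Laplacian with
  eigenvalues [expR (ell i)]. *)
Record scale (R : realType) (E : lmodType R[i]) := Scale {
  cf : E -> nat -> R[i] ;
  ell : nat -> R ;
  nrm : E -> R ;
  cf_lin : forall a v w i, cf (a *: v + w) i = a * cf v i + cf w i ;
  cf_ext : forall v w, (forall i, cf v i = cf w i) -> v = w ;
  ell_ge0 : forall i, 0 <= ell i ;
  cf_exists : forall f (s C : R), (forall i, nsq (f i) <= C * expR (s * ell i)) ->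
    forall v, exists w, forall i, cf w i = f i * cf v i ;
  nrm_ge0 : forall v, 0 <= nrm v ;
  nrmP : forall v (C : R), 0 <= C ->
    nrm v <= C <-> forall n, \sum_(i < n) nsq (cf v i) <= C ^+ 2 ;
  nrmD : forall v w, nrm (v + w) <= nrm v + nrm w ;
  nrm_par : forall v w,
    nrm (v + w) ^+ 2 + nrm (v - w) ^+ 2 = 2 * (nrm v ^+ 2 + nrm w ^+ 2) }.

(** * Weights, diagonal multipliers and Sobolev norms *)

Section SobolevScale.
Variables (R : realType) (E : lmodType R[i]) (S : scale E).
Implicit Types (u v w : E) (f g : nat -> R[i]) (s t : R) (X Y Z : E -> E).
Local Notation cf := (cf S).
Local Notation ell := (ell S).
Local Notation nrm := (nrm S).

Lemma cfD v w i : cf (v + w) i = cf v i + cf w i.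
Proof. by have := cf_lin S 1 v w i; rewrite scale1r mul1r. Qed.

Lemma cf0 i : cf 0 i = 0.
Proof. by apply: (addIr (cf 0 i)); rewrite -cfD !add0r. Qed.

Lemma cfZ a v i : cf (a *: v) i = a * cf v i.
Proof. by have := cf_lin S a v 0 i; rewrite addr0 cf0 addr0. Qed.

Lemma cfN v i : cf (- v) i = - cf v i.
Proof. by rewrite -scaleN1r cfZ mulN1r. Qed.

Lemma cfB v w i : cf (v - w) i = cf v i - cf w i.
Proof. by rewrite cfD cfN. Qed.

Definition wt s i : R := expR (s * ell i).

Lemma wt_expR s i : wt s i = expR (s * ell i). Proof. by []. Qed.

Lemma wt_gt0 s i : 0 < wt s i. Proof. exact: expR_gt0. Qed.
Lemma wt_ge0 s i : 0 <= wt s i. Proof. exact: expR_ge0. Qed.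

Lemma wtD s t i : wt (s + t) i = wt s i * wt t i.
Proof. by rewrite /wt mulrDl expRD. Qed.

Lemma wt0 i : wt 0 i = 1.
Proof. by rewrite /wt mul0r expR0. Qed.

Lemma wt_le s t i : s <= t -> wt s i <= wt t i.
Proof. by move=> st; rewrite /wt ler_expR ler_wpM2r ?ell_ge0. Qed.

Lemma wt_sqr s i : wt (s / 2) i ^+ 2 = wt s i.
Proof. by rewrite expr2 -wtD -splitr. Qed.

(** By [cf_exists], polynomial growth in the eigenvalue lets the multiplier act on [E]; otherwise
    [diag] may return its default 0. *)
Definition polyg f := exists s C, forall i, nsq (f i) <= C * wt s i.

Definition diag f : E -> E := fun v => xget 0 [set w | forall i, cf w i = f i * cf v i].

Lemma cf_diag f v i : polyg f -> cf (diag f v) i = f i * cf v i.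
Proof.
by move=> [s [C hf]]; rewrite /diag (xgetPex 0 (cf_exists hf v)).
Qed.

Lemma polyg_wt s : polyg (fun i => (wt s i)%:C).
Proof. by exists (2 * s), 1 => i; rewrite nsqR mul1r mulr_natl mulr2n wtD expr2. Qed.

Lemma polyg_bounded f (C : R) : (forall i, nsq (f i) <= C) -> polyg f.
Proof. by move=> h; exists 0, C => i; rewrite wt0 mulr1. Qed.

Lemma polyg_ind (p : pred nat) : polyg (fun i => (p i)%:R).
Proof. by apply: (@polyg_bounded _ 1) => i; case: (p i); rewrite ?nsq0 ?nsq1 ?ler01. Qed.

Lemma diag_linear f : polyg f -> linear (diag f).
Proof.
move=> pf a v w; apply: (@cf_ext _ _ S) => i.
by rewrite cf_lin !cf_diag // cf_lin; ring.
Qed.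

Lemma nrm_cmp u v (C : R) : 0 <= C ->
  (forall i, nsq (cf u i) <= C ^+ 2 * nsq (cf v i)) -> nrm u <= C * nrm v.
Proof.
move=> C0 h; apply/nrmP => [|n]; first by rewrite mulr_ge0 ?nrm_ge0.
rewrite exprMn; apply: (@le_trans _ _ (\sum_(i < n) C ^+ 2 * nsq (cf v i))).
  by apply: ler_sum => i _.
rewrite -mulr_sumr ler_wpM2l ?sqr_ge0 //.
by move: n; apply/nrmP => //; exact: nrm_ge0.
Qed.

(** As the Laplacian has order 2, [H^s] weighs the coordinates by the power [s / 2] of the
    eigenvalue and their squared moduli by the power [s]. *)
Definition sob s v : R := nrm (diag (fun i => (wt (s / 2) i)%:C) v).

Lemma nsq_sob s v i :
  nsq (cf (diag (fun i => (wt (s / 2) i)%:C) v) i) = wt s i * nsq (cf v i).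
Proof. by rewrite cf_diag ?nsqM ?nsqR ?wt_sqr //; exact: polyg_wt. Qed.

Lemma sob_ge0 s v : 0 <= sob s v.
Proof. exact: nrm_ge0. Qed.

Lemma sobP s v (C : R) : 0 <= C ->
  sob s v <= C <-> forall n, \sum_(i < n) wt s i * nsq (cf v i) <= C ^+ 2.
Proof.
move=> C0; split=> [h n|h].
  by under eq_bigr do rewrite -nsq_sob; move: n; apply/nrmP.
by apply/nrmP => // n; under eq_bigr do rewrite nsq_sob.
Qed.

Lemma sob_cmp s t u v (C : R) : 0 <= C ->
  (forall i, wt s i * nsq (cf u i) <= C ^+ 2 * (wt t i * nsq (cf v i))) ->
  sob s u <= C * sob t v.
Proof. by move=> C0 h; apply: nrm_cmp => // i; rewrite !nsq_sob. Qed.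

Lemma sob0E v : sob 0 v = nrm v.
Proof.
congr nrm; apply: (@cf_ext _ _ S) => i; rewrite cf_diag; last exact: polyg_wt.
by rewrite mul0r wt0 mul1r.
Qed.

Lemma sob_le s t v : s <= t -> sob s v <= sob t v.
Proof.
move=> st; rewrite -[leRHS]mul1r; apply: sob_cmp => // i.
by rewrite expr1n mul1r ler_wpM2r ?nsq_ge0 // wt_le.
Qed.

Lemma sobD s v w : sob s (v + w) <= sob s v + sob s w.
Proof.
have := diag_linear (polyg_wt (s / 2)) 1 v w; rewrite !scale1r /sob => ->.
exact: nrmD.
Qed.

Lemma sobZ s (a : R[i]) (C : R) v : 0 <= C -> nsq a <= C ^+ 2 ->
  sob s (a *: v) <= C * sob s v.
Proof.
move=> C0 aC; apply: sob_cmp => // i; rewrite cfZ nsqM mulrCA.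
by rewrite ler_wpM2r ?mulr_ge0 ?wt_ge0 ?nsq_ge0.
Qed.

Lemma sobN s v : sob s (- v) = sob s v.
Proof.
have h w : sob s (- w) <= sob s w.
  by rewrite -scaleN1r -[leRHS]mul1r; apply: sobZ; rewrite ?nsqN ?nsq1 ?expr1n.
by apply/eqP; rewrite eq_le h /= -[X in sob s X <= _]opprK h.
Qed.

Lemma sobB s v w : sob s (v - w) <= sob s v + sob s w.
Proof. by rewrite (le_trans (sobD s v _)) // sobN. Qed.

Lemma sob0 s : sob s 0 = 0.
Proof.
apply/eqP; rewrite eq_le sob_ge0 andbT; apply/sobP => // n.
by rewrite big1 ?expr0n // => i _; rewrite cf0 nsq0 mulr0.
Qed.

Lemma sob_diag s t f (C : R) v : 0 <= C -> polyg f ->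
  (forall i, nsq (f i) <= C ^+ 2 * wt t i) -> sob s (diag f v) <= C * sob (s + t) v.
Proof.
move=> C0 pf h; apply: sob_cmp => // i; rewrite cf_diag // nsqM wtD.
rewrite (_ : C ^+ 2 * _ = wt s i * ((C ^+ 2 * wt t i) * nsq (cf v i))); last by ring.
by rewrite ler_wpM2l ?wt_ge0 // ler_wpM2r ?nsq_ge0.
Qed.

(** A [scale] carries no inner product, only the parallelogram law; with disjoint supports [u - v]
    and [u + v] have equal norms, and the law becomes Pythagoras. *)
Lemma sob_disjoint s u v : (forall i, cf u i = 0 \/ cf v i = 0) ->
  sob s (u + v) ^+ 2 = sob s u ^+ 2 + sob s v ^+ 2.
Proof.
move=> uv; pose L := diag (fun i => (wt (s / 2) i)%:C).
have L_lin := diag_linear (polyg_wt (s / 2)).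
have LD : L (u + v) = L u + L v by have := L_lin 1 u v; rewrite !scale1r.
have LB : L (u - v) = L u - L v.
  by rewrite addrC -scaleN1r /L L_lin scaleN1r addrC.
have := nrm_par S (L u) (L v); rewrite -LD -LB -!/(sob s _).
have -> : sob s (u - v) = sob s (u + v).
  suff h w : (forall i, cf u i = 0 \/ cf w i = 0) -> sob s (u - w) <= sob s (u + w).
    apply/eqP; rewrite eq_le h //= -[X in sob s (u + X) <= _]opprK h // => i; rewrite cfN.
    by case: (uv i) => ->; [left|right; rewrite oppr0].
  move=> uw; rewrite -[leRHS]mul1r; apply: sob_cmp => // i.
  rewrite expr1n mul1r ler_wpM2l ?wt_ge0 // cfB cfD.
  by case: (uw i) => ->; rewrite ?add0r ?sub0r ?subr0 ?addr0 ?nsqN.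
by move=> h; lra.
Qed.

End SobolevScale.

Lemma geometric_small (R : realType) (q K c : R) : 0 <= q < 1 -> 0 <= K -> 0 < c ->
  exists j, q ^+ j * K <= c.
Proof.
move=> /andP[q0 q1] K0 c0.
have : (fun j => q ^+ j) @ \oo --> (0 : R) by apply: cvg_expr; rewrite ger0_norm.
have K1 : 0 < K + 1 by rewrite ltr_wpDl.
move=> /cvgrPdist_le /(_ _ (divr_gt0 c0 K1)) [j _ /(_ j (leqnn j))] /=.
rewrite sub0r normrN ger0_norm ?exprn_ge0 // ler_pdivlMr // => h; exists j.
by apply: le_trans h; rewrite ler_wpM2l ?exprn_ge0 // lerDl.
Qed.

(** * Spectral blocks and interpolation *)

Section Blocks.
Variables (R : realType) (E : lmodType R[i]) (S : scale E).
Implicit Types (u v w : E) (f g : nat -> R[i]) (s t : R) (X Y Z : E -> E).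
Local Notation cf := (cf S).
Local Notation ell := (ell S).
Local Notation nrm := (nrm S).
Local Notation wt := (wt S).
Local Notation sob := (sob S).
Local Notation diag := (diag S).

Lemma lin0 X : linear X -> X 0 = 0.
Proof. by move=> lX; have := lX (-1) 0 0; rewrite scaleN1r oppr0 addr0 scaleN1r addNr. Qed.

Lemma linD X u v : linear X -> X (u + v) = X u + X v.
Proof. by move=> lX; have := lX 1 u v; rewrite !scale1r. Qed.

Lemma linZ X a u : linear X -> X (a *: u) = a *: X u.
Proof. by move=> lX; have := lX a u 0; rewrite (lin0 lX) !addr0. Qed.

Lemma linN X u : linear X -> X (- u) = - X u.
Proof. by move=> lX; rewrite -scaleN1r linZ // scaleN1r. Qed.

Lemma linB X u v : linear X -> X (u - v) = X u - X v.
Proof. by move=> lX; rewrite linD // linN. Qed.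

Lemma lin_sum X n (F : 'I_n -> E) : linear X -> X (\sum_i F i) = \sum_i X (F i).
Proof.
move=> lX; apply: (big_morph X) => [u v|]; [exact: linD|exact: lin0].
Qed.

Definition blk i := Num.truncn (ell i).

Lemma blk_bounds i : (blk i)%:R <= ell i < (blk i).+1%:R.
Proof. exact: truncn_itv (ell_ge0 S i). Qed.

Definition blkP n := diag (fun i => (blk i == n)%:R).
Definition blkQ n := diag (fun i => (blk i < n)%N%:R).

Lemma cf_blkP n v i : cf (blkP n v) i = if blk i == n then cf v i else 0.
Proof.
rewrite cf_diag; last exact: (@polyg_ind _ _ S (fun i => blk i == n)).
by case: ifP => _; rewrite ?mul1r ?mul0r.
Qed.

Lemma cf_blkQ n v i : cf (blkQ n v) i = if (blk i < n)%N then cf v i else 0.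
Proof.
rewrite cf_diag; last exact: (@polyg_ind _ _ S (fun i => (blk i < n)%N)).
by case: ifP => _; rewrite ?mul1r ?mul0r.
Qed.

Lemma blkP_lin n : linear (blkP n).
Proof. exact: diag_linear (polyg_ind S (fun i => blk i == n)). Qed.

Lemma blkQ_lin n : linear (blkQ n).
Proof. exact: diag_linear (polyg_ind S (fun i => (blk i < n)%N)). Qed.

Lemma blkQS n v : blkQ n.+1 v = blkQ n v + blkP n v.
Proof.
apply: (@cf_ext _ _ S) => i; rewrite cfD !cf_blkQ cf_blkP ltnS leq_eqVlt.
by case: eqVneq => [->|_] /=; rewrite ?ltnn ?add0r ?addr0.
Qed.

Lemma blkQ0 v : blkQ 0 v = 0.
Proof. by apply: (@cf_ext _ _ S) => i; rewrite cf_blkQ cf0. Qed.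

Lemma blkQE n v : blkQ n v = \sum_(k < n) blkP k v.
Proof.
by elim: n => [|n IH]; [rewrite big_ord0 blkQ0|rewrite big_ord_recr /= -IH blkQS].
Qed.

Lemma sob_blkQE s n v : sob s (blkQ n v) ^+ 2 = \sum_(k < n) sob s (blkP k v) ^+ 2.
Proof.
elim: n => [|n IH]; first by rewrite blkQ0 sob0 expr0n big_ord0.
rewrite blkQS big_ord_recr /= -IH sob_disjoint // => i.
rewrite cf_blkP cf_blkQ; case: eqVneq => [->|_]; last by right.
by rewrite ltnn; left.
Qed.

Lemma sob_sub s u v : (forall i, cf u i = cf v i \/ cf u i = 0) -> sob s u <= sob s v.
Proof.
move=> h; rewrite -[leRHS]mul1r; apply: sob_cmp => // i.
rewrite expr1n mul1r ler_wpM2l ?wt_ge0 //.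
by case: (h i) => ->; rewrite ?nsq0 ?nsq_ge0.
Qed.

Lemma sob_blkQ s n v : sob s (blkQ n v) <= sob s v.
Proof. by apply: sob_sub => i; rewrite cf_blkQ; case: ifP => _; [left|right]. Qed.

Lemma sob_blkP s n v : sob s (blkP n v) <= sob s v.
Proof. by apply: sob_sub => i; rewrite cf_blkP; case: ifP => _; [left|right]. Qed.

(** Any finite set of coordinates lies in finitely many blocks. *)
Lemma sob_blkQ_lim s v (C : R) : 0 <= C ->
  (forall n, sob s (blkQ n v) <= C) -> sob s v <= C.
Proof.
move=> C0 h; apply/sobP => // n.
pose N := (\max_(i < n) blk i).+1.
have /sobP -/(_ C0 n) := h N.
congr (_ <= _); apply: eq_bigr => i _; rewrite cf_blkQ /N ltnS.
by rewrite (leq_bigmax (F := fun i : 'I_n => blk i)).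
Qed.

Lemma sob_tail s n v : sob s (v - blkQ n v) <= expR (- (n%:R / 2)) * sob (s + 1) v.
Proof.
apply: sob_cmp => [|i]; first exact: expR_ge0.
rewrite cfB cf_blkQ expr2 -expRD -opprD -splitr wtD.
case: ltnP => [_|ni]; first by rewrite subrr nsq0 mulr0 !mulr_ge0 ?expR_ge0 ?nsq_ge0.
rewrite subr0 mulrA ler_wpM2r ?nsq_ge0 // mulrCA ler_peMr ?wt_ge0 //.
rewrite /wt mul1r -expRD -[leLHS]expR0 ler_expR addrC subr_ge0.
by have /andP[h _] := blk_bounds i; apply: le_trans h; rewrite ler_nat.
Qed.

Lemma sob_blk_up s s' n v : s <= s' ->
  sob s' (blkP n v) <= expR ((s' - s) * n.+1%:R / 2) * sob s (blkP n v).
Proof.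
move=> ss; apply: sob_cmp => [|i]; first exact: expR_ge0.
rewrite cf_blkP; case: eqVneq => [bn|_]; last by rewrite nsq0 !mulr0.
rewrite mulrA ler_wpM2r ?nsq_ge0 // expr2 -!expRD -splitr ler_expR -lerBlDr -mulrBl.
rewrite ler_wpM2l ?subr_ge0 //.
by have /andP[_ h] := blk_bounds i; rewrite -bn ltW.
Qed.

Lemma sob_blk_down s s' n v : s <= s' ->
  sob s (blkP n v) <= expR (- ((s' - s) * n%:R / 2)) * sob s' (blkP n v).
Proof.
move=> ss; apply: sob_cmp => [|i]; first exact: expR_ge0.
rewrite cf_blkP; case: eqVneq => [bn|_]; last by rewrite nsq0 !mulr0.
rewrite mulrA ler_wpM2r ?nsq_ge0 // expr2 -!expRD -opprD -splitr ler_expR.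
rewrite addrC lerBrDr -lerBrDl -mulrBl ler_wpM2l ?subr_ge0 //.
by have /andP[h _] := blk_bounds i; rewrite -bn.
Qed.

Lemma gap_le (m n : nat) : (m <= n)%N -> gap R m n = expR (m%:R - n%:R).
Proof.
move=> mn; rewrite /gap (_ : (m - n)%N = 0%N) ?add0n; last by apply/eqP.
by rewrite -expRM_natl natrB // mulrN1 opprB.
Qed.

(** Each entry of the block matrix is bounded separately, with a common constant. This alone does
    not bound [X], but such bounds at two other exponents make the matrix summable. *)
Definition block_bounded t X s := exists2 M : R, 0 <= M &
  forall m n v, sob (s - t) (blkP m (X (blkP n v))) <= M * sob s (blkP n v).

(** Inside blocks, a bound at [a] can be moved to [s] at the cost [expR ((s - a) * (m - n) / 2)], a
    gain when [m <= n]; the bound at [b] serves [m > n]. A distance of 2 between the exponents turns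
    the gain into [gap], and [ca], [cb] pay for the width of a block. *)
Lemma block_decay t X s a b : a <= s - 2 -> s + 2 <= b ->
  block_bounded t X a -> block_bounded t X b ->
  exists2 M : R, 0 <= M & forall m n v,
    sob (s - t) (blkP m (X (blkP n v))) <= M * gap R m n * sob s (blkP n v).
Proof.
move=> ha hb [Ma Ma0 hMa] [Mb Mb0 hMb].
pose ca := expR ((s - a) / 2); pose cb := expR ((b - s) / 2).
have ca0 : 0 <= ca by exact: expR_ge0.
have cb0 : 0 <= cb by exact: expR_ge0.
exists (ca * Ma + cb * Mb) => [|m n v]; first by rewrite addr_ge0 ?mulr_ge0.
set A := sob _ _; set B := sob s _.
have B0 : 0 <= B by exact: sob_ge0.
have G0 := gap_ge0 R m n.
case: (leqP m n) => mn.
  suff h : A <= ca * Ma * gap R m n * B.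
    rewrite (le_trans h) // ler_wpM2r // ler_wpM2r // lerDl mulr_ge0 //.
  have sa : a <= s by lra.
  have h1 : A <= expR ((s - a) * m.+1%:R / 2) * sob (a - t) (blkP m (X (blkP n v))).
    by rewrite (_ : s - a = (s - t) - (a - t)); [apply: sob_blk_up; lra|ring].
  have h2 := hMa m n v; have h3 := sob_blk_down n v sa.
  apply: (le_trans h1); apply: (le_trans (ler_wpM2l (expR_ge0 _) h2)).
  have := ler_wpM2l Ma0 h3 => h4.
  apply: (le_trans (ler_wpM2l (expR_ge0 _) h4)).
  rewrite -/B [leLHS](_ : _ = Ma * (expR ((s - a) * m.+1%:R / 2) *
    expR (- ((s - a) * n%:R / 2))) * B); last by ring.
  rewrite ler_wpM2r // [ca * Ma]mulrC -[Ma * ca * _]mulrA ler_wpM2l // gap_le // -!expRD ler_expR.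
  have : (m%:R : R) <= n%:R by rewrite ler_nat.
  by rewrite -natr1; nra.
suff h : A <= cb * Mb * gap R m n * B.
  rewrite (le_trans h) // ler_wpM2r // ler_wpM2r // lerDr mulr_ge0 //.
have sb : s <= b by lra.
have h1 : A <= expR (- ((b - s) * m%:R / 2)) * sob (b - t) (blkP m (X (blkP n v))).
  by rewrite (_ : b - s = (b - t) - (s - t)); [apply: sob_blk_down; lra|ring].
have h2 := hMb m n v; have h3 := sob_blk_up n v sb.
apply: (le_trans h1); apply: (le_trans (ler_wpM2l (expR_ge0 _) h2)).
apply: (le_trans (ler_wpM2l (expR_ge0 _) (ler_wpM2l Mb0 h3))).
rewrite -/B [leLHS](_ : _ = Mb * (expR (- ((b - s) * m%:R / 2)) *
  expR ((b - s) * n.+1%:R / 2)) * B); last by ring.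
rewrite ler_wpM2r // [cb * Mb]mulrC -[Mb * cb * _]mulrA ler_wpM2l // gapC gap_le ?(ltnW mn) //.
rewrite -!expRD ler_expR.
have nm : 0 <= (m%:R : R) - n%:R by rewrite subr_ge0 ler_nat ltnW.
have bs : 0 <= b - s - 2 by lra.
have := mulr_ge0 bs nm; rewrite -[n.+1%:R]natr1; lra.
Qed.

Lemma sob_sum s n (F : 'I_n -> E) : sob s (\sum_i F i) <= \sum_i sob s (F i).
Proof.
elim: n F => [|n IH] F; first by rewrite !big_ord0 sob0.
by rewrite !big_ord_recr /= (le_trans (sobD _ _ _ _)) // lerD2r.
Qed.

(* Interpolation: block bounds at two exponents [a < s < b] decay geometrically
  off the diagonal at [s], and the Schur test applies. *)
Lemma bounded_of_blocks t X s a b : linear X ->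
  (exists s0 (C : R), forall v, nrm (X v) <= C * sob s0 v) ->
  a <= s - 2 -> s + 2 <= b -> block_bounded t X a -> block_bounded t X b ->
  exists2 M : R, 0 <= M & forall v, sob (s - t) (X v) <= M * sob s v.
Proof.
move=> lX [s0 [C0 hC0]] ha hb Xa Xb.
have [M M0 hM] := block_decay ha hb Xa Xb.
pose L := M * gap_sum R; have L0 : 0 <= L by rewrite mulr_ge0 ?gap_sum_ge0.
have QQ K N v : sob (s - t) (blkQ K (X (blkQ N v))) <= L * sob s v.
  rewrite -ler_sqr ?nnegrE ?mulr_ge0 ?sob_ge0 // exprMn.
  apply: (@le_trans _ _ (L ^+ 2 * sob s (blkQ N v) ^+ 2)); last first.
    by rewrite ler_wpM2l ?sqr_ge0 // ler_sqr ?nnegrE ?sob_ge0 ?sob_blkQ.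
  rewrite !sob_blkQE; apply: (@schur_gap _ (fun n => sob s (blkP n v))
      (fun m => sob (s - t) (blkP m (X (blkQ N v)))) M N K) => // [n|m|m].
  - exact: sob_ge0.
  - exact: sob_ge0.
  rewrite blkQE (lin_sum _ lX) (lin_sum _ (blkP_lin m)).
  rewrite mulr_sumr; apply: (le_trans (sob_sum _ _)); apply: ler_sum => n _.
  by rewrite mulrA hM.
exists L => // v; apply: sob_blkQ_lim => [|K]; first by rewrite mulr_ge0 ?sob_ge0.
apply/ler_addgt0Pr => c c0.
(* [QQ] covers truncated arguments only. For fixed [K], the a priori bound makes the contribution of
   the tail [v - blkQ N v] at most [W] times [expR (- (1 / 2)) ^+ N]. *)
pose W := expR (`|s - t| * K.+1%:R / 2) * `|C0| * sob (s0 + 1) v.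
have W0 : 0 <= W by rewrite !mulr_ge0 ?expR_ge0 ?sob_ge0.
have q01 : 0 <= (expR (- (1 / 2)) : R) < 1.
  by rewrite expR_ge0 -[ltRHS]expR0 ltr_expR oppr_lt0 divr_gt0.
have [N hN] := geometric_small q01 W0 c0.
have -> : X v = X (blkQ N v) + X (v - blkQ N v) by rewrite -linD // addrC subrK.
rewrite (linD _ _ (blkQ_lin K)) (le_trans (sobD _ _ _ _)) // lerD ?QQ //.
apply: le_trans hN.
have low u : sob (s - t) (blkQ K u) <= expR (`|s - t| * K.+1%:R / 2) * nrm u.
  rewrite -sob0E; apply: sob_cmp => [|i]; first exact: expR_ge0.
  rewrite cf_blkQ; case: ltnP => [bi|_]; last first.
    by rewrite nsq0 !mulr0 mulr_ge0 ?sqr_ge0 // mulr_ge0 ?wt_ge0 ?nsq_ge0.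
  rewrite wt0 mul1r ler_wpM2r ?nsq_ge0 // expr2 -expRD -splitr ler_expR.
  apply: (@le_trans _ _ (`|s - t| * ell i)).
    by rewrite ler_wpM2r ?ell_ge0 ?ler_norm.
  rewrite ler_wpM2l //; have /andP[_ h] := blk_bounds i.
  by apply: (le_trans (ltW h)); rewrite ler_nat ltnW.
apply: (le_trans (low _)).
rewrite [leRHS](_ : _ = expR (`|s - t| * K.+1%:R / 2) *
  (`|C0| * (expR (- (1 / 2)) ^+ N * sob (s0 + 1) v))); last by rewrite /W; ring.
rewrite ler_wpM2l ?expR_ge0 // (le_trans (hC0 _)) //.
apply: (@le_trans _ _ (`|C0| * sob s0 (v - blkQ N v))).
  by rewrite ler_wpM2r ?sob_ge0 ?ler_norm.
rewrite ler_wpM2l // (le_trans (sob_tail _ _ _)) // -expRM_natl.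
by rewrite (_ : N%:R * - (1 / 2) = - (N%:R / 2)) //; ring.
Qed.

End Blocks.

(** * Operators of a given order, and the Sylvester equation *)

Section OrderCalculus.
Variables (R : realType) (E : lmodType R[i]) (S : scale E).
Implicit Types (u v w : E) (f g : nat -> R[i]) (s t : R) (X Y Z : E -> E).
Local Notation cf := (cf S).
Local Notation ell := (ell S).
Local Notation nrm := (nrm S).
Local Notation wt := (wt S).
Local Notation sob := (sob S).
Local Notation diag := (diag S).
Local Notation blkP := (blkP S).
Local Notation polyg := (polyg S).

Definition sob_bounded t X s := exists M : R, forall v, sob (s - t) (X v) <= M * sob s v.

Lemma sob_bounded_ge0 t X s : sob_bounded t X s ->
  exists2 M : R, 0 <= M & forall v, sob (s - t) (X v) <= M * sob s v.
Proof.
move=> [M hM]; exists `|M| => // v; apply: (le_trans (hM v)).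
by rewrite ler_wpM2r ?sob_ge0 ?ler_norm.
Qed.

Definition sop t X := linear X /\ forall s, sob_bounded t X s.

Lemma sop_linear t X : sop t X -> linear X. Proof. by case. Qed.

Lemma sop0 t : sop t (fun=> 0).
Proof.
split=> [a u v|s]; first by rewrite scaler0 addr0.
by exists 0 => v; rewrite sob0 mul0r.
Qed.

Lemma sop_lin t (a : R[i]) X Y : sop t X -> sop t Y -> sop t (fun v => a *: X v + Y v).
Proof.
move=> [lX hX] [lY hY]; split=> [b u v|s].
  by rewrite lX lY !scalerDr !scalerA addrACA (mulrC a).
have [M M0 hM] := sob_bounded_ge0 (hX s); have [K K0 hK] := sob_bounded_ge0 (hY s).
pose c := Num.sqrt (nsq a).
exists (c * M + K) => v; apply: (le_trans (sobD _ _ _ _)).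
rewrite mulrDl lerD //; apply: (@le_trans _ _ (c * sob (s - t) (X v))).
  by apply: sobZ; rewrite ?sqrtr_ge0 // sqr_sqrtr ?nsq_ge0.
by rewrite -mulrA ler_wpM2l ?sqrtr_ge0.
Qed.

Lemma sopD t X Y : sop t X -> sop t Y -> sop t (fun v => X v + Y v).
Proof.
move=> hX hY; rewrite (_ : (fun v => _) = (fun v => 1 *: X v + Y v)).
  exact: sop_lin.
by apply: funext => v; rewrite scale1r.
Qed.

Lemma sopZ t a X : sop t X -> sop t (fun v => a *: X v).
Proof.
move=> hX; rewrite (_ : (fun v => _) = (fun v => a *: X v + 0)).
  by apply: sop_lin => //; exact: sop0.
by apply: funext => v; rewrite addr0.
Qed.

Lemma sopN t X : sop t X -> sop t (fun v => - X v).
Proof.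
move=> hX; rewrite (_ : (fun v => _) = (fun v => (-1) *: X v)); first exact: sopZ.
by apply: funext => v; rewrite scaleN1r.
Qed.

Lemma sopB t X Y : sop t X -> sop t Y -> sop t (fun v => X v - Y v).
Proof. by move=> hX hY; apply: sopD => //; exact: sopN. Qed.

Lemma sop_le s t X : s <= t -> sop s X -> sop t X.
Proof.
move=> st [lX hX]; split=> // r; have [M hM] := hX r; exists M => v.
by apply: le_trans (hM v); apply: sob_le; lra.
Qed.

Lemma sop_comp s t X Y : sop s X -> sop t Y -> sop (s + t) (X \o Y).
Proof.
move=> [lX hX] [lY hY]; split=> [a u v|r]; first by rewrite /= lY lX.
have [M hM] := hY r; have [K K0 hK] := sob_bounded_ge0 (hX (r - t)).
exists (K * M) => v; rewrite /= (_ : r - (s + t) = r - t - s); last by ring.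
by rewrite (le_trans (hK _)) // -mulrA ler_wpM2l.
Qed.

Lemma sop_diag t f (C : R) : (forall i, nsq (f i) <= C * wt t i) -> sop t (diag f).
Proof.
move=> hf; have pf : polyg f by exists t, C.
split=> [|s]; first exact: diag_linear.
exists (Num.sqrt `|C|) => v.
have := @sob_diag _ _ S (s - t) t f (Num.sqrt `|C|) v (sqrtr_ge0 _) pf.
rewrite subrK; apply => i; rewrite sqr_sqrtr // (le_trans (hf i)) //.
by rewrite ler_wpM2r ?wt_ge0 // ler_norm.
Qed.

Lemma block_bounded_sob t X s : sob_bounded t X s -> block_bounded S t X s.
Proof.
move=> /sob_bounded_ge0[M M0 hM]; exists M => // m n v.
exact: le_trans (sob_blkP _ _ _ _) (hM _).
Qed.

Lemma sop_blocks t X : linear X ->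
  (exists s0 (C : R), forall v, nrm (X v) <= C * sob s0 v) ->
  (forall s, exists2 a, a <= s & block_bounded S t X a) ->
  (forall s, exists2 b, s <= b & block_bounded S t X b) -> sop t X.
Proof.
move=> lX cX hlo hhi; split=> // s.
have [a sa Xa] := hlo (s - 2); have [b sb Xb] := hhi (s + 2).
by have [M _ hM] := bounded_of_blocks lX cX sa sb Xa Xb; exists M.
Qed.

(** Exponents arbitrarily far out in both directions suffice; one with [b >= t] also supplies the a
    priori bound. *)
Lemma sop_interp t X : linear X ->
  (forall s, exists2 a, a <= s & sob_bounded t X a) ->
  (forall s, exists2 b, s <= b & sob_bounded t X b) -> sop t X.
Proof.
move=> lX hlo hhi; apply: sop_blocks => // [|s|s].
- have [b tb [M hM]] := hhi t; exists b, M => v.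
  by rewrite -sob0E (le_trans _ (hM v)) // sob_le // subr_ge0.
- by have [a sa /block_bounded_sob Xa] := hlo s; exists a.
- by have [b sb /block_bounded_sob Xb] := hhi s; exists b.
Qed.

(* The square root of the Laplacian; [kapd] and [kapi] below are the Laplacian and
  its inverse. *)
Definition Lam : E -> E := diag (fun i => (wt (1 / 2) i)%:C).

Lemma cf_Lam v i : cf (Lam v) i = (wt (1 / 2) i)%:C * cf v i.
Proof. by rewrite cf_diag //; exact: polyg_wt. Qed.

Lemma sop_Lam : sop 1 Lam.
Proof. by apply: (@sop_diag _ _ 1) => i; rewrite nsqR wt_sqr mul1r. Qed.

Lemma Lam_linear : linear Lam. Proof. exact: sop_linear sop_Lam. Qed.

(** [edge n] is the upper bound of [Lam] on block [n], and [expR (- (1 / 2)) * edge n] the lower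
    one; [ratio] is the relative width. *)
Definition edge n : R := expR (n.+1%:R / 2).
Definition ratio : R := 1 - expR (- (1 / 2)).

Lemma edge_gt0 n : 0 < edge n. Proof. exact: expR_gt0. Qed.

Lemma ratio_itv : 0 <= ratio < 1.
Proof.
rewrite /ratio subr_ge0 gtrBl expR_gt0 andbT -[leRHS]expR0 ler_expR.
by rewrite oppr_le0 divr_ge0.
Qed.

(* On a block, [Lam] is close to the constant [edge n] with relative error
  [ratio < 1]. *)
Lemma edge_Lam s n u : (forall i, blk S i != n -> cf u i = 0) ->
  sob s ((edge n)%:C *: u - Lam u) <= ratio * edge n * sob s u.
Proof.
move=> hu; have /andP[r0 _] := ratio_itv.
apply: sob_cmp => [|i]; first by rewrite mulr_ge0 // ltW ?edge_gt0.
rewrite cfB cfZ cf_Lam -mulrBl nsqM -rmorphB /= nsqR mulrCA.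
have [bi|bi] := eqVneq (blk S i) n; last by rewrite hu // nsq0 !mulr0.
rewrite ler_wpM2r ?mulr_ge0 ?wt_ge0 ?nsq_ge0 //.
have /andP[h1 h2] := blk_bounds S i.
have w1 : wt (1 / 2) i <= edge n.
  by rewrite wt_expR /edge ler_expR -bi mulrC mulrA mulr1 ler_wpM2r ?invr_ge0 // ltW.
rewrite ler_sqr ?nnegrE ?subr_ge0 ?mulr_ge0 ?(ltW (edge_gt0 _)) //.
have : expR (- (1 / 2)) * edge n <= wt (1 / 2) i.
  rewrite /edge wt_expR -expRD ler_expR -bi; move: h1; rewrite -[(blk S i).+1%:R]natr1; lra.
by rewrite /ratio; lra.
Qed.

(* A solution of a Sylvester equation gains one order.  On each pair of
  blocks [Lam] is replaced by a constant; the relative error [ratio < 1] is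
  absorbed in the left-hand side. *)
Lemma sylvester t (l : R) Y Z : 0 < l -> linear Y ->
  (exists s0 (C : R), forall v, nrm (Y v) <= C * sob s0 v) ->
  sop (t + 1) Z -> (forall v, Lam (Y v) + l%:C *: Y (Lam v) = Z v) -> sop t Y.
Proof.
move=> l0 lY cY hZ YZ; have /andP[q0 q1] := ratio_itv.
have l0' := ltW l0.
suff h s : block_bounded S t Y s by apply: sop_blocks => // s; exists s.
have [M M0 hM] := sob_bounded_ge0 (hZ.2 s).
(* The fixed point of the map [K |-> ratio * K + M] of [step]. *)
pose L := M / (1 - ratio).
have L0 : 0 <= L by rewrite divr_ge0 // subr_ge0 ltW.
exists L => // m n.
pose valid K := forall v, sob (s - t) (blkP m (Y (blkP n v))) <= K * sob s (blkP n v).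
have step K : 0 <= K -> valid K -> valid (ratio * K + M).
  move=> K0 hK v; set u := blkP n v; set y := blkP m (Y u).
  have c0 : 0 < edge m + l * edge n by rewrite addr_gt0 ?mulr_gt0 ?edge_gt0.
  pose w := (edge n)%:C *: u - Lam u.
  have uw : blkP n w = w.
    apply: (@cf_ext _ _ S) => i; rewrite cf_blkP /w cfB cfZ cf_Lam /u cf_blkP.
    by case: ifP => bn; rewrite ?bn ?mulr0 ?subrr.
  (* The equation between the blocks [n] and [m], with [Lam] replaced by [edge] on both sides. The
     two errors add up to [ratio] times the factor on the left, which is positive because
     [l > 0]. *)
  have key : (edge m + l * edge n)%:C *: y =
      blkP m (Z u) + ((edge m)%:C *: y - Lam y) + l%:C *: blkP m (Y w).
    apply: (@cf_ext _ _ S) => i; rewrite -YZ /w (linB _ _ lY) (linZ _ _ lY).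
    rewrite /y !(cfB, cfD, cfZ, cf_Lam, cf_blkP) rmorphD rmorphM /=.
    by case: ifP => bn; rewrite ?bn; ring.
  rewrite -(ler_pM2l c0).
  have hc : (edge m + l * edge n) * sob (s - t) y <=
      sob (s - t) ((edge m + l * edge n)%:C *: y).
    set c := edge m + _ in c0 *.
    have := @sobZ _ _ S (s - t) c^-1%:C c^-1 (c%:C *: y).
    rewrite scalerA -rmorphM /= mulVf ?gt_eqF // scale1r nsqR lexx.
    move=> h; rewrite -ler_pdivlMl //; apply: h => //.
    by rewrite invr_ge0 ltW.
  apply: (le_trans hc); rewrite key.
  (* The order is gained here: raising the exponent by one on block [m] costs [edge m], which the
     factor on the left pays for. *)
  have b1 : sob (s - t) (blkP m (Z u)) <= edge m * (M * sob s u).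
    apply: (@le_trans _ _ (edge m * sob (s - t - 1) (blkP m (Z u)))).
      have := @sob_blk_up _ _ S (s - t - 1) (s - t) m (Z u).
      rewrite subKr mul1r; apply; lra.
    rewrite ler_wpM2l ?(ltW (edge_gt0 _)) // (le_trans (sob_blkP _ _ _ _)) //.
    by rewrite (_ : s - t - 1 = s - (t + 1)) //; ring.
  have b2 : sob (s - t) ((edge m)%:C *: y - Lam y) <= ratio * edge m * (K * sob s u).
    apply: (le_trans (edge_Lam _ _)) => [i|].
      by rewrite /y cf_blkP => /negbTE ->.
    by rewrite ler_wpM2l ?mulr_ge0 ?(ltW (edge_gt0 _)) //; exact: hK.
  have b3 : sob (s - t) (l%:C *: blkP m (Y w)) <= l * (K * (ratio * edge n * sob s u)).
    apply: (@le_trans _ _ (l * sob (s - t) (blkP m (Y w)))).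
      by apply: sobZ => //; rewrite nsqR.
    rewrite ler_wpM2l // -uw (le_trans (hK w)) // ler_wpM2l // uw.
    by apply: edge_Lam => i; rewrite /u cf_blkP => /negbTE ->.
  apply: (le_trans (sobD _ _ _ _)); apply: (le_trans (lerD (sobD _ _ _ _) (lexx _))).
  have p : 0 <= l * edge n * (M * sob s u).
    by rewrite !mulr_ge0 ?sob_ge0 // ltW // edge_gt0.
  by move: b1 b2 b3 p; rewrite -/u; lra.
have [s0 [C hC]] := cY.
pose C1 := expR (`|s - t| * m.+1%:R / 2); pose C2 := expR (`|s0 - s| * n.+1%:R / 2).
have C10 : 0 <= C1 by exact: expR_ge0.
have C20 : 0 <= C2 by exact: expR_ge0.
have blk_up a b k v : sob b (blkP k v) <= expR (`|b - a| * k.+1%:R / 2) * sob a (blkP k v).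
  case: (leP a b) => ab.
    by rewrite ger0_norm ?subr_ge0 //; exact: sob_blk_up.
  rewrite (le_trans (sob_le _ _ (ltW ab))) // ler_peMl ?sob_ge0 //.
  by rewrite -[leLHS]expR0 ler_expR divr_ge0 // mulr_ge0.
(* This starting constant depends on [m] and [n]; iterating [step] damps it by [ratio ^+ j], and
   only the uniform [L] survives. *)
have init : valid (C1 * (`|C| * C2)).
  move=> v; apply: (@le_trans _ _ (C1 * nrm (Y (blkP n v)))).
    rewrite -sob0E /C1 (_ : s - t = s - t - 0); last by rewrite subr0.
    rewrite (le_trans (blk_up 0 _ _ _)) // subr0 ler_wpM2l ?expR_ge0 //.
    exact: sob_blkP.
  rewrite -!mulrA ler_wpM2l // (le_trans (hC _)) //.
  apply: (@le_trans _ _ (`|C| * sob s0 (blkP n v))).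
    by rewrite ler_wpM2r ?sob_ge0 ?ler_norm.
  by rewrite ler_wpM2l //; exact: blk_up.
set K := C1 * (`|C| * C2) in init.
have K0 : 0 <= K by rewrite !mulr_ge0.
have all_valid j : valid (ratio ^+ j * K + L).
  elim: j => [|j IH].
    by move=> v; rewrite expr0 mul1r (le_trans (init v)) // ler_wpM2r ?sob_ge0 // lerDl.
  have := step _ _ IH; rewrite (_ : ratio * _ + M = ratio ^+ j.+1 * K + L).
    by apply; rewrite addr_ge0 // mulr_ge0 // exprn_ge0.
  rewrite exprS /L; field; rewrite subr_eq0 eq_sym; apply/eqP => r1.
  by rewrite -r1 ltxx in q1.
move=> v; apply/ler_addgt0Pr => c c0.
have [j hj] := geometric_small (q := ratio) (K := K * sob s (blkP n v))
  ltac:(by rewrite q0 q1) ltac:(by rewrite mulr_ge0 ?sob_ge0) c0.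
apply: (le_trans (all_valid j v)); rewrite mulrDl addrC lerD2l.
by rewrite -mulrA.
Qed.

Definition kapd : E -> E := diag (fun i => (wt 1 i)%:C).
Definition kapi : E -> E := diag (fun i => (wt (-1) i)%:C).

Lemma cf_kapd v i : cf (kapd v) i = (wt 1 i)%:C * cf v i.
Proof. by rewrite cf_diag //; exact: polyg_wt. Qed.

Lemma cf_kapi v i : cf (kapi v) i = (wt (-1) i)%:C * cf v i.
Proof. by rewrite cf_diag //; exact: polyg_wt. Qed.

Lemma kapdK : cancel kapd kapi.
Proof.
move=> v; apply: (@cf_ext _ _ S) => i; rewrite cf_kapi cf_kapd mulrA -rmorphM /=.
by rewrite -wtD addNr wt0 mul1r.
Qed.

Lemma kapiK : cancel kapi kapd.
Proof.
move=> v; apply: (@cf_ext _ _ S) => i; rewrite cf_kapd cf_kapi mulrA -rmorphM /=.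
by rewrite -wtD addrN wt0 mul1r.
Qed.

Lemma Lam_Lam v : Lam (Lam v) = kapd v.
Proof.
apply: (@cf_ext _ _ S) => i; rewrite !cf_Lam cf_kapd mulrA -rmorphM /=.
by rewrite -wtD -splitr.
Qed.

Lemma sop_kapd : sop 2 kapd.
Proof.
apply: (@sop_diag _ _ 1) => i.
by rewrite nsqR mul1r expr2 -wtD.
Qed.

Lemma sob_wt_shift s t v : sob s (diag (fun i => (wt (t / 2) i)%:C) v) = sob (s + t) v.
Proof.
have p := polyg_wt S (t / 2).
apply/eqP; rewrite eq_le -[leRHS]mul1r -[X in _ && (_ <= X)]mul1r.
by rewrite !sob_cmp // => i; rewrite expr1n mul1r cf_diag // nsqM nsqR wt_sqr mulrA -wtD.
Qed.

Lemma sob_kapd s v : sob s (kapd v) = sob (s + 2) v.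
Proof. by rewrite -sob_wt_shift divff. Qed.

Lemma sob_kapi s v : sob s (kapi v) = sob (s - 2) v.
Proof. by rewrite -sob_wt_shift mulNr divff. Qed.

Lemma sob_Lam s v : sob s (Lam v) = sob (s + 1) v.
Proof. by rewrite -sob_wt_shift. Qed.

(** * Mapping properties of twisted differential operators *)

Section DifferentialOperators.
Variables (F : nat -> set (E -> E)) (th : (E -> E) -> E -> E).
Hypothesis F_linear : forall m X, F m X -> linear X.
Hypothesis th_filt : forall m X, F m X -> F m (th X).
Hypothesis th_surj : forall m X, F m X -> exists2 Y, F m Y & th Y = X.
Hypothesis F_comm : forall m X, F m X ->
  F m.+1 (fun v => kapd (X v) - th (th X) (kapd v)).
Hypothesis F_bound : forall m X, F m X ->
  exists M : R, forall v, nrm (X v) <= M * sob m%:R v.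

(** The induction on [k] runs over all operators and orders at once: [kapd \o X] is the twice
    twisted [X] composed with [kapd], plus a remainder of order [m + 1], and [kapd] shifts exponents
    by 2. *)
Lemma DO_pos m X k : F m X -> sob_bounded m%:R X (m%:R + (2 * k)%:R).
Proof.
elim: k m X => [|k IH] m X FX.
  have [M hM] := F_bound FX; exists M => v.
  by rewrite muln0 addr0 subrr sob0E.
have FX2 := th_filt (th_filt FX).
have [M M0 hM] := sob_bounded_ge0 (IH _ _ FX2).
have [K K0 hK] := sob_bounded_ge0 (IH _ _ (F_comm FX)).
rewrite /sob_bounded; exists (M + K) => v.
rewrite mulnS natrD.
have -> : sob (m%:R + (2 + (2 * k)%:R) - m%:R) (X v) = sob (2 * k)%:R (kapd (X v)).
  by rewrite sob_kapd; congr sob; ring.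
have -> : kapd (X v) = kapd (X v) - th (th X) (kapd v) + th (th X) (kapd v).
  by rewrite subrK.
rewrite addrC (le_trans (sobD _ _ _ _)) // mulrDl lerD //.
  have := hM (kapd v); rewrite addrAC subrr add0r sob_kapd => /le_trans; apply.
  by rewrite ler_wpM2l // sob_le //; lra.
have := hK v; rewrite addrAC subrr add0r => /le_trans; apply.
by rewrite ler_wpM2l // sob_le // -natr1; lra.
Qed.

(* After two iterations the remainder [kapi \o Z2 \o kapi \o kapi] has order at
  most [m - 2] even if its leftmost factor is only bounded by 1. *)
Lemma DO_inv m X : F m X -> exists Z Z1, [/\ F m Z, F m.+1 Z1 &
  forall v, kapi (X v) = Z (kapi v) - kapi (Z1 (kapi v))].
Proof.
move=> FX; have [Y FY Yth] := th_surj FX; have [Z FZ Zth] := th_surj FY.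
exists Z, (fun v => kapd (Z v) - th (th Z) (kapd v)); split=> // [|v].
  exact: F_comm.
have kl : linear kapi by exact: diag_linear (polyg_wt S (-1)).
by rewrite Zth Yth (linB _ _ kl) kapdK kapiK opprB addrC subrK.
Qed.

(** One use of [DO_inv] falls one order short: [Z1 \o kapi] has order [m - 1], and profiting from
    the outer [kapi] would need [Z1] at an exponent the induction has not reached. Expanding
    [kapi \o Z1] puts a second [kapi] on the right. *)
Lemma DO_neg m X k : F m X -> sob_bounded m%:R X (m%:R - (2 * k)%:R).
Proof.
elim: k m X => [|k IH] m X FX.
  have [M hM] := F_bound FX; exists M => v.
  by rewrite muln0 subr0 subrr sob0E.
have [Z [Z1 [FZ FZ1 e1]]] := DO_inv FX; have [Z' [Z2 [FZ' FZ2 e2]]] := DO_inv FZ1.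
have [M0 M00 h0] := sob_bounded_ge0 (IH _ _ FZ).
have [M1 M10 h1] := sob_bounded_ge0 (IH _ _ FZ').
have [M2 M20 h2] := sob_bounded_ge0 (IH _ _ FZ2).
exists (M0 + (M1 + M2)) => v.
have k2 : (2 * k.+1)%:R = (2 * k)%:R + 2 :> R by rewrite mulnS natrD addrC.
set c : R := (2 * k)%:R in h0 h1 h2 k2; rewrite k2.
have -> : sob (m%:R - (c + 2) - m%:R) (X v) = sob (- c) (kapi (X v)).
  by rewrite sob_kapi; congr sob; ring.
rewrite e1 e2 mulrDl (le_trans (sobB _ _ _ _)) // lerD //.
  have := h0 (kapi v); rewrite addrAC subrr add0r sob_kapi => /le_trans; apply.
  by rewrite ler_wpM2l // sob_le //; lra.
rewrite mulrDl (le_trans (sobB _ _ _ _)) // lerD //.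
  have := h1 (kapi (kapi v)); rewrite addrAC subrr add0r !sob_kapi => /le_trans; apply.
  by rewrite ler_wpM2l // sob_le // -natr1; lra.
rewrite sob_kapi.
have := h2 (kapi (kapi v)); rewrite addrAC subrr add0r !sob_kapi => h.
apply: (le_trans (sob_le S _ (_ : - c - 2 <= - c))); first by lra.
apply: (le_trans h); rewrite ler_wpM2l // sob_le // -!natr1; lra.
Qed.

Lemma DO_sop m X : F m X -> sop m%:R X.
Proof.
move=> FX; apply: sop_interp => [|s|s]; first exact: F_linear FX.
  exists (m%:R - (2 * (Num.truncn `|m%:R - s|).+1)%:R); last exact: DO_neg.
  have := normr_ge0 (m%:R - s); have := truncnS_gt `|m%:R - s|; have := ler_norm (m%:R - s).
  by rewrite natrM; set k : R := (Num.truncn _).+1%:R; lra.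
exists (m%:R + (2 * (Num.truncn `|s - m%:R|).+1)%:R); last exact: DO_pos.
have := normr_ge0 (s - m%:R); have := truncnS_gt `|s - m%:R|; have := ler_norm (s - m%:R).
by rewrite natrM; set k : R := (Num.truncn _).+1%:R; lra.
Qed.

End DifferentialOperators.

Lemma eigen_commutator (l : R) Y : 0 < l -> sop 0 Y ->
  sop 1 (fun v => kapd (Y v) - (l ^+ 2)%:C *: Y (kapd v)) ->
  sop 0 (fun v => Lam (Y v) - l%:C *: Y (Lam v)).
Proof.
move=> l0 hY hZ; set W := (fun v => _ - l%:C *: _).
have hW : sop 1 W.
  apply: sopB; first by have := sop_comp sop_Lam hY; rewrite addr0.
  by apply: sopZ; have := sop_comp hY sop_Lam; rewrite add0r.
apply: (@sylvester 0 l W _ l0 hW.1 _ _ _).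
- by have [M hM] := hW.2 1; exists 1, M => v; rewrite -sob0E -[X in sob X (W v)](subrr 1).
- rewrite add0r; exact: hZ.
move=> v; rewrite /W (linB _ _ Lam_linear) (linZ _ _ Lam_linear) !Lam_Lam.
by rewrite scalerBr scalerA -rmorphM -expr2 addrA subrK.
Qed.

(** * Mapping properties of a regular algebra *)

Section RegularFamily.
Variables (ad : nat -> R) (B : set (E -> E)).
Hypothesis ad_ge0 : forall i, 0 <= ad i.
Hypothesis ad_wt : forall i, wt 1 i = ad i ^+ 2 + 1.
(* [ad i] stands for the eigenvalue of [|D|], so that [gapd] below is the bounded
  operator [Delta^(1/2) - |D|]. *)
Definition absd : E -> E := diag (fun i => (ad i)%:C).
Hypothesis B_linear : forall X, B X -> linear X.
Hypothesis B_bound : forall X, B X -> exists M : R, forall v, nrm (X v) <= M * nrm v.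
Hypothesis B_comm : forall X, B X -> exists X' X'',
  [/\ B X', B X'' & forall v, absd (X v) = X' (absd v) + X'' v].
Hypothesis B_comm' : forall X, B X -> exists X' X'',
  [/\ B X', B X'' & forall v, absd (X' v) = X (absd v) + X'' v].

Lemma ad_Lam i : ad i <= wt (1 / 2) i <= ad i + 1.
Proof.
have w2 : wt (1 / 2) i ^+ 2 = ad i ^+ 2 + 1 by rewrite wt_sqr ad_wt.
have w0 := wt_ge0 S (1 / 2) i; have a0 := ad_ge0 i.
have wp : 0 < wt (1 / 2) i + ad i by rewrite ltr_pwDl // wt_gt0.
by apply/andP; split; nra.
Qed.

Definition gapd : E -> E := diag (fun i => (wt (1 / 2) i - ad i)%:C).

Lemma nsq_gapd i : nsq (wt (1 / 2) i - ad i)%:C <= 1.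
Proof.
rewrite nsqR; have /andP[h1 h2] := ad_Lam i.
by rewrite expr_le1 ?subr_ge0 // lerBlDl.
Qed.

Lemma sop_gapd : sop 0 gapd.
Proof. by apply: (@sop_diag _ _ 1) => i; rewrite wt0 mulr1 nsq_gapd. Qed.

Lemma sob_gapd s v : sob s (gapd v) <= sob s v.
Proof.
rewrite -[leRHS]mul1r; apply: sob_cmp => // i.
rewrite expr1n mul1r cf_diag; last exact: polyg_bounded nsq_gapd.
by rewrite nsqM ler_wpM2l ?wt_ge0 // ler_piMl ?nsq_ge0 ?nsq_gapd.
Qed.

Lemma nsq_ad i : nsq (ad i)%:C <= 1 * wt 1 i.
Proof. by rewrite nsqR mul1r ad_wt lerDl. Qed.

Lemma cf_absd v i : cf (absd v) i = (ad i)%:C * cf v i.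
Proof. by rewrite cf_diag //; exists 1, 1; exact: nsq_ad. Qed.

Lemma Lam_absd v : Lam v = absd v + gapd v.
Proof.
apply: (@cf_ext _ _ S) => i; rewrite cfD cf_Lam cf_absd cf_diag.
  by rewrite -mulrDl -rmorphD /= addrC subrK.
exact: polyg_bounded nsq_gapd.
Qed.

Lemma sob_absd s v : sob s (absd v) <= sob (s + 1) v.
Proof.
rewrite -[leRHS]mul1r; apply: sob_cmp => // i.
rewrite expr1n mul1r cf_absd nsqM wtD mulrA ler_wpM2r ?nsq_ge0 //.
by rewrite ler_wpM2l ?wt_ge0 // (le_trans (nsq_ad i)) ?mul1r.
Qed.

Lemma B_pos n X : B X -> sob_bounded 0 X n%:R.
Proof.
elim: n X => [|n IH] X BX.
  by have [M hM] := B_bound BX; exists M => v; rewrite subr0 !sob0E.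
have [X' [X'' [BX' BX'' e]]] := B_comm BX.
have [M M0 hM] := sob_bounded_ge0 (IH _ BX).
have [M' M'0 hM'] := sob_bounded_ge0 (IH _ BX').
have [M'' M''0 hM''] := sob_bounded_ge0 (IH _ BX'').
exists (M' + M'' + M) => v; rewrite subr0 -natr1 -sob_Lam Lam_absd e.
rewrite subr0 in hM hM' hM''.
have vn : sob n%:R v <= sob (n%:R + 1) v by rewrite sob_le // lerDl.
rewrite (le_trans (sobD _ _ _ _)) // mulrDl lerD //.
  rewrite (le_trans (sobD _ _ _ _)) // mulrDl lerD //.
    by rewrite (le_trans (hM' _)) // ler_wpM2l // sob_absd.
  by rewrite (le_trans (hM'' _)) // ler_wpM2l.
by rewrite (le_trans (sob_gapd _ _)) // (le_trans (hM _)) // ler_wpM2l.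
Qed.

Lemma Lam_surj v : exists u, v = Lam u.
Proof.
exists (diag (fun i => (wt (- (1 / 2)) i)%:C) v); apply: (@cf_ext _ _ S) => i.
rewrite cf_Lam cf_diag; last exact: polyg_wt.
by rewrite mulrA -rmorphM /= -wtD subrr wt0 mul1r.
Qed.

(** Adjoints of elements of [B] need not lie in [B]. Instead of using duality, the argument is
    written as [Lam u], and [B_comm'] moves the unbounded part of [Lam] to the left of [X]. *)
Lemma B_neg n X : B X -> sob_bounded 0 X (- n%:R).
Proof.
elim: n X => [|n IH] X BX.
  by have [M hM] := B_bound BX; exists M => v; rewrite !oppr0 addr0 !sob0E.
have [X' [X'' [BX' BX'' e]]] := B_comm' BX.
have [M M0 hM] := sob_bounded_ge0 (IH _ BX).
have [M' M'0 hM'] := sob_bounded_ge0 (IH _ BX').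
have [M'' M''0 hM''] := sob_bounded_ge0 (IH _ BX'').
rewrite subr0 in hM hM' hM''.
exists (M' + M' + M'' + M) => v; have [u ->] := Lam_surj v.
have n1 : - n.+1%:R + 1 = - n%:R :> R by rewrite -natr1; ring.
rewrite subr0 sob_Lam n1.
have low w : sob (- n.+1%:R) w <= sob (- n%:R) w.
  by rewrite sob_le // -n1 lerDl.
have -> : X (Lam u) = Lam (X' u) - gapd (X' u) - X'' u + X (gapd u).
  rewrite Lam_absd (linD _ _ (B_linear BX)) Lam_absd addrK e addrK //.
rewrite (le_trans (sobD _ _ _ _)) // mulrDl lerD //; last first.
  by rewrite (le_trans (low _)) // (le_trans (hM _)) // ler_wpM2l // sob_gapd.
rewrite (le_trans (sobB _ _ _ _)) // mulrDl lerD //; last first.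
  by rewrite (le_trans (low _)).
rewrite (le_trans (sobB _ _ _ _)) // mulrDl lerD //.
  by rewrite sob_Lam n1.
by rewrite (le_trans (low _)) // (le_trans (sob_gapd _ _)).
Qed.

Lemma regular_sop X : B X -> sop 0 X.
Proof.
move=> BX; apply: sop_interp => [|s|s]; first exact: B_linear.
  exists (- (Num.truncn `|s|).+1%:R); last exact: B_neg.
  have := truncnS_gt `|s|; have := ler_norm (- s); rewrite normrN.
  by set k : R := (Num.truncn _).+1%:R; lra.
exists (Num.truncn `|s|).+1%:R; last exact: B_pos.
have := truncnS_gt `|s|; have := ler_norm s.
by set k : R := (Num.truncn _).+1%:R; lra.
Qed.

Lemma regular_commutator X X' X'' : B X -> B X' -> B X'' ->
  (forall v, absd (X v) = X' (absd v) + X'' v) ->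
  sop 0 (fun v => Lam (X v) - X' (Lam v)).
Proof.
move=> BX BX' BX'' e.
rewrite (_ : (fun v => _) = (fun v => X'' v + gapd (X v) - X' (gapd v))).
  have c := @sop_comp 0 0; rewrite addr0 in c.
  apply: sopB; last exact: c (regular_sop BX') sop_gapd.
  by apply: sopD; [exact: regular_sop|exact: c sop_gapd (regular_sop BX)].
apply: funext => v; rewrite !Lam_absd (linD _ _ (B_linear BX')) e.
by rewrite opprD addrA -[_ + _ + gapd _]addrA [X' _ + _]addrC addrK.
Qed.

End RegularFamily.
End OrderCalculus.

(** * The scale of the Laplacian *)

Section FrameScale.
Variables (R : realType) (H : completeNormedModType R[i]).
Variable ip : {dot H for @conjc R}.
Variables (D : linop H) (e : nat -> H) (d : nat -> R).
Hypothesis fr : eigenframe ip D e d.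
Let ip_norm := frame_norm fr.
Local Notation E := (smooth (laplacian D)).

Definition fscale : scale E.
Proof.
refine (@Scale R E (fun v i => ip (smooth_val v) (e i)) (lkap d)
  (fun v => rn (smooth_val v)) _ _ _ _ _ _ _ _).
- by move=> a v w i; rewrite smooth_valD smooth_valZ (ipDl ip) (ipZl ip).
- by move=> v w; exact: (smooth_ext fr).
- exact: lkap_ge0.
- by move=> f s C; exact: (smooth_exists fr).
- by move=> v; exact: rn_ge0.
- by move=> v C; exact: (rn_leP fr).
- by move=> v w; exact: rnD.
- by move=> v w; exact: (parallelogram ip_norm).
Defined.

Local Notation S := fscale.
Implicit Types (v w : E) (X Y Z : E -> E) (s t : R) (z : R[i]).

Lemma cfE v i : cf S v i = ip (smooth_val v) (e i). Proof. by []. Qed.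
Lemma nrmE v : nrm S v = rn (smooth_val v). Proof. by []. Qed.
Lemma wtE s i : wt S s i = expR (s * lkap d i). Proof. by []. Qed.

Lemma on_smoothE (T : linop H) (f : nat -> R[i]) : diagonal_op ip e T f ->
  on_smooth T = diag S f.
Proof.
move=> Tf; apply: funext => v; rewrite /on_smooth /diag; congr xget.
by apply/seteqP; split=> w /Tf.
Qed.

Lemma LpowE z : Lpow ip z = diag S (fun i => cpow (kap d i) z).
Proof.
apply: on_smoothE; exact: (diagonal_fcalc fr (fun x => cpow x z) (diagonal_lap fr)).
Qed.

Lemma on_smooth_lapE : on_smooth (laplacian D) = kapd S :> (E -> E).
Proof.
rewrite (on_smoothE (diagonal_lap fr)); congr diag.
by apply: funext => i; rewrite wtE mul1r expR_lkap.
Qed.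

Lemma polyg_cpow z : polyg S (fun i => cpow (kap d i) z).
Proof. by exists (2 * complex.Re z), 1 => i; rewrite nsq_cpow mul1r. Qed.

Lemma cf_Lpow z v i : cf S (Lpow ip z v) i = cpow (kap d i) z * cf S v i.
Proof. by rewrite LpowE cf_diag //; exact: polyg_cpow. Qed.

Lemma Lpow_real s : Lpow ip s%:C = diag S (fun i => (wt S s i)%:C).
Proof. by rewrite LpowE; congr diag; apply: funext => i; rewrite cpow_real. Qed.

Lemma Lpow0 : Lpow ip 0 = id :> (E -> E).
Proof.
apply: funext => v; apply: (smooth_ext fr) => i.
rewrite -!cfE cf_Lpow (_ : 0 = 0%:C) // cpow_real mul0r expR0 mul1r //.
Qed.

Lemma LpowD z z' v : Lpow ip (z + z') v = Lpow ip z (Lpow ip z' v).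
Proof. by apply: (smooth_ext fr) => i; rewrite -!cfE !cf_Lpow cpowD mulrA. Qed.

Lemma sobolev_normE s v : sobolev_norm ip 2 s v = (sob S s v)%:C.
Proof.
rewrite /sobolev_norm rnE; congr (_%:C); rewrite /sob nrmE.
by rewrite -Lpow_real rmorphM fmorphV /= rmorph_nat.
Qed.

Lemma OpE t : Op ip 2 t = [set X | sop S t X].
Proof.
apply/seteqP; split=> X [lX hX]; split=> // s; have [M hM] := hX s.
  exists (complex.Re M) => v; have := hM v.
  rewrite !sobolev_normE lecE => /andP[_]; case: (M) => a b /=.
  by rewrite mulr0 subr0.
by exists M%:C => v; rewrite !sobolev_normE -rmorphM lecR.
Qed.

Lemma sop_Lpow z : sop S (2 * complex.Re z) (Lpow ip z).
Proof. by rewrite LpowE; apply: (@sop_diag _ _ _ _ _ 1) => i; rewrite nsq_cpow mul1r. Qed.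

Lemma Lam_LpowE : Lam S = Lpow ip (2^-1).
Proof.
rewrite /Lam -Lpow_real; congr Lpow.
by rewrite mul1r fmorphV /= rmorph_nat.
Qed.

Lemma diagonal_absd : diagonal_op ip e (abs_op ip D) (fun i => `|d i|%:C).
Proof. exact: (diagonal_fcalc fr (fun x => `|x|%:C) (diagonal_D fr)). Qed.

Lemma abs_graph v : abs_op ip D (smooth_val v) (smooth_val (absd S (fun i => `|d i|) v)).
Proof.
apply/diagonal_absd => i; rewrite -!cfE cf_absd // => j.
by rewrite wtE mul1r expR_lkap /kap real_normK ?num_real.
Qed.

(** Truncated expansions lie in [H^oo] and commute with diagonal operators, so a single sequence
    approximates [v] together with its image under any diagonal operator whose domain contains
    [v]. *)
Lemma smooth_approx (v : H) : exists u : nat -> E, cvgs (fun n => smooth_val (u n)) v /\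
  forall (f : nat -> R[i]) (w : H), (forall i, ip w (e i) = f i * ip v (e i)) ->
  forall w' : nat -> E, (forall n i, cf S (w' n) i = f i * cf S (u n) i) ->
  cvgs (fun n => smooth_val (w' n)) w.
Proof.
have trunc (x : H) n : exists y : E, forall i, cf S y i = if (i < n)%N then ip x (e i) else 0.
  have [|y hy] := @smooth_lift _ _ D (psum e (fun i => ip x (e i)) n).
    apply/(smooth_setP fr) => k.
    exists (\sum_(i < n) kap d i ^+ k * nsq (ip x (e i))) => m.
    have cfp i : ip (psum e (fun i => ip x (e i)) n) (e i) =
      if (i < n)%N then ip x (e i) else 0.
      by rewrite (ip_psum (frame_orth fr) (frame_unit fr)) //; exact: supported_ip.
    under eq_bigr do rewrite cfp.
    have pos i : 0 <= kap d i ^+ k * nsq (ip x (e i)).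
      by rewrite mulr_ge0 ?nsq_ge0 // exprn_ge0 // ltW // kap_gt0.
    rewrite (big_ord_widen_cond _ (fun=> true) (fun i => kap d i ^+ k *
      nsq (if (i < n)%N then ip x (e i) else 0)) (leq_maxl m n)).
    rewrite [leRHS](big_ord_widen_cond _ (fun=> true) (fun i => kap d i ^+ k *
      nsq (ip x (e i))) (leq_maxr m n)).
    rewrite big_mkcond [leRHS]big_mkcond /=; apply: ler_sum => i _.
    by case: (i < n)%N; case: (i < m)%N => //; rewrite nsq0 mulr0.
  exists y => i; rewrite cfE hy (ip_psum (frame_orth fr) (frame_unit fr)) //.
  exact: supported_ip.
have {trunc} trunc (x : H) : exists u : nat -> E, forall n i,
  cf S (u n) i = if (i < n)%N then ip x (e i) else 0.
  by have [u hu] := choice (trunc x); exists u.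
have trunc_cvg (x : H) (u : nat -> E) : (forall n i,
    cf S (u n) i = if (i < n)%N then ip x (e i) else 0) ->
    cvgs (fun n => smooth_val (u n)) x.
  move=> hu; rewrite (_ : (fun n => _) = psum e (fun i => ip x (e i))).
    exact: (cvgs_psum_cf fr).
  apply: funext => n; apply: (cf_inj fr) => i.
  rewrite -cfE hu (ip_psum (frame_orth fr) (frame_unit fr)) //.
  exact: supported_ip.
have [u hu] := trunc v; exists u; split; first exact: trunc_cvg.
move=> f w hw w' hw'; apply: trunc_cvg => n i; rewrite hw' hu hw.
by case: ifP => _; rewrite ?mulr0.
Qed.

Lemma smooth_dense (v : H) : exists u : nat -> E, cvgs (fun n => smooth_val (u n)) v.
Proof. by have [u [hu _]] := smooth_approx v; exists u. Qed.

End FrameScale.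

(** * The calculi of all operators of finite order *)

Section ConjugationCalculus.
Variables (R : realType) (H : completeNormedModType R[i]).
Variable ip : {dot H for @conjc R}.
Variables (D : linop H) (e : nat -> H) (d : nat -> R).
Hypothesis fr : eigenframe ip D e d.
Local Notation E := (smooth (laplacian D)).
Local Notation S := (fscale fr).
Implicit Types (v w : E) (X Y Z : E -> E) (s t : R) (z : R[i]).

Definition Lhalf z : E -> E := Lpow ip (z / 2%:R).

Lemma Lhalf0 : Lhalf 0 = id.
Proof. by rewrite /Lhalf mul0r (Lpow0 fr). Qed.

Lemma LhalfD z z' v : Lhalf (z + z') v = Lhalf z (Lhalf z' v).
Proof. by rewrite /Lhalf mulrDl (LpowD fr). Qed.

Lemma LhalfK z : cancel (Lhalf z) (Lhalf (- z)).
Proof. by move=> v; rewrite -LhalfD addNr Lhalf0. Qed.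

Lemma LhalfNK z : cancel (Lhalf (- z)) (Lhalf z).
Proof. by move=> v; rewrite -LhalfD addrN Lhalf0. Qed.

Lemma Re_half z : 2 * complex.Re (z / 2%:R) = complex.Re z.
Proof.
rewrite -(rmorph_nat (real_complex R)) -fmorphV /=.
by case: z => a b /=; rewrite mulr0 subr0 mulrCA divff ?mulr1.
Qed.

Lemma sop_Lhalf z : sop S (complex.Re z) (Lhalf z).
Proof. by rewrite -{1}Re_half; exact: sop_Lpow. Qed.

Lemma Lhalf_linear z : linear (Lhalf z).
Proof. exact: sop_linear (sop_Lhalf z). Qed.

Lemma Lam_Lhalf : Lam S = Lhalf 1.
Proof. by rewrite Lam_LpowE /Lhalf div1r. Qed.

Definition conjL z X : E -> E := Lhalf z \o X \o Lhalf (- z).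

Lemma sop_conjL z t X : sop S t X -> sop S t (conjL z X).
Proof.
move=> hX; have := sop_comp (sop_comp (sop_Lhalf z) hX) (sop_Lhalf (- z)).
by rewrite raddfN /= addrAC subrr add0r.
Qed.

Lemma conjLD z z' X : conjL (z + z') X = conjL z (conjL z' X).
Proof.
by apply: funext => v; rewrite /conjL /= LhalfD opprD [- z - z']addrC LhalfD.
Qed.

Lemma conjL0 X : conjL 0 X = X.
Proof. by apply: funext => v; rewrite /conjL /= oppr0 Lhalf0. Qed.

Lemma conjLK z : cancel (conjL z) (conjL (- z)).
Proof. by move=> X; rewrite -conjLD addNr conjL0. Qed.

Lemma conjLNK z : cancel (conjL (- z)) (conjL z).
Proof. by move=> X; rewrite -conjLD addrN conjL0. Qed.

Lemma sop_conjL_iff z t X : sop S t (conjL z X) <-> sop S t X.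
Proof. by split=> [/(sop_conjL (- z))|]; [rewrite conjLK|exact: sop_conjL]. Qed.

Lemma conjL_lin z k X Y : conjL z (k *: X + Y) = k *: conjL z X + conjL z Y.
Proof. by apply: funext => v; rewrite /conjL /= Lhalf_linear. Qed.

Lemma conjL_comp z X Y : conjL z (X \o Y) = conjL z X \o conjL z Y.
Proof. by apply: funext => v; rewrite /conjL /= LhalfK. Qed.

Local Notation Psi := (@Op R H ip (laplacian D) 2).

Lemma totalP X : Defs.total Psi X <-> exists t, sop S t X.
Proof.
split=> [[t _]|[t ht]]; first by rewrite (OpE fr); exists t.
by exists t => //; rewrite (OpE fr).
Qed.

Lemma total_conjL z X : Defs.total Psi X -> Defs.total Psi (conjL z X).
Proof. by move=> /totalP[t ht]; apply/totalP; exists t; exact: sop_conjL. Qed.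

Lemma Op_filtered : filtered_algebra (fun s t : R => s <= t) (fun s t => s + t) Psi.
Proof.
split=> [t X|t|t k X Y|s t st X|s t X Y]; rewrite !(OpE fr) /=.
- exact: sop_linear.
- exact: sop0.
- exact: sop_lin.
- exact: sop_le.
- exact: sop_comp.
Qed.

Lemma twisted_PsiDO_Op : twisted_PsiDO ip 2 Psi conjL.
Proof.
split.
- exact: Op_filtered.
- by [].
- move=> z; split.
  + by move=> k X Y _ _; exact: conjL_lin.
  + split=> [X|X Y _ _ /(can_inj (conjLK z))//|X hX]; first exact: total_conjL.
    by exists (conjL (- z) X); [exact: total_conjL|exact: conjLNK].
  + move=> t; rewrite (OpE fr); apply/seteqP; split=> [_ [X hX <-]|X hX].
      exact: sop_conjL.
    by exists (conjL (- z) X); [exact: sop_conjL|exact: conjLNK].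
- by move=> z X Y _ _; exact: conjL_comp.
- by move=> z z' X _; exact: conjLD.
- move=> z X /totalP[t hX]; apply/totalP; exists (2 * complex.Re z + t).
  by apply: sop_comp => //; exact: sop_Lpow.
- move=> z X /totalP[t hX]; apply/totalP; exists (t + 2 * complex.Re z).
  by apply: sop_comp => //; exact: sop_Lpow.
- move=> z t; rewrite !(OpE fr); apply/seteqP; split=> [_ [X hX <-]|X hX].
    exact: sop_comp (sop_Lhalf z) hX.
  exists (Lhalf (- z) \o X); last by apply: funext => v; exact: LhalfNK.
  have := sop_comp (sop_Lhalf (- z)) hX.
  by rewrite raddfN /= addrA addNr add0r.
- move=> z t; rewrite !(OpE fr) addrC; apply/seteqP; split=> [_ [X hX <-]|X hX].
    exact: sop_comp hX (sop_Lhalf z).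
  exists (X \o Lhalf (- z)); last by apply: funext => v /=; congr X; exact: LhalfK.
  have := sop_comp hX (sop_Lhalf (- z)).
  by rewrite raddfN /= addrK.
- move=> z t X _; rewrite (OpE fr) (_ : _ - _ = fun=> 0); first exact: sop0.
  apply: funext => v; rewrite /conjL; apply/eqP; rewrite subr_eq0; apply/eqP => /=.
  by rewrite -/(Lhalf z v) LhalfK.
- by [].
Qed.

End ConjugationCalculus.

(** * A linear twist extending [theta] *)

Section TwistCalculus.
Variables (R : realType) (H : completeNormedModType R[i]).
Variable ip : {dot H for @conjc R}.
Variables (A : algType R[i]) (star : A -> A) (theta : {lrmorphism A -> A}).
Variables (pi : A -> H -> H) (D : linop H).
Hypothesis tst : twisted_spectral_triple ip star theta pi D.
Variables (e : nat -> H) (d : nat -> R).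
Hypothesis fr : eigenframe ip D e d.
Local Notation E := (smooth (laplacian D)).
Local Notation S := (fscale fr).
Implicit Types (v w : E) (X Y Z : E -> E) (s t : R) (z : R[i]).

(* Both parts of the theorem factor through this property of the restrictions
  [rho a] of [pi a] to the smooth domain. *)
Record twist_calculus (rho : A -> E -> E) : Prop := {
  tc_restr : forall a, restricts (pi a) (rho a) ;
  tc_sop : forall a, sop S 0 (rho a) ;
  tc_comm : forall a, sop S 0 (fun v => Lam S (rho a v) - rho (theta a) (Lam S v)) ;
  tc_D : forall c, D_commutators theta pi D c ->
    exists2 X : E -> E, restricts c X & sop S 0 X ;
  tc_ker : forall a, rho (theta a) = 0 <-> rho a = 0 }.

Lemma restricts_inj (b : H -> H) X Y : restricts b X -> restricts b Y -> X = Y.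
Proof.
by move=> bX bY; apply: funext => v; apply: val_inj; rewrite /= -bX -bY.
Qed.

Section FromCalculus.
Variable rho : A -> E -> E.
Hypothesis tc : twist_calculus rho.

Lemma rho_lin k a b : rho (k *: a + b) = k *: rho a + rho b.
Proof.
apply: funext => v; apply: val_inj.
by rewrite /= -(tc_restr tc) (pi_lin tst) !(tc_restr tc).
Qed.

(** The commutator of order 0 is composed on the right with [Delta^(-1/2)]. *)
Lemma tc_conjL a : sop S (-1) (rho (theta a) - conjL ip 1 (rho a)).
Proof.
rewrite (_ : _ - _ = (fun v => - ((fun v => Lam S (rho a v) - rho (theta a) (Lam S v))
  \o Lhalf ip (-1)) v)); last first.
  apply: funext => v; rewrite /conjL /= opprB !Lam_Lhalf; congr (_ - _).
  by rewrite (LhalfNK fr).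
apply: sopN; have := sop_comp (tc_comm tc a) (sop_Lhalf fr (-1)).
by rewrite add0r.
Qed.

Lemma PsiDO_compatible_Op :
  PsiDO_compatible theta pi (@Op R H ip (laplacian D) 2) (@conjL R H ip D).
Proof.
move=> a; exists (rho a), (rho (theta a)); split.
- exact: tc_restr.
- exact: tc_restr.
- by rewrite (OpE fr); exact: tc_sop.
- rewrite (OpE fr) /= -opprB.
  have := sopN (tc_conjL a); congr sop.
Qed.

Local Notation Psi := (@Op R H ip (laplacian D) 2).

(** The representation need not be faithful: [tc_ker] makes [rho a |-> rho (theta a)] well defined
    and injective on the range of [rho]. [twist_extension] is applied with the operators of order -1
    as the subspace of allowed corrections. *)
Lemma exists_twist : exists T : (E -> E) -> E -> E,
  [/\ forall k X Y, Defs.total Psi X -> Defs.total Psi Y -> T (k *: X + Y) = k *: T X + T Y,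
      set_bij (Defs.total Psi) (Defs.total Psi) T,
      forall a, T (rho a) = rho (theta a) &
      forall X, Defs.total Psi X -> sop S (-1) (T X - conjL ip 1 X)].
Proof.
pose Sr := [set X | exists a, X = rho a].
pose W := [set X | sop S (-1) X].
pose rel X Y := exists a, X = rho a /\ Y = rho (theta a).
pose th X := xget 0 [set Y | rel X Y].
have rho0 : rho 0 = 0.
  by have := rho_lin (-1) 0 0; rewrite scaler0 addr0 scaleN1r addNr.
have rhoB a b : rho (a - b) = rho a - rho b.
  by rewrite addrC -scaleN1r rho_lin scaleN1r addrC.
have thE a : th (rho a) = rho (theta a).
  rewrite /th; have [|b [ab ->]] := @xgetPex _ 0 [set Y | rel (rho a) Y].
    by exists (rho (theta a)), a.
  apply/eqP; rewrite -subr_eq0 -rhoB -raddfB; apply/eqP/(tc_ker tc).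
  by rewrite rhoB ab subrr.
suff [T [Tl Tb TS TW]] : exists T : (E -> E) -> E -> E,
  [/\ forall k X Y, Defs.total Psi X -> Defs.total Psi Y -> T (k *: X + Y) = k *: T X + T Y,
    set_bij (Defs.total Psi) (Defs.total Psi) T, {in Sr, T =1 th} &
    forall X, Defs.total Psi X -> W (T X - conjL ip 1 X)].
  by exists T; split=> // a; rewrite -thE; apply: TS; apply/mem_set; exists a.
apply: (@twist_extension _ _ (Defs.total Psi) Sr W (@conjL R H ip D 1) th).
- split; first by apply/(totalP fr); exists 0; exact: sop0.
  move=> k X Y /(totalP fr)[s hX] /(totalP fr)[t hY].
  apply/(totalP fr); exists (Num.max s t); apply: sop_lin.
    by apply: sop_le hX; rewrite le_max lexx.
  by apply: sop_le hY; rewrite le_max lexx orbT.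
- split; first by exists 0.
  by move=> k _ _ [a ->] [b ->]; exists (k *: a + b); rewrite rho_lin.
- split; first exact: sop0.
  by move=> k X Y hX hY; exact: sop_lin.
- by move=> _ [a ->]; apply/(totalP fr); exists 0; exact: tc_sop.
- by move=> X hX; apply/(totalP fr); exists (-1).
- by move=> k X Y _ _; exact: conjL_lin fr _ _ _ _.
- by move=> X; exact: (total_conjL fr).
- move=> X _ h; rewrite -(conjLK fr 1 X) h.
  by apply: funext => v; rewrite /conjL /= lin0 //; exact: (Lhalf_linear fr).
- by move=> Y hY; exists (conjL ip (-1) Y); [exact: (total_conjL fr)|exact: (conjLNK fr)].
- by move=> X _; exact: sop_conjL_iff.
- move=> k _ _ [a ->] [b ->]; rewrite -rho_lin !thE.
  by rewrite linearP rho_lin.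
- by move=> _ [a ->]; rewrite thE; exists (theta a).
- by move=> _ [a ->]; rewrite thE => /(tc_ker tc).
- move=> _ [a ->]; have [g _ gK] := theta_bij tst.
  by exists (rho (g a)); [exists (g a)|rewrite thE gK].
- by move=> _ [a ->]; rewrite thE; exact: tc_conjL.
Qed.

End FromCalculus.
End TwistCalculus.

(** * Differential operators and regularity from the twist *)

Section FromTwist.
Variables (R : realType) (H : completeNormedModType R[i]).
Variable ip : {dot H for @conjc R}.
Variables (A : algType R[i]) (star : A -> A) (theta : {lrmorphism A -> A}).
Variables (pi : A -> H -> H) (D : linop H).
Hypothesis tst : twisted_spectral_triple ip star theta pi D.
Variables (e : nat -> H) (d : nat -> R).
Hypothesis fr : eigenframe ip D e d.
Let ip_norm := frame_norm fr.
Local Notation E := (smooth (laplacian D)).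
Local Notation S := (fscale fr).
Local Notation Psi := (@Op R H ip (laplacian D) 2).
Local Notation conj1 := (@conjL R H ip D 1).
Implicit Types (v w : E) (X Y Z : E -> E) (s t : R) (z : R[i]).

Lemma bounded_opP (b : H -> H) : bounded_op b <->
  linear b /\ exists2 M : R, 0 <= M & forall v : H, rn (b v) <= M * rn v.
Proof.
split=> [[lb [M hM]]|[lb [M M0 hM]]]; split=> //.
  exists `|complex.Re M| => // v; have := hM v.
  rewrite !rnE lecE => /andP[_]; case: (M) => a c /=.
  rewrite mulr0 subr0 => /le_trans; apply.
  by rewrite ler_wpM2r ?rn_ge0 ?ler_norm.
by exists M%:C => v; rewrite !rnE -rmorphM lecR.
Qed.

Lemma bounded_cvgs (b : H -> H) (s : nat -> H) (v : H) : bounded_op b ->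
  cvgs s v -> cvgs (fun n => b (s n)) (b v).
Proof.
move=> /bounded_opP[lb [M _ hM]] sv.
by apply: (cvgs_bound (C := M) _ _ sv) => // x y; rewrite -linB.
Qed.

Lemma bounded_ext (b b' : H -> H) X : bounded_op b -> bounded_op b' ->
  restricts b X -> restricts b' X -> b = b'.
Proof.
move=> hb hb' bX b'X; apply: funext => v; have [u hu] := smooth_dense fr v.
have h := bounded_cvgs hb hu; have h' := bounded_cvgs hb' hu.
apply: cvgs_unique h _; rewrite (_ : (fun n => b _) = (fun n => b' (smooth_val (u n)))) //.
by apply: funext => n; rewrite bX b'X.
Qed.

(** The limit is asserted for every approximating sequence; this independence of the choice is what
    yields linearity. *)
Lemma bounded_extension X : sop S 0 X -> exists b, bounded_op b /\ restricts b X.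
Proof.
move=> [lX hX]; have [M M0 hM] := sob_bounded_ge0 (hX 0).
have {}hM v : rn (smooth_val (X v)) <= M * rn (smooth_val v).
  by have := hM v; rewrite subr0 !sob0E.
have dist v w : rn (smooth_val (X v) - smooth_val (X w)) <=
    M * rn (smooth_val v - smooth_val w).
  by rewrite -!smooth_valB -linB.
have ext (v : H) : exists l, forall u : nat -> E, cvgs (fun n => smooth_val (u n)) v ->
    cvgs (fun n => smooth_val (X (u n))) l.
  have [u hu] := smooth_dense fr v.
  have M1 : 0 < M + 1 by rewrite ltr_wpDl.
  have [l hl] : exists l, cvgs (fun n => smooth_val (X (u n))) l.
    apply: complete_cvgs => c c0.
    have c1 : 0 < c / (2 * (M + 1)) by rewrite divr_gt0 // mulr_gt0.
    have [N hN] := hu _ c1; exists N => m n Nm Nn.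
    have h1 := hN m Nm; have h2 := hN n Nn.
    apply: (le_trans (dist _ _)).
    have h3 := rn_tri (smooth_val (u m)) v (smooth_val (u n)).
    rewrite (rn_distC v) in h3.
    have h4 : rn (smooth_val (u m) - smooth_val (u n)) <= c / (M + 1).
      apply: (le_trans h3); apply: (le_trans (lerD h1 h2)).
      rewrite le_eqVlt; apply/orP; left; apply/eqP; field.
      by rewrite gt_eqF.
    move: h4; rewrite ler_pdivlMr // => h4.
    by have := rn_ge0 (smooth_val (u m) - smooth_val (u n)); nra.
  exists l => u' hu' c c0.
  have c1 : 0 < c / (2 * (M + 1)) by rewrite divr_gt0 // mulr_gt0.
  have c2 : 0 < c / 4 by rewrite divr_gt0.
  have c3 : 0 < c / (4 * (M + 1)) by rewrite divr_gt0 // mulr_gt0.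
  have [N1 hN1] := hl _ c2; have [N2 hN2] := hu _ c3; have [N3 hN3] := hu' _ c3.
  exists (maxn N1 (maxn N2 N3)) => n; rewrite !geq_max => /and3P[n1 n2 n3].
  have h1 := hN1 n n1; have h2 := hN2 n n2; have h3 := hN3 n n3.
  apply: (le_trans (rn_tri _ (smooth_val (X (u n))) _)).
  have h4 := dist (u' n) (u n).
  have h5 := rn_tri (smooth_val (u' n)) v (smooth_val (u n)).
  rewrite (rn_distC v) in h5.
  rewrite ler_pdivlMr ?mulr_gt0 // in h2; rewrite ler_pdivlMr ?mulr_gt0 // in h3.
  by have := rn_ge0 (smooth_val (u' n) - smooth_val (u n)); nra.
have [b hb] := choice ext.
have lb : linear b.
  move=> k v w; have [u hu] := smooth_dense fr v; have [u' hu'] := smooth_dense fr w.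
  have kc (s : nat -> H) (x : H) : cvgs s x -> cvgs (fun n => k *: s n) (k *: x).
    apply: (cvgs_bound (C := Num.sqrt (nsq k)) (f := fun x => k *: x)) => // x1 x2.
    rewrite -scalerBr -ler_sqr ?nnegrE ?mulr_ge0 ?sqrtr_ge0 ?rn_ge0 //.
    by rewrite rnZ2 exprMn sqr_sqrtr ?nsq_ge0.
  have h1 := hb _ _ hu; have h2 := hb _ _ hu'.
  have h3 := hb (k *: v + w) (fun n => k *: u n + u' n) (cvgsD (kc _ _ hu) hu').
  apply: (cvgs_unique h3); rewrite (_ : (fun n => _) =
    (fun n => k *: smooth_val (X (u n)) + smooth_val (X (u' n)))).
    exact: cvgsD (kc _ _ h1) h2.
  by apply: funext => n; rewrite lX.
exists b; split; last first.
  move=> v; apply: (cvgs_unique (hb _ (fun=> v) _)).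
    by move=> c /ltW c0; exists 0%N => n _; rewrite subrr rn0.
  by move=> c /ltW c0; exists 0%N => n _; rewrite subrr rn0.
apply/bounded_opP; split=> //; exists M => // v.
have [u hu] := smooth_dense fr v.
apply/ler_addgt0Pr => c c0.
have M1 : 0 < M + 1 by rewrite ltr_wpDl.
have c1 : 0 < c / (2 * (M + 1)) by rewrite divr_gt0 // mulr_gt0.
have [N1 hN1] := hu _ c1.
have [N2 hN2] := hb _ _ hu (c / 2) (divr_gt0 c0 (ltr0Sn _ _)).
pose n := maxn N1 N2.
have h1 := hN1 n (leq_maxl _ _); have h2 := hN2 n (leq_maxr _ _).
have h3 := hM (u n).
have h4 := rnD (b v - smooth_val (X (u n))) (smooth_val (X (u n))).
rewrite subrK rn_distC in h4.
have h5 := rnD (smooth_val (u n) - v) v; rewrite subrK in h5.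
rewrite ler_pdivlMr ?mulr_gt0 // in h1.
have := rn_ge0 (smooth_val (u n) - v); nra.
Qed.

Variable rho : A -> E -> E.
Hypothesis tc : twist_calculus theta pi fr rho.
Variable T : (E -> E) -> E -> E.
Hypothesis T_lin : forall k X Y, Defs.total Psi X -> Defs.total Psi Y ->
  T (k *: X + Y) = k *: T X + T Y.
Hypothesis T_bij : set_bij (Defs.total Psi) (Defs.total Psi) T.
Hypothesis T_rho : forall a, T (rho a) = rho (theta a).
Hypothesis T_conj : forall X, Defs.total Psi X -> sop S (-1) (T X - conj1 X).

Lemma sop_total t X : sop S t X -> Defs.total Psi X.
Proof. by move=> hX; apply/(totalP fr); exists t. Qed.

(** A change by order -1 is invisible in every order [t >= -1], and conjugation preserves orders in
    both directions. *)
Lemma T_sop t X : -1 <= t -> Defs.total Psi X -> sop S t (T X) <-> sop S t X.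
Proof.
move=> t1 tX; have h := sop_le t1 (T_conj tX); split=> hX.
  apply/(sop_conjL_iff fr 1); rewrite (_ : conj1 X = T X - (T X - conj1 X)).
    exact: sopB.
  by rewrite opprB addrC subrK.
rewrite -(subrK (conj1 X) (T X)); apply: sopD => //.
exact: sop_conjL.
Qed.

Lemma T_surj t Y : -1 <= t -> sop S t Y -> exists2 X, sop S t X & T X = Y.
Proof.
move=> t1 hY; have [_ _ /(_ _ (sop_total hY)) [X tX XY]] := T_bij.
by exists X => //; apply/(T_sop t1 tX); rewrite XY.
Qed.

Local Notation F := (fun m : nat => Psi m%:R).

Lemma total_nat : Defs.total F = Defs.total Psi.
Proof.
apply/seteqP; split=> X [m _ hm]; first by exists m%:R.
exists (Num.truncn `|m|).+1 => //; move: hm; rewrite !(OpE fr); apply: sop_le.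
by rewrite (le_trans (ler_norm _)) // ltW // truncnS_gt.
Qed.

Lemma kapd_Lhalf : kapd S = Lhalf ip (1 + 1).
Proof. by apply: funext => v; rewrite -Lam_Lam Lam_Lhalf (LhalfD fr). Qed.

Lemma T_conj2 X : Defs.total Psi X -> sop S (-1) (T (T X) - conjL ip (1 + 1) X).
Proof.
move=> tX; have tTX : Defs.total Psi (T X) by case: T_bij => h _ _; exact: h.
rewrite (conjLD fr) -(subrKA (conj1 (T X))).
apply: sopD; first exact: T_conj.
have := sop_conjL 1 (T_conj tX).
rewrite (_ : conjL ip 1 (T X - conj1 X) = conj1 (T X) - conj1 (conj1 X)) //.
by rewrite addrC -scaleN1r (conjL_lin fr) scaleN1r addrC.
Qed.

Lemma twisted_DO_Op : twisted_DO ip 2 F T.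
Proof.
have OF := Op_filtered fr.
split.
- split=> [m X|m|m k X Y|m n mn|m n X Y].
  + exact: (filt_linear OF).
  + exact: (filt_zero OF).
  + exact: (filt_lin OF).
  + by apply: (filt_mono OF); rewrite ler_nat.
  + by rewrite natrD; exact: (filt_mul OF).
- split.
  + by rewrite total_nat.
  + by rewrite total_nat.
  + have m1 m : -1 <= m%:R :> R by rewrite (le_trans (lerN10 _)).
    move=> m; rewrite (OpE fr); apply/seteqP; split=> [_ [X hX <-]|Y hY].
      by apply/T_sop => //; exact: sop_total hX.
    by have [X hX XY] := T_surj (m1 m) hY; exists X.
- move=> m X; rewrite -addnBA // subn1 /= !(OpE fr) => hX.
  have tX := sop_total hX.
  (* For the conjugation the twisted commutator vanishes. What remains is a correction of order -1,
     whatever [m] is; composed with [kapd] it has order 1, hence at most [m + 1]. *)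
  rewrite (_ : _ - _ = (fun v => - ((T (T X) - conjL ip (1 + 1) X) \o kapd S) v)).
    apply: sopN; have := sop_comp (T_conj2 tX) (sop_kapd S).
    by apply: sop_le; rewrite natrD; have := ler0n R m; lra.
  apply: funext => v; rewrite (on_smooth_lapE fr) /=.
  rewrite -[RHS]/(- (T (T X) (kapd S v) - conjL ip (1 + 1) X (kapd S v))) opprB.
  by congr (_ - _); rewrite /conjL /= kapd_Lhalf (LhalfK fr).
- move=> m X; rewrite (OpE fr) => -[_ /(_ m%:R) /sob_bounded_ge0[M M0 hM]].
  exists (M + 1)%:C => [|v]; first by rewrite ltcR ltr_wpDl.
  rewrite (sobolev_normE fr) rnE -rmorphM lecR.
  have := hM v; rewrite subrr sob0E => /le_trans; apply.
  by rewrite ler_wpM2r ?sob_ge0 // lerDl.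
Qed.

Lemma DO_compatible_Op : DO_compatible theta pi F T.
Proof.
move=> a; exists (rho a), (rho (theta a)); split.
- exact: tc_restr tc a.
- exact: tc_restr tc (theta a).
- by rewrite (OpE fr); exact: tc_sop tc a.
- exact: T_rho.
Qed.

Lemma DO_contains_commutators_Op : DO_contains_commutators theta pi F.
Proof. by move=> c /(tc_D tc)[X cX hX]; exists X; rewrite ?(OpE fr). Qed.

Lemma diagonal_closed (L : linop H) (f : nat -> R[i]) (s t : nat -> H) (x y : H) :
  diagonal_op ip e L f -> (forall n, L (s n) (t n)) -> cvgs s x -> cvgs t y -> L x y.
Proof.
move=> Lf st sx ty; apply/Lf => i.
rewrite -[f i]conjcK -(ipZr ip).
by apply: (ip_limit ip_norm _ ty sx) => n; rewrite (ipZr ip) conjcK; have /Lf := st n.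
Qed.

Definition opsB : set (H -> H) := [set b | bounded_op b /\
  exists X : E -> E, restricts b X /\ sop S 0 X].

Definition thB (b : H -> H) : H -> H := xget 0 [set b' | exists X : E -> E,
  [/\ restricts b X, sop S 0 X, bounded_op b' & restricts b' (T X)]].

Lemma thBP b X : restricts b X -> sop S 0 X ->
  bounded_op (thB b) /\ restricts (thB b) (T X).
Proof.
move=> bX hX.
have hT : sop S 0 (T X) by apply/T_sop => //; exact: sop_total hX.
have [b' [hb' b'T]] := bounded_extension hT.
have [|Y [bY _ hb bT]] := @xgetPex _ 0 [set b' | exists X : E -> E,
  [/\ restricts b X, sop S 0 X, bounded_op b' & restricts b' (T X)]].
  by exists b', X.
by rewrite (restricts_inj bX bY).
Qed.

Lemma thBE b b' X : restricts b X -> sop S 0 X -> bounded_op b' ->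
  restricts b' (T X) -> thB b = b'.
Proof. by move=> bX hX hb' b'T; have [hb bT] := thBP bX hX; exact: bounded_ext bT b'T. Qed.

Lemma opsB_thB b : opsB b -> opsB (thB b).
Proof.
move=> [hb [X [bX hX]]]; have [hb' bT] := thBP bX hX; split=> //.
exists (T X); split=> //; apply/T_sop => //; exact: sop_total hX.
Qed.

Lemma bounded_op_lin (k : R[i]) (a b : H -> H) :
  bounded_op a -> bounded_op b -> bounded_op (k *: a + b).
Proof.
move=> /bounded_opP[la [M M0 hM]] /bounded_opP[lb [N N0 hN]]; apply/bounded_opP; split.
  move=> c x y; rewrite -![(k *: a + b) _]/(k *: a _ + b _) la lb.
  by rewrite !scalerDr !scalerA addrACA (mulrC k).
exists (Num.sqrt (nsq k) * M + N) => [|x]; first by rewrite addr_ge0 ?mulr_ge0 ?sqrtr_ge0.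
rewrite -[(k *: a + b) _]/(k *: a _ + b _) (le_trans (rnD _ _)) // mulrDl lerD //.
rewrite -mulrA; apply: (@le_trans _ _ (Num.sqrt (nsq k) * rn (a x))).
  rewrite -ler_sqr ?nnegrE ?mulr_ge0 ?sqrtr_ge0 ?rn_ge0 //.
  by rewrite rnZ2 exprMn sqr_sqrtr ?nsq_ge0.
by rewrite ler_wpM2l ?sqrtr_ge0.
Qed.

Lemma bounded_op_comp (a b : H -> H) :
  bounded_op a -> bounded_op b -> bounded_op (a \o b).
Proof.
move=> /bounded_opP[la [M M0 hM]] /bounded_opP[lb [N N0 hN]]; apply/bounded_opP; split.
  by move=> c x y; rewrite /= lb la.
exists (M * N) => [|x]; first exact: mulr_ge0.
by rewrite /= (le_trans (hM _)) // -mulrA ler_wpM2l.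
Qed.

Lemma restricts_lin (k : R[i]) (a b : H -> H) X Y :
  restricts a X -> restricts b Y -> restricts (k *: a + b) (k *: X + Y).
Proof. by move=> aX bY v; rewrite -[(k *: a + b) _]/(k *: a _ + b _) aX bY. Qed.

Lemma wt_absd i : wt S 1 i = `|d i| ^+ 2 + 1.
Proof. by rewrite wtE mul1r expR_lkap /kap real_normK ?num_real. Qed.

Local Notation Dabs := (absd S (fun i => `|d i|)).
Local Notation Dgap := (gapd S (fun i => `|d i|)).

(** Replacing [|D|] by [Lam] costs terms of order 0, and the commutator of [Lam] is the correction
    of order -1 composed with [Lam]. *)
Lemma sop_twisted_absd X : sop S 0 X -> sop S 0 (fun v => Dabs (X v) - T X (Dabs v)).
Proof.
move=> hX; have a0 i : 0 <= `|d i| by [].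
have hT : sop S 0 (T X) by apply/T_sop => //; exact: sop_total hX.
have hg := sop_gapd a0 wt_absd.
have c00 := @sop_comp _ _ S 0 0; rewrite addr0 in c00.
rewrite (_ : (fun v => _) = (fun v => T X (Dgap v) - Dgap (X v)
    - ((T X - conj1 X) \o Lam S) v)).
  apply: sopB; first by apply: sopB; [exact: c00 hT hg|exact: c00 hg hX].
  by have := sop_comp (T_conj (sop_total hX)) (sop_Lam S); rewrite addNr.
apply: funext => v.
rewrite -[((T X - conj1 X) \o Lam S) v]/(T X (Lam S v) - conj1 X (Lam S v)).
rewrite /conjL /= !Lam_Lhalf (LhalfK fr) -!(Lam_Lhalf fr).
rewrite !(Lam_absd a0 wt_absd) (linD _ _ hT.1).
apply: (@cf_ext _ _ S) => i; rewrite !(cfB, cfD, cfN); ring.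
Qed.

Lemma opsB_comm b : opsB b -> exists2 c, opsB c & twisted_comm (abs_op ip D) b (thB b) c.
Proof.
move=> [hb [X [bX hX]]]; have [hb' bT] := thBP bX hX.
have hC := sop_twisted_absd hX.
have [c [hc cC]] := bounded_extension hC.
exists c; first by split=> //; eexists; split; [exact: cC|exact: hC].
move=> v w vw; exists (thB b w + c v); last by rewrite addrC addKr.
(* The identity is clear on [H^oo] but is claimed on the whole domain of [|D|]: the truncations
   converge together with their images, and [|D|] is closed. *)
have [u [uv uw]] := smooth_approx fr v.
have dvw := (diagonal_absd fr v w).1 vw.
have a0 i : 0 <= `|d i| by [].
have hw := uw (fun i => `|d i|%:C) w dvw (fun n => Dabs (u n))
  (fun n i => cf_absd wt_absd (u n) i).
apply: (diagonal_closed (diagonal_absd fr) _ (bounded_cvgs hb uv)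
  (cvgsD (bounded_cvgs hb' hw) (bounded_cvgs hc uv))) => n.
rewrite bX bT cC.
rewrite -[X in abs_op _ _ _ X]/(smooth_val (T X (Dabs (u n)) + (Dabs (X (u n)) - T X (Dabs (u n))))).
by rewrite addrC subrK; exact: abs_graph.
Qed.

Lemma pi_opsB a : opsB (pi a).
Proof.
split; first exact: (pi_bounded tst).
by exists (rho a); split; [exact: (tc_restr tc a)|exact: (tc_sop tc a)].
Qed.

Lemma regular_Op : regular ip theta pi D.
Proof.
exists opsB, thB; split.
- by move=> b [].
- split=> [k a b [ha [X [aX hX]]] [hb [Y [bY hY]]]|a b [ha [X [aX hX]]] [hb [Y [bY hY]]]].
    split; first exact: bounded_op_lin.
    by exists (k *: X + Y); split; [exact: restricts_lin|exact: sop_lin].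
  split; first exact: bounded_op_comp.
  exists (X \o Y); split; first by move=> v; rewrite /= bY aX.
  by have := sop_comp hX hY; rewrite addr0.
- split; first exact: pi_opsB.
  move=> c hc; have [X cX hX] := tc_D tc hc; split; first by case: hc.
  by exists X.
- split.
  + move=> k a b [ha [X [aX hX]]] [hb [Y [bY hY]]].
    have [hTa aT] := thBP aX hX; have [hTb bT] := thBP bY hY.
    apply: (thBE (restricts_lin k aX bY) (sop_lin k hX hY) (bounded_op_lin k hTa hTb)).
    rewrite T_lin; [exact: restricts_lin|exact: sop_total hX|exact: sop_total hY].
  + split=> [b|b b' /set_mem[hb [X [bX hX]]] /set_mem[hb' [X' [b'X' hX']]] bb'|b].
    * exact: opsB_thB.
    * have [h1 h2] := thBP bX hX; have [h3 h4] := thBP b'X' hX'.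
      have XX' : X = X'.
        have [_ TI _] := T_bij.
        apply: TI; rewrite ?inE; [exact: sop_total hX|exact: sop_total hX'|].
        by apply: (restricts_inj h2); rewrite bb'.
      by move: b'X'; rewrite -XX' => b'X; exact: bounded_ext bX b'X.
    * move=> [hb [Y [bY hY]]]; have [X hX XY] := T_surj (lerN10 R) hY.
      have [b' [hb' b'X]] := bounded_extension hX; exists b'; first by split=> //; exists X.
      by apply: (thBE b'X hX hb); rewrite XY.
  + move=> a; apply: (thBE (tc_restr tc a) (tc_sop tc a)); first exact: (pi_bounded tst).
    by rewrite T_rho; exact: (tc_restr tc).
- exact: opsB_comm.
Qed.

End FromTwist.

(** * Orders of the elements of the algebra *)

Section EigenComponents.
Variables (K : fieldType) (V : lmodType K) (W U : set V) (th : V -> V).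
Hypotheses (sW : subsp W) (sU : subsp U).
Hypothesis th_lin : forall k x y, W x -> W y -> th (k *: x + y) = k *: th x + th y.
Hypothesis thU : forall x, U x -> U (th x).

(** Applying [th - a] removes the [a]-component and scales the others by [m - a], nonzero since [a]
    is not in [r]. The lemma keeps eigencomponents, which diagonalizability only places in the total
    algebra, in the filtration step of their sum. *)
Lemma eigen_components_uniq (r : seq K) (Z : K -> V) : uniq r ->
  (forall m, W (Z m) /\ th (Z m) = m *: Z m) ->
  U (\sum_(m <- r) Z m) -> {in r, forall m, U (Z m)}.
Proof.
have W_sum (s : seq K) (Y : K -> V) : (forall m, W (Y m)) -> W (\sum_(m <- s) Y m).
  move=> hY; elim: s => [|m s IH]; first by rewrite big_nil; exact: sW.1.
  by rewrite big_cons; exact: subspD.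
have th0 : th 0 = 0.
  by have := th_lin (-1) sW.1 sW.1; rewrite scaleN1r oppr0 addr0 scaleN1r addNr.
have th_sum (s : seq K) (Y : K -> V) : (forall m, W (Y m)) ->
    th (\sum_(m <- s) Y m) = \sum_(m <- s) th (Y m).
  move=> hY; elim: s => [|m s IH]; first by rewrite !big_nil.
  rewrite !big_cons -{1}[Y m]scale1r th_lin ?scale1r ?IH //; exact: W_sum.
elim: r Z => [//|a r IH] Z /= /andP[ar ur] hZ; rewrite big_cons => hU.
have thZ m : th (Z m) = m *: Z m by case: (hZ m).
have WZ m : W (Z m) by case: (hZ m).
have Ur : {in r, forall m, U (Z m)}.
  pose Y m := (m - a) *: Z m.
  have UY : {in r, forall m, U (Y m)}.
    apply: IH => // [m|].
      split; first exact: subspZ.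
      have := th_lin (m - a) (WZ m) sW.1.
      by rewrite addr0 th0 addr0 thZ !scalerA mulrC.
    have := subspB sU (thU hU) (subspZ a sU hU).
    rewrite -{1}[Z a]scale1r th_lin // ?scale1r ?th_sum //; last exact: W_sum.
    rewrite thZ scalerDr opprD addrACA subrr add0r scaler_sumr -sumrB.
    congr U; apply: eq_bigr => m _.
    by rewrite thZ /Y scalerBl.
  move=> m mr; have := UY m mr; rewrite /Y => h.
  have ma : m - a != 0 by rewrite subr_eq0; apply: contraNneq ar => <-.
  by rewrite -[Z m]scale1r -(mulVf ma) -scalerA; exact: subspZ.
move=> m; rewrite inE => /orP[/eqP ->|]; last exact: Ur.
rewrite -(addrK (\sum_(m <- r) Z m) (Z a)); apply: subspB => //.
elim: {IH ar ur hU} r Ur => [|b r IH] Ur; first by rewrite big_nil; exact: sU.1.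
rewrite big_cons; apply: subspD => //; first by apply: Ur; rewrite mem_head.
by apply: IH => x xr; apply: Ur; rewrite inE xr orbT.
Qed.

Lemma eigen_components n (Y : 'I_n -> V) (lam : 'I_n -> K) :
  (forall i, W (Y i) /\ th (Y i) = lam i *: Y i) -> U (\sum_i Y i) ->
  exists (r : seq K) (Z : K -> V), \sum_i Y i = \sum_(m <- r) Z m /\
    forall m, U (Z m) /\ th (Z m) = m *: Z m.
Proof.
move=> hY hU.
(* The family [lam] may repeat eigenvalues, so components with the same one are merged. *)
pose Z m := \sum_(i | lam i == m) Y i.
pose r := undup [seq lam i | i : 'I_n].
have th0 : th 0 = 0.
  by have := th_lin (-1) sW.1 sW.1; rewrite scaleN1r oppr0 addr0 scaleN1r addNr.
have hZ m : W (Z m) /\ th (Z m) = m *: Z m.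
  rewrite /Z; elim/big_rec: _ => [|i x /eqP im [Wx xE]].
    by rewrite th0 scaler0; split=> //; exact: sW.1.
  have [Wi iE] := hY i; split; first exact: subspD.
  by rewrite -{1}[Y i]scale1r th_lin // scale1r iE xE im scalerDr.
have sumE : \sum_i Y i = \sum_(m <- r) Z m.
  rewrite /Z (exchange_big_dep predT) //=; apply: eq_bigr => i _.
  rewrite -big_filter (_ : [seq m <- r | lam i == m] = [:: lam i]) ?big_seq1 //.
  have ir : lam i \in r by rewrite mem_undup; exact: codom_f.
  have ur : uniq r by exact: undup_uniq.
  rewrite (eq_filter (a2 := pred1 (lam i))); last by move=> m /=; rewrite eq_sym.
  exact: filter_pred1_uniq.
exists r, Z; split=> // m; split; last by case: (hZ m).
have [mr|mr] := boolP (m \in r).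
  by apply: (eigen_components_uniq _ hZ) mr; [exact: undup_uniq|rewrite -sumE].
rewrite /Z big1 => [|i /eqP im]; first exact: sU.1.
by case/negP: mr; rewrite mem_undup -im; exact: codom_f.
Qed.

End EigenComponents.

(** * The order estimates, from differential operators and from regularity *)

Section ToCalculus.
Variables (R : realType) (H : completeNormedModType R[i]).
Variable ip : {dot H for @conjc R}.
Variables (A : algType R[i]) (star : A -> A) (theta : {lrmorphism A -> A}).
Variables (pi : A -> H -> H) (D : linop H).
Hypothesis tst : twisted_spectral_triple ip star theta pi D.
Variables (e : nat -> H) (d : nat -> R).
Hypothesis fr : eigenframe ip D e d.
Let ip_norm := frame_norm fr.
Local Notation E := (smooth (laplacian D)).
Local Notation S := (fscale fr).
Implicit Types (v w : E) (X Y Z : E -> E) (s t : R) (z : R[i]).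

Lemma calculus_of_DO (F : nat -> set (E -> E)) (th : (E -> E) -> E -> E) :
  twisted_DO ip 2 F th -> DO_compatible theta pi F th ->
  DO_contains_commutators theta pi F -> diagonalizable_pos F th ->
  exists rho, twist_calculus theta pi fr rho.
Proof.
move=> hDO hcomp hD [hdiag hpos].
have FA := DO_alg hDO; have FT := DO_twist hDO.
have thF m X : F m X -> F m (th X).
  by move=> hX; rewrite -(auto_filt FT m); exists X.
have F_sub m : subsp (F m).
  by split; [exact: (filt_zero FA)|move=> k X Y; exact: (filt_lin FA)].
have tot m : F m `<=` Defs.total F by move=> X hX; exists m.
have sT : subsp (Defs.total F).
  split; first by exists 0%N => //; exact: (filt_zero FA).
  move=> k X Y [m _ hX] [n _ hY]; exists (maxn m n) => //.
  apply: (filt_lin FA).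
    by apply: (filt_mono FA) hX; exact: leq_maxl.
  by apply: (filt_mono FA) hY; exact: leq_maxr.
have th_lin := auto_lin FT.
have th0 : th 0 = 0.
  by have := th_lin (-1) 0 0 sT.1 sT.1; rewrite scaleN1r oppr0 addr0 scaleN1r addNr.
have thZ k X : Defs.total F X -> th (k *: X) = k *: th X.
  by move=> tX; have := th_lin k X 0 tX sT.1; rewrite th0 !addr0.
have comm m X : F m X -> F m.+1 (fun v => kapd S (X v) - th (th X) (kapd S v)).
  by move=> /(DO_comm hDO); rewrite (on_smooth_lapE fr) -addnBA // subn1 addn1.
have F_sop m X : F m X -> sop S m%:R X.
  apply: (DO_sop (th := th)) => {m X} [m X|||m X|m X] //.
  - exact: (filt_linear FA).
  - move=> m Y hY; have := auto_filt FT m.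
    by move=> /seteqP[_ /(_ Y hY)[X hX XY]]; exists X.
  - exact: comm.
  - move=> hX; have [M _ hM] := DO_bound hDO hX.
    exists (complex.Re M) => v; have := hM v.
    rewrite (sobolev_normE fr) rnE lecE => /andP[_]; case: (M) => a b /=.
    by rewrite mulr0 subr0.
have [rho hrho] : exists rho : A -> E -> E, forall a,
    [/\ restricts (pi a) (rho a), F 0%N (rho a) & restricts (pi (theta a)) (th (rho a))].
  have h a : exists X : E -> E,
      [/\ restricts (pi a) X, F 0%N X & restricts (pi (theta a)) (th X)].
    by have [X [Y [aX aY FX XY]]] := hcomp a; exists X; rewrite XY.
  by have [rho hrho] := choice h; exists rho.
have rho_th a : rho (theta a) = th (rho a).
  have [_ _ h1] := hrho a; have [h2 _ _] := hrho (theta a).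
  exact: restricts_inj h2 h1.
have comm_sop X : F 0%N X -> sop S 0 (fun v => Lam S (X v) - th X (Lam S v)).
  move=> FX; have [n [Y [lam [hY XE]]]] := hdiag X (tot _ _ FX).
  have FXs : F 0%N (\sum_i Y i) by rewrite -XE.
  have [r [Z [sE hZ]]] := eigen_components sT (F_sub 0%N) th_lin (thF 0%N) hY FXs.
  rewrite XE sE {X FX n Y lam hY XE FXs sE}.
  pose P X := sop S 0 (fun v => Lam S (X v) - th X (Lam S v)).
  have PZ m : P (Z m).
    have [FZ ZE] := hZ m; rewrite /P ZE.
    (* Positivity of [m] is granted only when it has a nonzero eigenvector. *)
    have [->|/eqP Z0] := eqVneq (Z m) 0.
      rewrite (_ : (fun v => _) = fun=> 0); first exact: sop0.
      apply: funext => v; rewrite scaler0.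
      rewrite -[X in Lam S X]/(0 : E) -[X in _ - X]/(0 : E).
      by rewrite (lin0 (Lam_linear S)) subrr.
    have m0 := hpos m _ (tot _ _ FZ) Z0 ZE.
    have mE : m = (complex.Re m)%:C by rewrite RRe_real ?gtr0_real.
    have l0 : 0 < complex.Re m by rewrite -ltcR -mE.
    suff : sop S 0 (fun v => Lam S (Z m v) - (complex.Re m)%:C *: Z m (Lam S v)).
      by rewrite -mE.
    apply: eigen_commutator => //; first exact: F_sop FZ.
    have := F_sop _ _ (comm _ _ FZ).
    rewrite ZE thZ ?ZE; last exact: tot FZ.
    by rewrite scalerA -expr2 [in X in X -> _]mE -rmorphXn -mE.
  suff [] : F 0%N (\sum_(m <- r) Z m) /\ P (\sum_(m <- r) Z m) by [].
  elim: r => [|m r [IH1 IH2]].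
    rewrite big_nil; split; first exact: (F_sub 0%N).1.
    rewrite /P th0 (_ : (fun v => _) = fun=> 0); first exact: sop0.
    apply: funext => v; rewrite -[X in Lam S X]/(0 : E) -[X in _ - X]/(0 : E).
    by rewrite (lin0 (Lam_linear S)) subrr.
  have [FZ _] := hZ m.
  rewrite big_cons; split; first exact: subspD.
  set X := \sum_(_ <- _) _ in IH1 IH2 *.
  have thD : th (Z m + X) = th (Z m) + th X.
    have := th_lin 1 (Z m) X (tot _ _ FZ) (tot _ _ IH1).
    by rewrite !scale1r.
  rewrite /P thD (_ : (fun v => _) = (fun v => (Lam S (Z m v) - th (Z m) (Lam S v)) +
    (Lam S (X v) - th X (Lam S v)))); first by apply: sopD; [exact: PZ|exact: IH2].
  apply: funext => v.
  rewrite -[(Z m + X) v]/(Z m v + X v) (linD _ _ (Lam_linear S)).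
  by rewrite -[(th (Z m) + th X) _]/(th (Z m) _ + th X _) opprD addrACA.
exists rho; split.
- by move=> a; case: (hrho a).
- by move=> a; case: (hrho a) => _ /F_sop.
- by move=> a; rewrite rho_th; apply: comm_sop; case: (hrho a).
- by move=> c /hD[X cX /F_sop hX]; exists X.
- move=> a; rewrite rho_th; split=> [h|->//].
  have [_ TI _] := auto_bij FT; apply: TI; rewrite ?th0 ?inE //.
    by case: (hrho a) => _ /(tot 0%N).
  exact: sT.1.
Qed.

(** Regularity does not mention [H^oo], but the twisted commutator gives
    [|D| (b v) = thB b (|D| v) + c v]. Membership in [H^n], expressed by [dm n], thus propagates by
    induction on [n], for all elements of [B] simultaneously. *)
Lemma twisted_comm_smooth (B : set (H -> H)) (thB : (H -> H) -> H -> H) :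
  (forall b, B b -> B (thB b)) ->
  (forall b, B b -> exists2 c, B c & twisted_comm (abs_op ip D) b (thB b) c) ->
  forall b, B b -> forall v : H, smooth_set (laplacian D) v ->
    smooth_set (laplacian D) (b v).
Proof.
move=> BthB Bcomm.
pose dm n (v : H) := exists C : R, forall m,
  \sum_(i < m) kap d i ^+ n * nsq (ip v (e i)) <= C.
have pos n i (v : H) : 0 <= kap d i ^+ n * nsq (ip v (e i)).
  by rewrite mulr_ge0 ?nsq_ge0 // exprn_ge0 // ltW // kap_gt0.
have dmD n (u v : H) : dm n u -> dm n v -> dm n (u + v).
  move=> [C hC] [C' hC']; exists (2 * C + 2 * C') => m.
  apply: (le_trans _ (lerD (ler_wpM2l _ (hC m)) (ler_wpM2l _ (hC' m)))) => //.
  rewrite !mulr_sumr -big_split; apply: ler_sum => i _ /=.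
  rewrite [leRHS](_ : _ = kap d i ^+ n * (2 * nsq (ip u (e i)) + 2 * nsq (ip v (e i))));
    last by ring.
  rewrite (ipDl ip) ler_wpM2l ?nsqD_le //.
  by rewrite exprn_ge0 // ltW // kap_gt0.
have kapE i n (x : R) : kap d i ^+ n.+1 * x = kap d i ^+ n * (`|d i| ^+ 2 * x) + kap d i ^+ n * x.
  by rewrite exprSr /kap real_normK ?num_real //; ring.
have dmS n (v w : H) : (forall i, ip w (e i) = `|d i|%:C * ip v (e i)) ->
    dm n.+1 v <-> dm n w /\ dm n v.
  move=> vw; have E1 i : kap d i ^+ n.+1 * nsq (ip v (e i)) =
      kap d i ^+ n * nsq (ip w (e i)) + kap d i ^+ n * nsq (ip v (e i)).
    by rewrite kapE vw nsqM nsqR.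
  split=> [[C hC]|[[C hC] [C' hC']]]; last first.
    exists (C + C') => m; under eq_bigr do rewrite E1.
    by rewrite big_split lerD.
  split; exists C => m; apply: le_trans (hC m); apply: ler_sum => i _; rewrite E1.
    by rewrite lerDl.
  by rewrite lerDr.
have step n : forall b, B b -> forall v : H, dm n v -> dm n (b v).
  elim: n => [|n IH] b Bb v hv.
    exists (rn (b v) ^+ 2) => m; under eq_bigr do rewrite expr0 mul1r.
    exact: (bessel ip_norm (frame_orth fr) (frame_unit fr)).
  (* The vector [|D| v] exists because [kap d i ^+ n >= 1], so that [dm n.+1] controls the sum of
     its squared coordinates. *)
  have [w hw] : exists w : H, forall i, ip w (e i) = `|d i|%:C * ip v (e i).
    have [C hC] := hv; apply: (diag_exists fr (C := C)) => m.
    apply: le_trans (hC m); apply: ler_sum => i _; rewrite nsqR kapE.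
    have k1 : 1 <= kap d i ^+ n by rewrite exprn_ege1 // kap_ge1.
    have p1 : 0 <= `|d i| ^+ 2 * nsq (ip v (e i)) by rewrite mulr_ge0 ?nsq_ge0 ?sqr_ge0.
    by apply: (le_trans (ler_peMl p1 k1)); rewrite lerDl.
  have [c Bc hc] := Bcomm b Bb.
  have [u bvu uE] := hc v w ((diagonal_absd fr v w).2 hw).
  have [dw dv] := (dmS n v w hw).1 hv.
  apply/(dmS n (b v) u ((diagonal_absd fr (b v) u).1 bvu)); split; last exact: IH.
  have -> : u = c v + thB b w by rewrite -uE subrK.
  by apply: dmD; apply: IH => //; exact: BthB.
by move=> b Bb v /(smooth_setP fr) hv; apply/(smooth_setP fr) => n; exact: step.
Qed.

Lemma calculus_of_regular : regular ip theta pi D ->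
  exists rho, twist_calculus theta pi fr rho.
Proof.
move=> [B [thB [Bb [Blin Bcomp] [Bpi BD] [thl thbij thpi] Bcomm]]].
have BthB b : B b -> B (thB b) by case: thbij => h _ _; exact: h.
have Bsm := twisted_comm_smooth BthB Bcomm.
have restr b : B b -> exists X : E -> E, restricts b X.
  move=> hb; have h (v : E) : exists w : E, smooth_val w = b (smooth_val v).
    apply: smooth_lift; apply: Bsm => //.
    by apply: set_mem; case: v.
  by have [X hX] := choice h; exists X => v; rewrite hX.
pose BE := [set X : E -> E | exists b, B b /\ restricts b X].
have a0 i : 0 <= `|d i| by [].
have absd_eq b b' c X Y Z : twisted_comm (abs_op ip D) b b' c ->
    restricts b X -> restricts b' Y -> restricts c Z ->
    forall v, absd S (fun i => `|d i|) (X v) = Y (absd S (fun i => `|d i|) v) + Z v.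
  move=> bc bX bY cZ v; have [u bvu uE] := bc _ _ (abs_graph fr v).
  apply: val_inj; rewrite /= -bY -cZ -uE addrC subrK.
  have /(diagonal_absd fr) h1 := bvu; have /(diagonal_absd fr) h2 := abs_graph fr (X v).
  by apply: (cf_inj fr) => i; rewrite h1 h2 bX.
have BE_linear X : BE X -> linear X.
  move=> [b [/Bb[lb _] bX]] k v w; apply: val_inj.
  by rewrite /= -!bX /= lb.
have BE_bound X : BE X -> exists M : R, forall v, nrm S (X v) <= M * nrm S v.
  move=> [b [/Bb/bounded_opP[_ [M _ hM]] bX]]; exists M => v.
  by rewrite !nrmE -bX.
have BE_comm X : BE X -> exists X' X'', [/\ BE X', BE X'' &
    forall v, absd S (fun i => `|d i|) (X v) = X' (absd S (fun i => `|d i|) v) + X'' v].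
  move=> [b [Bbb bX]]; have [c Bc hc] := Bcomm b Bbb.
  have [Y bY] := restr _ (BthB _ Bbb); have [Z cZ] := restr _ Bc.
  exists Y, Z; split; [by exists (thB b); split=> //; exact: BthB|by exists c|].
  exact: absd_eq hc bX bY cZ.
have BE_comm' X : BE X -> exists X' X'', [/\ BE X', BE X'' &
    forall v, absd S (fun i => `|d i|) (X' v) = X (absd S (fun i => `|d i|) v) + X'' v].
  (* Surjectivity of [thB] lets the given operator appear as the twisted factor. *)
  move=> [b' [Bb' bX]]; have [_ _ /(_ _ Bb')[b Bbb bb']] := thbij.
  have [c Bc hc] := Bcomm b Bbb.
  have [Y bY] := restr _ Bbb; have [Z cZ] := restr _ Bc.
  exists Y, Z; split; [by exists b|by exists c|].
  by apply: (absd_eq _ _ _ _ _ _ hc bY _ cZ); rewrite bb'.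
have wtd := @wt_absd _ _ _ _ _ _ fr.
have BE_sop X : BE X -> sop S 0 X.
  exact: (regular_sop a0 wtd BE_linear BE_bound BE_comm BE_comm').
have [rho hrho] : exists rho : A -> E -> E, forall a, restricts (pi a) (rho a).
  by have [rho hrho] := choice (fun a => restr _ (Bpi a)); exists rho.
have rhoB a : BE (rho a) by exists (pi a).
have zero_op : bounded_op (0 : H -> H).
  apply/bounded_opP; split=> [k x y|].
    by rewrite -![(0 : H -> H) _]/(0 : H) scaler0 addr0.
  by exists 0 => // x; rewrite -[(0 : H -> H) _]/(0 : H) rn0 mul0r.
(* Density of [H^oo] transfers the kernel condition to [pi], where linearity and injectivity of
   [thB] settle it. *)
have rho0 a : rho a = 0 <-> pi a = 0.
  split=> [h|h].
    apply: (bounded_ext fr (Bb _ (Bpi a)) zero_op (hrho a)).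
    by rewrite h => v.
  by apply: (restricts_inj (hrho a)); rewrite h => v.
have thB0 : B 0 -> thB 0 = 0.
  move=> B0; have := thl (-1) 0 0 B0 B0.
  by rewrite scaleN1r oppr0 addr0 scaleN1r addNr.
exists rho; split=> //.
- by move=> a; exact: BE_sop.
- move=> a; have [c Bc hc] := Bcomm _ (Bpi a); have [Z cZ] := restr _ Bc.
  apply: (regular_commutator a0 wtd BE_linear BE_bound BE_comm BE_comm' (X'' := Z)) => //.
    by exists c.
  by apply: absd_eq hc _ _ cZ => //; rewrite thpi.
- move=> c hc; have Bc := BD c hc; have [X cX] := restr _ Bc.
  by exists X => //; apply: BE_sop; exists c.
- move=> a; split=> /rho0 h; apply/rho0.
    have B0 : B 0 by rewrite -h; exact: Bpi.
    have [_ TI _] := thbij; apply: TI; rewrite ?inE //.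
    by rewrite thpi h thB0.
  have B0 : B 0 by rewrite -h; exact: Bpi.
  by rewrite -thpi h thB0.
Qed.

End ToCalculus.

Unset Implicit Arguments.

Theorem theorem6p1 (R : realType) (H : completeNormedModType R[i])
    (ip : {dot H for @conjc R})
    (A : algType R[i]) (star : A -> A) (theta : {lrmorphism A -> A})
    (pi : A -> H -> H) (D : linop H) :
  twisted_spectral_triple ip star theta pi D ->
  let Delta := laplacian D in
  let r := 2%N in
  let End := smooth Delta -> smooth Delta in
  ((exists (DO : nat -> set End) (th : End -> End),
      [/\ twisted_DO ip r DO th,
          DO_compatible theta pi DO th,
          DO_contains_commutators theta pi DO
        & diagonalizable_pos DO th]) ->
    regular ip theta pi D /\
    (exists (Psi : R -> set End) (Theta : R[i] -> End -> End),
      twisted_PsiDO ip r Psi Theta /\ PsiDO_compatible theta pi Psi Theta)) /\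
  (regular ip theta pi D ->
    exists (DO : nat -> set End) (th : End -> End),
      [/\ twisted_DO ip r DO th,
          DO_compatible theta pi DO th
        & DO_contains_commutators theta pi DO]).
Proof.
move=> tst Delta r End.
have ip_norm := ip_norm tst; have D_sa := D_self_adjoint tst.
have [e [d [e_orth e_unit e_eigen e_total]]] :=
  spectral_theorem ip_norm D_sa (D_compact_resolvent tst).
have fr : eigenframe ip D e d by split.
split=> [[F [th [hDO hcomp hcont hdiag]]]|hreg].
  have [rho tc] := calculus_of_DO fr hDO hcomp hcont hdiag.
  have [T [Tl Tb Tr Tc]] := exists_twist tst tc.
  split; first exact: (regular_Op tst tc Tl Tb Tr Tc).
  by do 2!eexists; split; [exact: (twisted_PsiDO_Op fr)|exact: (PsiDO_compatible_Op tc)].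
have [rho tc] := calculus_of_regular fr hreg.
have [T [Tl Tb Tr Tc]] := exists_twist tst tc.
exists (fun m => Op ip 2 m%:R), T; split.
- exact: (twisted_DO_Op Tl Tb Tc).
- exact: (DO_compatible_Op tc Tr).
- exact: (DO_contains_commutators_Op tc).
Qed.
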